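(* There is an absolute constant $C>0$ such that the following holds. Let $M\geq 2$ be an integer, let $N\ge 2$ be an integer, let $0<\delta\leq 1/2$, and let $A\subseteq[N]$ satisfy $|A|\geq\delta N$. Let $S\subseteq\mathbb{N}$ be multiplicatively $[M]$-syndetic. If there do not exist $x\in\mathbb{Z}$ and $d\in S$ with $x,x+d,x+2d\in A$, then $\log\log N\leq C\log(\delta^{-1})\log(M/\delta)$.
   Context: $\mathbb{N}=\{1,2,3,\dots\}$, $[X]=\{n\in\mathbb{N}:1\le n\le X\}$. A set $S\subseteq\mathbb{N}$ is multiplicatively $[M]$-syndetic if for every $n\in\mathbb{N}$ there exists $t\in\{1,\dots,M\}$ with $nt\in S$. *)

(* Defs.v *)
From mathcomp Require Import all_boot all_order all_algebra.
From mathcomp Require Import finmap.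
From mathcomp Require Import all_classical all_reals all_analysis.

Set Implicit Arguments.
Unset Strict Implicit.
Unset Printing Implicit Defensive.

Import Order.TTheory GRing.Theory Num.Theory.

Local Open Scope classical_set_scope.

(* Here N = {1, 2, ...}, so [0 : nat] is excluded wherever an element of N is
   meant. *)
Definition positive_nats : set nat := [set n | (0 < n)%N].

Definition mult_syndetic (M : nat) (S : set nat) : Prop :=
  forall n : nat, positive_nats n ->
    exists t : nat, (1 <= t <= M)%N /\ S (n * t)%N.

(* [A] is a set of integers because the base point of a progression ranges over
   all of Z. *)
Definition has_3AP_with_difference_in (A : {fset int}) (S : set nat) : Prop :=
  exists (x : int) (d : nat),
    [/\ S d, x \in A, (x + d%:Z)%R \in A & (x + 2 * d%:Z)%R \in A].

(* Main.v *)
(* Let f be the indicator of A, extended by zero to G = Z/n with n about 4N.  Choose g with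
   0 <= g <= gamma 1_[N], gamma a little above delta, nearly minimising the U^3 norm of
   F = f - g.  If that norm is small, three applications of Cauchy-Schwarz replace f by g in the
   count of progressions with difference in S, and the count for g is positive because g is close
   to the constant gamma.  Otherwise the first variation at g says that F cannot be decorrelated
   from f - f' for any competitor f'.  The correlation is governed by the ambiguity function
   (h, xi) |-> sum_x F(x) F(x+h) chi(xi x) on G x G, whose large values are covered, up to a
   negligible part, by polynomially many pieces of small doubling (Balog-Szemeredi-Gowers,
   Plunnecke, Bogolyubov); each piece contains long strings (l q0, l e) in its difference set.
   Dirichlet and Schmidt's theorem on simultaneous approximation of a^2 alpha_i produce one step
   q along which all the quadratic phases of these pieces are almost constant, so an f' obtained by
   averaging f along short progressions inside the cells {y + j q} correlates with nothing.  Such an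
   f' is a competitor unless A has density above gamma on a progression of length T; hence it does,
   and O(log 1/delta) such density increments, each with log N -> log N / poly(M/delta), give the
   bound, since dilating S keeps it syndetic. *)

Require Import Defs.
From HB Require Import structures.
From mathcomp Require Import all_boot all_order all_algebra.
From mathcomp Require Import complex reals.
From mathcomp Require Import zify ring lra.
From mathcomp Require all_fingroup.
From mathcomp Require mathcomp_extra classical_sets functions topology normedtype derive realfun exp.

Set Implicit Arguments.
Unset Strict Implicit.
Unset Printing Implicit Defensive.

Import Order.TTheory GRing.Theory Num.Theory.
Local Open Scope ring_scope.
Local Open Scope complex_scope.

(** * Complex modulus and characters *)

(** No inverse theorem for the U^3 norm is used. The covering by pieces rests on one fact: the
    squared ambiguity function is its own Fourier transform. It is therefore positive definite,
    hence large at many differences of points where it is large, and this is the additive structure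
    that Balog-Szemeredi-Gowers asks for. Squares enter as follows. Replacing l by a l in a string
    (l q0, l e) turns it into (l q, l eta) with q = a q0 and eta = a e. Inside a cell y + j q the
    character then carries the mixed phase eta q l j = a^2 e q0 l j. Once this is negligible, what
    remains is an ordinary correlation in j, small as soon as f - f' has small Fourier sums on the
    cell. No quadratic phase is ever identified, and one a serves all pieces. Sizes and thresholds
    are powers of X, itself polynomial in M/delta. The number of pieces and the number of
    frequencies enter only as exponents of the cell length, which is why a density increment divides
    log N by a polynomial factor. *)

Notation normc := ComplexField.Normc.normc.

Section ComplexModulus.
Variable R : rcfType.
Implicit Types (x y : R) (z w : R[i]).

Lemma sqr_normcE z : normc z ^+ 2 = complex.Re z ^+ 2 + complex.Im z ^+ 2.
Proof. by case: z => a b /=; rewrite sqr_sqrtr // addr_ge0 ?sqr_ge0. Qed.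

Lemma normc_ge0 z : 0 <= normc z.
Proof. by case: z => a b; rewrite sqrtr_ge0. Qed.

Lemma normcD z w : normc (z + w) <= normc z + normc w.
Proof. exact: (@le_normcD R). Qed.

Lemma normc_opp z : normc (- z) = normc z.
Proof. by case: z => a b /=; rewrite !sqrrN. Qed.

Lemma normcB z w : normc (z - w) <= normc z + normc w.
Proof. by rewrite -(normc_opp w) normcD. Qed.

Lemma normc_conj z : normc (conjc z) = normc z.
Proof. by case: z => a b /=; rewrite sqrrN. Qed.

Lemma normc_realE x : normc x%:C = `|x|.
Proof. by rewrite /= expr0n addr0 sqrtr_sqr. Qed.

Lemma ReD z w : complex.Re (z + w) = complex.Re z + complex.Re w.
Proof. by case: z; case: w. Qed.

Lemma Re_realc x : complex.Re x%:C = x.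
Proof. by []. Qed.

Lemma ReZ x z : complex.Re (x%:C * z) = x * complex.Re z.
Proof. by case: z => a b /=; rewrite mul0r subr0. Qed.

Lemma Re_conjc z : complex.Re (conjc z) = complex.Re z.
Proof. by case: z. Qed.

Lemma Re_sum (I : Type) (r : seq I) (P : pred I) (F : I -> R[i]) :
  complex.Re (\sum_(i <- r | P i) F i) = \sum_(i <- r | P i) complex.Re (F i).
Proof. by apply: (big_morph _ ReD). Qed.

Lemma real_complexM x y : (x * y)%:C = x%:C * y%:C.
Proof. exact: rmorphM. Qed.

Lemma real_complex_sum (I : Type) (r : seq I) (P : pred I) (F : I -> R) :
  (\sum_(i <- r | P i) F i)%:C = \sum_(i <- r | P i) (F i)%:C.
Proof. by rewrite rmorph_sum. Qed.

Lemma normc_sum (I : Type) (r : seq I) (P : pred I) (F : I -> R[i]) :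
  normc (\sum_(i <- r | P i) F i) <= \sum_(i <- r | P i) normc (F i).
Proof.
elim/big_rec2: _ => [|i x y _ le_yx]; first by rewrite normc_realE normr0.
by apply: le_trans (normcD _ _) _; rewrite lerD2l.
Qed.

Lemma Re_le_normc z : `|complex.Re z| <= normc z.
Proof.
rewrite -(ler_pXn2r (ltn0Sn 1)) ?nnegrE ?normc_ge0 //.
by rewrite sqr_normcE real_normK ?num_real // lerDl sqr_ge0.
Qed.

Lemma mulcJ z : z * conjc z = (normc z ^+ 2)%:C.
Proof.
rewrite sqr_normcE; case: z => a b /=; apply/eqP; rewrite eq_complex /=.
by apply/andP; split; apply/eqP; ring.
Qed.

Lemma conjcM z w : conjc (z * w) = conjc z * conjc w.
Proof. exact: rmorphM. Qed.

Lemma conjcD z w : conjc (z + w) = conjc z + conjc w.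
Proof. exact: rmorphD. Qed.

Lemma conjc_sum (I : Type) (r : seq I) (P : pred I) (F : I -> R[i]) :
  conjc (\sum_(i <- r | P i) F i) = \sum_(i <- r | P i) conjc (F i).
Proof. exact: rmorph_sum. Qed.

Lemma sqr_normcD z w :
  normc (z + w) ^+ 2 = normc z ^+ 2 + 2 * complex.Re (z * conjc w) + normc w ^+ 2.
Proof. by rewrite !sqr_normcE; case: z => a b; case: w => c d /=; ring. Qed.

Lemma ler_sqr_sum (I : finType) (P : pred I) (a b : I -> R) :
  (\sum_(i | P i) a i * b i) ^+ 2
    <= (\sum_(i | P i) a i ^+ 2) * (\sum_(i | P i) b i ^+ 2).
Proof.
rewrite expr2 !big_distrlr /= -subr_ge0 -sumrB.
under eq_bigr do rewrite -sumrB.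
set S := (X in 0 <= X).
(* Adding to S its copy with i and j exchanged makes every summand a square (Lagrange's
   identity). *)
suff: 0 <= S + S by move=> ?; lra.
rewrite {2}/S exchange_big /= /S -big_split /=; apply: sumr_ge0 => i _.
rewrite -big_split /=; apply: sumr_ge0 => j _.
have -> : a i ^+ 2 * b j ^+ 2 - a i * b i * (a j * b j)
  + (a j ^+ 2 * b i ^+ 2 - a j * b j * (a i * b i)) = (a i * b j - a j * b i) ^+ 2.
  by ring.
exact: sqr_ge0.
Qed.

Lemma sqr_sum_le (I : finType) (P : pred I) (a : I -> R) :
  (\sum_(i | P i) a i) ^+ 2 <= #|P|%:R * \sum_(i | P i) a i ^+ 2.
Proof.
have := ler_sqr_sum P a (fun=> 1).
under eq_bigr do rewrite mulr1.
move=> /le_trans; apply.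
by rewrite expr1n sumr_const mulrC.
Qed.

End ComplexModulus.

(** The ring product serves as the pairing: [chi (k * x)] runs through all characters as k varies,
    and [char_orth] is the nondegeneracy that makes G its own dual. *)
Record is_char (R : rcfType) (G : finComNzRingType) (chi : G -> R[i]) : Prop :=
  IsChar {
    charD : {morph chi : x y / x + y >-> x * y};
    char_norm : forall x, normc (chi x) = 1;
    char_orth : forall x, x != 0 -> \sum_y chi (x * y) = 0 }.

Section Fourier.
Variables (R : rcfType) (G : finComNzRingType) (chi : G -> R[i]).
Hypothesis chiP : is_char chi.
Let n : R := #|G|%:R.

Lemma char0 : chi 0 = 1.
Proof.
have h := charD chiP 0 0; rewrite addr0 in h.
have nz : chi 0 != 0.
  apply/eqP => c0; have := char_norm chiP 0; rewrite c0 normc_realE normr0.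
  by move/eqP; rewrite eq_sym oner_eq0.
by apply: (mulfI nz); rewrite mulr1 -h.
Qed.

Lemma charN x : chi (- x) = conjc (chi x).
Proof.
have nz : chi x != 0.
  apply/eqP => c0; have := char_norm chiP x; rewrite c0 normc_realE normr0.
  by move/eqP; rewrite eq_sym oner_eq0.
apply: (mulfI nz); rewrite -(charD chiP) subrr char0 mulcJ (char_norm chiP).
by rewrite expr1n.
Qed.

Lemma char_sum x : \sum_y chi (x * y) = if x == 0 then n%:C else 0.
Proof.
case: eqP => [->|/eqP /(char_orth chiP) //].
under eq_bigr do rewrite mul0r char0.
by rewrite sumr_const rmorph_nat.
Qed.

Lemma char_parseval (a b : G -> R[i]) :
  \sum_k (\sum_x a x * chi (k * x)) * conjc (\sum_y b y * chi (k * y))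
   = n%:C * \sum_x a x * conjc (b x).
Proof.
under eq_bigr => k _ do rewrite conjc_sum big_distrlr /=.
rewrite exchange_big /= mulr_sumr; apply: eq_bigr => x _.
rewrite exchange_big /= (bigD1 x) //= [X in _ + X]big1 ?addr0 => [|y nyx]; last first.
  under eq_bigr => k _ do rewrite conjcM mulrACA -charN -(charD chiP) -mulrBr (mulrC k).
  by rewrite -mulr_sumr char_sum subr_eq0 eq_sym (negPf nyx) mulr0.
under eq_bigr => k _ do rewrite conjcM mulrACA -charN -(charD chiP) subrr char0 mulr1.
by rewrite sumr_const -[n%:C]/(_) rmorph_nat mulr_natl.
Qed.

Lemma char_plancherel (a : G -> R[i]) :
  \sum_k normc (\sum_x a x * chi (k * x)) ^+ 2 = n * \sum_x normc (a x) ^+ 2.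
Proof.
apply: (@complexI R); rewrite rmorph_sum rmorphM rmorph_sum /=.
under eq_bigr do rewrite -mulcJ.
by rewrite char_parseval; under [in RHS]eq_bigr do rewrite -mulcJ.
Qed.

End Fourier.

(** * Sumsets *)

HB.instance Definition _ (U V : finZmodType) := GRing.Zmodule.on (U * V)%type.

Section Sumsets.
Variable V : finZmodType.
Implicit Types A B C X Y : {set V}.

Definition sumset A B : {set V} := [set x + y | x in A, y in B].
Definition diffset A B : {set V} := [set x - y | x in A, y in B].
Definition nsumset k A : {set V} := iter k (sumset A) [set 0].

Lemma mem_sumset A B x y : x \in A -> y \in B -> x + y \in sumset A B.
Proof. by move=> Ax By; apply/imset2P; exists x y. Qed.

Lemma mem_diffset A B x y : x \in A -> y \in B -> x - y \in diffset A B.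
Proof. by move=> Ax By; apply/imset2P; exists x y. Qed.

Lemma sumsetS A B A' B' :
  A \subset A' -> B \subset B' -> sumset A B \subset sumset A' B'.
Proof.
move=> sA sB; apply/subsetP => _ /imset2P[x y Ax By ->].
by apply: mem_sumset; [apply: (subsetP sA)|apply: (subsetP sB)].
Qed.

Lemma diffsetS A B A' B' :
  A \subset A' -> B \subset B' -> diffset A B \subset diffset A' B'.
Proof.
move=> sA sB; apply/subsetP => _ /imset2P[x y Ax By ->].
by apply: mem_diffset; [apply: (subsetP sA)|apply: (subsetP sB)].
Qed.

Lemma sumsetA A B C : sumset A (sumset B C) = sumset (sumset A B) C.
Proof.
apply/setP/subset_eqP; apply/andP; split; apply/subsetP.
  by move=> _ /imset2P[a _ Aa /imset2P[b c Bb Cc ->] ->]; rewrite addrA !mem_sumset.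
by move=> _ /imset2P[_ c /imset2P[a b Aa Bb ->] Cc ->]; rewrite -addrA !mem_sumset.
Qed.

Lemma nsumsetS k A B : A \subset B -> nsumset k A \subset nsumset k B.
Proof. by move=> sAB; elim: k => //= k IH; apply: sumsetS. Qed.

Lemma mem_nsumsetD j k A x y :
  x \in nsumset j A -> y \in nsumset k A -> x + y \in nsumset (j + k) A.
Proof.
elim: j x => [|j IH] x /=; first by rewrite inE => /eqP-> Hy; rewrite add0r add0n.
move=> /imset2P[a x' Aa Hx' ->] Hy; rewrite -addrA; apply: mem_sumset => //.
exact: IH.
Qed.

(** Petridis's induction on C. When c is added to D, the new points of X + B + C are translates of
    points outside X1 + B, where X1 collects the x with x + B + c already inside X + B + D.
    Minimality of the ratio of X, applied to X1, pays for them, since |X + C| grows by at least |X|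
    - |X1|. *)
Lemma petridis B X :
  (forall Y, Y \subset X -> #|sumset X B| * #|Y| <= #|sumset Y B| * #|X|)%N ->
  forall C, (#|sumset (sumset X B) C| * #|X| <= #|sumset X B| * #|sumset X C|)%N.
Proof.
move=> minX C; have [m] := ubnP #|C|; elim: m C => // m IH C leC.
have [->|[c Cc]] := set_0Vmem C.
  by rewrite [sumset _ set0](_ : _ = set0) ?cards0 //;
    apply/setP => x; rewrite inE; apply/negP => /imset2P[? ? _]; rewrite inE.
pose D := C :\ c.
have CE : C = c |: D by rewrite setD1K.
have /IH {IH} : (#|D| < m)%N by move: leC; rewrite CE cardsU1 !inE eqxx.
set S := sumset (sumset X B) D => IH.
pose X1 := [set x in X | [forall b in B, x + b + c \in S]].
have sX1 : X1 \subset X by apply/subsetP => x; rewrite inE => /andP[].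
have h1 : (#|sumset (sumset X B) C| + #|sumset X1 B| <= #|S| + #|sumset X B|)%N.
  pose T := [set y + c | y in sumset X B :\: sumset X1 B].
  have sST : sumset (sumset X B) C \subset S :|: T.
    apply/subsetP => _ /imset2P[y d By Cd ->]; rewrite inE.
    have [Dd|nDd] := boolP (d \in D); first by rewrite mem_sumset.
    have -> : d = c by move: Cd; rewrite CE 2!inE (negPf nDd) orbF => /eqP.
    have [|nB1] := boolP (y \in sumset X1 B).
      case/imset2P => x b; rewrite inE => /andP[Xx /forallP hx] Bb ->.
      by have := hx b; rewrite Bb /= => ->.
    by apply/orP; right; apply: imset_f; rewrite inE nB1.
  have cT : #|T| = (#|sumset X B| - #|sumset X1 B|)%N.
    rewrite card_imset; last by move=> ? ? /addIr.
    by rewrite cardsD (setIidPr _) //; apply: sumsetS.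
  have := leq_trans (subset_leq_card sST) (leq_card_setU _ _).1.
  have := subset_leq_card (sumsetS sX1 (subxx B)); rewrite cT; lia.
have h2 : (#|sumset X D| + #|X| <= #|sumset X C| + #|X1|)%N.
  pose X2 := [set x in X | x + c \in sumset X D].
  have sX2 : X2 \subset X1.
    apply/subsetP => x; rewrite !inE => /andP[Xx /imset2P[x1 d Xx1 Dd e]].
    rewrite Xx /=; apply/forallP => b; apply/implyP => Bb.
    by rewrite addrAC e addrAC !mem_sumset.
  pose T := [set x + c | x in X :\: X2].
  have dT : [disjoint sumset X D & T].
    rewrite disjoint_sym disjoint_subset; apply/subsetP => z /imsetP[x].
    by rewrite !inE => /andP[nx2 Xx] ->; move: nx2; rewrite Xx.
  have sT : sumset X D :|: T \subset sumset X C.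
    rewrite subUset sumsetS ?subD1set //=; apply/subsetP => _ /imsetP[x + ->].
    by rewrite inE => /andP[_ Xx]; rewrite mem_sumset.
  have := subset_leq_card sT.
  rewrite cardsU (disjoint_setI0 dT) cards0 subn0 card_imset; last by move=> ? ? /addIr.
  have sX2X : X2 \subset X by apply: subset_trans sX2 sX1.
  rewrite cardsD (setIidPr sX2X).
  have aux (a x x2 b x1 : nat) : (x2 <= x -> x2 <= x1 -> a + (x - x2) <= b ->
    a + x <= b + x1)%N by lia.
  exact: aux (subset_leq_card sX2X) (subset_leq_card sX2).
have h3 := minX _ sX1.
move: IH h1 h2 h3; nia.
Qed.

(** Fix a representation d = b - c of every difference. Then (d, x) |-> (x + b, x + c) is injective,
    because the difference of the two coordinates recovers d. *)
Lemma ruzsa_triangle B C X :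
  (#|diffset B C| * #|X| <= #|sumset X B| * #|sumset X C|)%N.
Proof.
pose P (d : V) (bc : V * V) := (bc.1 \in B) && (bc.2 \in C) && (d == bc.1 - bc.2).
have exP d : d \in diffset B C -> exists bc, P d bc.
  by case/imset2P => b c Bb Cc ->; exists (b, c); rewrite /P /= Bb Cc eqxx.
pose s d := if [pick bc | P d bc] is Some bc then bc else (0, 0).
have sP d : d \in diffset B C -> P d (s d).
  rewrite /s => /exP[bc Hbc]; case: pickP => [//|/(_ bc)]; by rewrite Hbc.
pose f (p : V * V) := (p.2 + (s p.1).1, p.2 + (s p.1).2).
rewrite -!cardsX -(@card_in_imset _ _ f).
  apply: subset_leq_card; apply/subsetP => _ /imsetP[[d x] + ->].
  rewrite !inE /= => /andP[/sP /andP[/andP[Bb Cc] _] Xx].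
  by rewrite !mem_sumset.
move=> [d x] [d' x']; rewrite !inE /= => /andP[/sP /andP[_ /eqP e] _].
move=> /andP[/sP /andP[_ /eqP e'] _] [e1 e2].
have ed : d = d'.
  by rewrite e e' -[LHS](addrKA x) -[RHS](addrKA x') ![_ + x]addrC ![_ + x']addrC e1 e2.
by move: e1; rewrite ed => /addIr ->.
Qed.

(** With B = - A, take a nonempty X in A minimising |X + B| / |X|; this ratio is at most K.
    Petridis's inequality with C = i B gives |X + i B| <= K^i |X|, and Ruzsa's inequality then
    bounds k B - j B, which is j A - k A. *)
Lemma plunnecke (A : {set V}) (K j k : nat) : A != set0 ->
  (#|diffset A A| <= K * #|A|)%N ->
  (#|diffset (nsumset j A) (nsumset k A)| <= K ^ (j + k) * #|A|)%N.
Proof.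
move=> /set0Pn[a0 Aa0] dblA.
pose B := [set - x | x in A].
have AB : sumset A B = diffset A A.
  apply/setP/subset_eqP; apply/andP; split; apply/subsetP.
    by move=> _ /imset2P[x _ Ax /imsetP[y Ay ->] ->]; apply: mem_diffset.
  by move=> _ /imset2P[x y Ax Ay ->]; apply: mem_sumset => //; apply: imset_f.
pose le_ratio X Y := (#|sumset X B| * #|Y| <= #|sumset Y B| * #|X|)%N.
have [X [sXA X0 minX]] : exists X, [/\ X \subset A, X != set0 &
    forall Y, Y \subset A -> Y != set0 -> le_ratio X Y].
  have A0 : A != set0 by apply/set0Pn; exists a0.
  have : forall s : seq {set V}, (forall Y, Y \in s -> Y \subset A /\ Y != set0) ->
     exists X, [/\ X \subset A, X != set0 & forall Y, Y \in s -> le_ratio X Y].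
    elim=> [|Y s IH] hs; first by exists A; split.
    have [|X [sX X0 hX]] := IH; first by move=> Z Zs; apply: hs; rewrite inE Zs orbT.
    have [sY Y0] := hs Y (mem_head _ _).
    have [le1|lt1] := leqP (#|sumset X B| * #|Y|) (#|sumset Y B| * #|X|).
      by exists X; split=> // Z; rewrite inE => /predU1P[->|/hX].
    exists Y; split=> // Z; rewrite inE => /predU1P[->|/hX]; rewrite /le_ratio //.
    have : (0 < #|X|)%N by rewrite card_gt0.
    move: lt1; move: #|X| #|Y| #|Z| #|sumset X B| #|sumset Y B| #|sumset Z B|.
    move=> x y z xb yb zb h1 h2 h3.
    rewrite -(leq_pmul2l h2); apply: (@leq_trans (xb * y * z)); first by nia.
    by nia.
  move=> /(_ (enum [set Y in powerset A | Y != set0]))[|X [? ? hX]].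
    by move=> Y; rewrite mem_enum !inE => /andP[].
  by exists X; split=> // Y sY Y0; apply: hX; rewrite mem_enum !inE sY.
have cX : (0 < #|X|)%N by rewrite card_gt0.
have cA : (0 < #|A|)%N by apply/card_gt0P; exists a0.
have XB : (#|sumset X B| <= K * #|X|)%N.
  have := minX A (subxx A); rewrite /le_ratio AB => /(_ _)/leq_trans h.
  have /h : A != set0 by apply/set0Pn; exists a0.
  move=> /(_ (K * #|A| * #|X|))%N; rewrite leq_mul2r dblA orbT => /(_ isT).
  by rewrite mulnAC leq_pmul2r.
have pet : forall C, (#|sumset (sumset X B) C| <= K * #|sumset X C|)%N.
  move=> C; have := @petridis B X _ C.
  have h : (forall Y, Y \subset X -> #|sumset X B| * #|Y| <= #|sumset Y B| * #|X|)%N.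
    move=> Y sY; have [->|Y0] := eqVneq Y set0; first by rewrite cards0 muln0.
    by apply: minX => //; apply: subset_trans sY sXA.
  move=> /(_ h) /leq_trans/(_ (leq_mul XB (leqnn _))).
  by rewrite mulnAC leq_pmul2r.
have it : forall i, (#|sumset X (nsumset i B)| <= K ^ i * #|X|)%N.
  elim=> [|i IH] /=.
    rewrite mul1n (_ : sumset X [set 0] = X) //.
    apply/setP/subset_eqP; apply/andP; split; apply/subsetP.
      by move=> _ /imset2P[x y Xx /set1P-> ->]; rewrite addr0.
    by move=> x Xx; rewrite -[x]addr0; apply: mem_sumset => //; rewrite inE.
  by rewrite sumsetA; apply: leq_trans (pet _) _; rewrite expnS -mulnA leq_mul2l IH orbT.
have NB : forall i x, (x \in nsumset i A) = (- x \in nsumset i B).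
  elim=> [|i IH] x /=; first by rewrite !inE oppr_eq0.
  apply/idP/idP.
    case/imset2P => y z Ay Hz ->; rewrite opprD; apply: mem_sumset; first exact: imset_f.
    by rewrite -IH.
  case/imset2P => _ z /imsetP[y Ay ->] Hz e; rewrite -[x]opprK e opprD opprK.
  by apply: mem_sumset => //; rewrite IH opprK.
have -> : diffset (nsumset j A) (nsumset k A) = diffset (nsumset k B) (nsumset j B).
  apply/setP/subset_eqP; apply/andP; split; apply/subsetP => _ /imset2P[x y Hx Hy ->].
    by rewrite -[x]opprK addrC; apply: mem_diffset; rewrite -NB.
  by rewrite -[x]opprK addrC; apply: mem_diffset; rewrite NB opprK.
have := ruzsa_triangle (nsumset k B) (nsumset j B) X.
move=> /leq_trans/(_ (leq_mul (it k) (it j))).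
rewrite mulnACA -expnD mulnA leq_pmul2r // addnC => /leq_trans; apply.
by rewrite leq_mul2l subset_leq_card ?orbT.
Qed.

End Sumsets.

(** * The Balog-Szemeredi-Gowers theorem *)

Lemma sqrn_sum_le (I : finType) (P : pred I) (a : I -> nat) :
  ((\sum_(i | P i) a i) ^ 2 <= #|P| * \sum_(i | P i) a i ^ 2)%N.
Proof.
rewrite -(leq_pmul2l (isT : (0 < 2)%N)).
have -> : ((\sum_(i | P i) a i) ^ 2 = \sum_(i | P i) \sum_(j | P j) a i * a j)%N.
  by rewrite -mulnn big_distrlr.
apply: (@leq_trans (\sum_(i | P i) \sum_(j | P j) (a i ^ 2 + a j ^ 2))%N).
  rewrite big_distrr /=; apply: leq_sum => i _.
  rewrite big_distrr /=; apply: leq_sum => j _.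
  exact: (nat_Cauchy (a i) (a j)).1.
under eq_bigr do rewrite big_split /= sum_nat_const.
rewrite big_split /= sum_nat_const -big_distrr /=; lia.
Qed.

Section BalogSzemerediGowers.
Variables (V : finZmodType) (Y P : {set V}) (k : nat).

(** Graph on Y joining a to y when a - y is in P. A pair is [bad] when fewer than |Y| / (32 k^2)
    vertices are adjacent to both members, and [bd] counts ordered bad pairs. *)
Let nb (y : V) := [set a in Y | a - y \in P].
Let cn (a a' : V) := [set y in Y | (a - y \in P) && (a' - y \in P)].
Let bad (a a' : V) := (32 * k ^ 2 * #|cn a a'| < #|Y|)%N.
Let bd (A : {set V}) := (\sum_(a in A) #|[set a' in A | bad a a']|)%N.

(** Double counting: a bad pair lies in [nb y] for exactly |cn a a'| of the y, and there are at most
    |Y|^2 pairs. *)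
Lemma sum_bad_nbhd : (32 * k ^ 2 * (\sum_(y in Y) bd (nb y)) <= #|Y| ^ 3)%N.
Proof.
have -> : (\sum_(y in Y) bd (nb y)
   = \sum_(a in Y) \sum_(a' in Y | bad a a') #|cn a a'|)%N.
  rewrite /bd; under eq_bigr => y _.
    under eq_bigl => a do rewrite inE; rewrite big_mkcondr /=.
    over.
  rewrite exchange_big /=; apply: eq_bigr => a _.
  under eq_bigr => y _.
    rewrite (_ : (if _ then _ else _) =
      \sum_(a' in Y | bad a a') (((a - y)%R \in P) && ((a' - y)%R \in P) : nat))%N; last first.
      case: ifP => _; last by rewrite big1.
      rewrite -sum1_card big_mkcond /= [RHS]big_mkcond /=; apply: eq_bigr => a' _.
      by rewrite !inE; case: (a' \in Y) (a' - y \in P) (bad a a') => [] [] [].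
    over.
  rewrite exchange_big /=; apply: eq_bigr => a' _.
  rewrite -sum1_card; under [RHS]eq_bigl => y do rewrite inE.
  by rewrite [RHS]big_mkcondr /=; apply: eq_bigr => y _; case: ifP.
rewrite big_distrr /=; under eq_bigr do rewrite big_distrr /=.
apply: (@leq_trans (\sum_(a in Y) \sum_(a' in Y) #|Y|))%N.
  apply: leq_sum => a _; rewrite big_mkcondr /=; apply: leq_sum => a' _.
  by case: ifP => // /ltnW.
by rewrite !sum_nat_const !expnS expn0 muln1.
Qed.

Hypothesis k_gt0 : (0 < k)%N.
Hypothesis dense : (#|Y| ^ 2 <= k * \sum_(y in Y) #|nb y|)%N.
Hypothesis Y0 : (0 < #|Y|)%N.

(** Averaging over y: by Cauchy-Schwarz the second moment of |nb y| is at least |Y|^3 / k^2, while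
    the weighted bad pairs cost at most |Y|^3 in total, so some y pays for both terms on the
    left. *)
Lemma good_nbhd : exists2 y, y \in Y &
  (#|Y| ^ 2 + 32 * k ^ 2 * bd (nb y) <= 2 * k ^ 2 * #|nb y| ^ 2)%N.
Proof.
apply/exists_inP; apply: contraT; rewrite negb_exists_in => /forall_inP h.
have h1 : (2 * k ^ 2 * \sum_(y in Y) #|nb y| ^ 2 < 2 * #|Y| ^ 3)%N.
  apply: (@leq_trans (\sum_(y in Y) (#|Y| ^ 2 + 32 * k ^ 2 * bd (nb y))))%N; last first.
    rewrite big_split /= sum_nat_const -big_distrr /=.
    by rewrite -expnS mul2n -addnn leq_add2l; exact: sum_bad_nbhd.
  rewrite big_distrr /=.
  have [y Yy] : exists y, y \in Y by apply/card_gt0P.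
  rewrite (bigD1 y) //= [X in (_ < X)%N](bigD1 y) //= -addSn; apply: leq_add.
    by rewrite ltnNge h.
  by apply: leq_sum => z /andP[Yz _]; apply: ltnW; rewrite ltnNge h.
have h2 := sqrn_sum_le (mem Y) (fun y => #|nb y|).
have h3 : (#|Y| ^ 4 <= k ^ 2 * (#|Y| * \sum_(y in Y) #|nb y| ^ 2))%N.
  apply: leq_trans (_ : (k * \sum_(y in Y) #|nb y|) ^ 2 <= _)%N; first by
    rewrite (_ : 4 = 2 * 2)%N // expnM leq_exp2r.
  by rewrite expnMn leq_mul2l h2 orbT.
move: h1 h3; set S := (\sum_(y in Y) #|nb y| ^ 2)%N; move: S => S h1 h3.
have : (2 * #|Y| ^ 4 < 2 * #|Y| ^ 4)%N.
  apply: leq_ltn_trans (_ : 2 * (k ^ 2 * (#|Y| * S)) < _)%N; first by lia.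
  have -> : (2 * (k ^ 2 * (#|Y| * S)) = #|Y| * (2 * k ^ 2 * S))%N by lia.
  have -> : (2 * #|Y| ^ 4 = #|Y| * (2 * #|Y| ^ 3))%N by rewrite [(_ ^ 4)%N]expnS; lia.
  by rewrite ltn_pmul2l.
by rewrite ltnn.
Qed.

(** Any a, a' in A have at least half of A1 as common good partners c, and each c supplies many y,
    y' with a - a' = (a - y) - (c - y) + (c - y') - (a' - y'). So every difference has at least |A1|
    (|Y| / (32 k^2))^2 / 2 representations by four elements of P, out of |P|^4 in all. *)
Lemma bsg : exists A : {set V}, [/\ A \subset Y, (#|Y| <= 4 * k * #|A|)%N &
  (#|diffset A A| * #|Y| ^ 3 <= 4096 * k ^ 5 * #|P| ^ 4)%N].
Proof.
have [y Yy hy] := good_nbhd.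
set A1 := nb y in hy.
have sA1 : A1 \subset Y by apply/subsetP => a; rewrite inE => /andP[].
clearbody A1.
(* Markov's inequality: by [bdA1], at most a quarter of A1 has too many bad partners. *)
pose A := [set a in A1 | 4 * #|[set a' in A1 | bad a a']| <= #|A1|]%N.
have sAA1 : A \subset A1 by apply/subsetP => a; rewrite inE => /andP[].
have k2 : (0 < k ^ 2)%N by rewrite expn_gt0 k_gt0.
have bdA1 : (16 * bd A1 <= #|A1| ^ 2)%N.
  have k2' : (0 < 2 * k ^ 2)%N by rewrite muln_gt0.
  rewrite -(leq_pmul2l k2').
  by apply: leq_trans hy; rewrite -[X in (X <= _)%N]add0n leq_add //; lia.
have YA1 : (#|Y| <= 2 * k * #|A1|)%N.
  rewrite -(leq_sqr) !expnMn; nia.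
have A1pos : (0 < #|A1|)%N by move: YA1 Y0; case: #|A1| => //; lia.
have cA : (3 * #|A1| <= 4 * #|A|)%N.
  have h : (#|A1 :\: A| * #|A1| <= 4 * bd A1)%N.
    rewrite -sum_nat_const /bd [X in (_ <= 4 * X)%N](big_setID A) /= mulnDr.
    apply: leq_trans (leq_addl _ _); rewrite big_distrr /=; apply: leq_sum => a.
    by rewrite inE [a \in A]inE => /andP[+ A1a]; rewrite A1a /= -ltnNge => /ltnW.
  have : (4 * #|A1 :\: A| <= #|A1|)%N.
    rewrite -(leq_pmul2r A1pos); apply: leq_trans (_ : 16 * bd A1 <= _)%N; first by lia.
    by rewrite mulnn; exact: bdA1.
  have := cardsID A A1; rewrite (setIidPr sAA1); lia.
exists A; split; first exact: subset_trans sAA1 sA1.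
  by apply: leq_trans YA1 _; nia.
pose Q (d : V) := [set p : V * V * (V * V) | [&& p.1.1 \in P, p.1.2 \in P, p.2.1 \in P,
   p.2.2 \in P & p.1.1 - p.1.2 + (p.2.1 - p.2.2) == d]].
have cQ : (\sum_(d in diffset A A) #|Q d| <= #|P| ^ 4)%N.
  pose PP := setX (setX P P) (setX P P).
  have -> : (#|P| ^ 4 = #|PP|)%N by rewrite !cardsX; lia.
  rewrite -[X in (_ <= X)%N]sum1_card.
  rewrite (partition_big (fun p : V * V * (V * V) => p.1.1 - p.1.2 + (p.2.1 - p.2.2)) predT) //=.
  rewrite [X in (_ <= X)%N](bigID (mem (diffset A A))) /=.
  apply: leq_trans (leq_addr _ _); apply: leq_sum => d _.
  rewrite -sum1_card; apply/eq_leq/eq_bigl => p.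
  by rewrite !inE /= -!andbA.
pose t := (#|A1| * #|Y| ^ 2)%N.
have lQ d : d \in diffset A A -> (t <= 2 * (32 * k ^ 2) ^ 2 * #|Q d|)%N.
  case/imset2P => a a' Aa Aa' ->.
  pose g := [set c in A1 | ~~ bad a c && ~~ bad a' c].
  have cg : (#|A1| <= 2 * #|g|)%N.
    have : (#|A1| <= #|g| + (#|[set c in A1 | bad a c]| + #|[set c in A1 | bad a' c]|))%N.
      apply: leq_trans (_ : #|g :|: ([set c in A1 | bad a c] :|: [set c in A1 | bad a' c])| <= _)%N.
        apply: subset_leq_card; apply/subsetP => c A1c; rewrite !inE A1c /=.
        by case: (bad a c); case: (bad a' c).
      apply: leq_trans (leq_card_setU _ _).1 _; rewrite leq_add2l.
      exact: (leq_card_setU _ _).1.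
    move: Aa Aa'; rewrite !inE => /andP[_ h1] /andP[_ h2] h3; lia.
  pose W := [set w : V * (V * V) | [&& w.1 \in g, w.2.1 \in cn a w.1 & w.2.2 \in cn a' w.1]].
  pose f (w : V * (V * V)) : V * V * (V * V) :=
    ((a - w.2.1, w.1 - w.2.1), (w.1 - w.2.2, a' - w.2.2)).
  have cW : (#|g| * #|Y| ^ 2 <= (32 * k ^ 2) ^ 2 * #|W|)%N.
    have -> : #|W| = (\sum_(c in g) #|cn a c| * #|cn a' c|)%N.
      under [RHS]eq_bigr => c _ do rewrite -cardsX -sum1_card.
      rewrite pair_big_dep /= -sum1_card; apply: eq_bigl => w.
      by rewrite !inE.
    rewrite big_distrr /= -sum_nat_const; apply: leq_sum => c.
    rewrite inE => /andP[_ /andP[]]; rewrite -!leqNgt => h1 h2.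
    by have := leq_mul h1 h2; rewrite mulnACA !mulnn.
  have WQ : (#|W| <= #|Q (a - a')%R|)%N.
    rewrite -(@card_in_imset _ _ f) => [|[c [b b']] [c2 [b2 b2']] _ _]; last first.
      case=> e1 e2 e3 _.
      have eb : b = b2 by move/addrI/oppr_inj: e1.
      by move: e2 e3; rewrite eb => /addIr -> /addrI/oppr_inj ->.
    apply: subset_leq_card; apply/subsetP => _ /imsetP[[c [b b']] + ->].
    rewrite !inE /= => /andP[_ /andP[/andP[_ /andP[-> ->]] /andP[_ /andP[-> ->]]]] /=.
    by apply/eqP; rewrite !opprB !subrKA.
  rewrite /t; move: cg cW WQ; nia.
have : (#|diffset A A| * t <= 2 * (32 * k ^ 2) ^ 2 * #|P| ^ 4)%N.
  rewrite -sum_nat_const; apply: leq_trans (_ : 2 * (32 * k ^ 2) ^ 2 *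
    \sum_(d in diffset A A) #|Q d| <= _)%N; last by rewrite leq_mul2l cQ orbT.
  by rewrite big_distrr /=; apply: leq_sum.
rewrite /t => h.
apply: leq_trans (_ : 2 * k * (#|diffset A A| * (#|A1| * #|Y| ^ 2)) <= _)%N.
  by have := leq_mul (leqnn (#|diffset A A| * #|Y| ^ 2)%N) YA1; rewrite (expnS _ 2); lia.
apply: leq_trans (leq_mul (leqnn _) h) _.
by apply/eq_leq; move: (#|P| ^ 4)%N => p; rewrite !expnS !expn0; lia.
Qed.

End BalogSzemerediGowers.

(** * The ambiguity function *)

(** The eighth power of the Gowers U^3 norm without normalisation: the square accounts for the third
    differencing. *)
Definition U3 (R : rcfType) (G : finComNzRingType) (F : G -> R) : R :=
  \sum_h \sum_k (\sum_x F x * F (x + h) * F (x + k) * F (x + h + k)) ^+ 2.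

Section Ambiguity.
Variables (R : rcfType) (G : finComNzRingType) (chi : G -> R[i]).
Hypothesis chiP : is_char chi.
Let n : R := #|G|%:R.

Definition amb (H F : G -> R) (u : G * G) : R[i] :=
  \sum_x (H x * F (x + u.1))%:C * chi (u.2 * x).

Definition ambs F u : R := normc (amb F F u) ^+ 2.

Lemma order_gt0 : 0 < n.
Proof. by rewrite ltr0n; apply/card_gt0P; exists 0. Qed.

Lemma ambs_ge0 F u : 0 <= ambs F u.
Proof. exact: sqr_ge0. Qed.

Section Bounded.
Variables H F : G -> R.
Hypotheses (H1 : forall x, `|H x| <= 1) (F1 : forall x, `|F x| <= 1).

Lemma normM_le1 (a b : R) : `|a| <= 1 -> `|b| <= 1 -> `|a * b| <= 1.
Proof. by move=> ha hb; rewrite normrM mulr_ile1. Qed.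

Lemma amb_le u : normc (amb H F u) <= n.
Proof.
apply: le_trans (normc_sum _ _ _) _.
rewrite /n -sumr_const; apply: ler_sum => x _.
rewrite ComplexField.Normc.normcM (char_norm chiP) mulr1 normc_realE.
exact: normM_le1.
Qed.

Lemma amb_fibre_le h : \sum_k normc (amb H F (h, k)) ^+ 2 <= n ^+ 2.
Proof.
rewrite (char_plancherel chiP (fun x => (H x * F (x + h))%:C)) expr2 ler_wpM2l ?ler0n //.
rewrite /n -sumr_const; apply: ler_sum => x _.
by rewrite normc_realE exprn_ile1 ?normr_ge0 //; apply: normM_le1.
Qed.

Lemma amb_sum_le : \sum_u normc (amb H F u) ^+ 2 <= n ^+ 3.
Proof.
rewrite -(pair_bigA _ (fun h k => normc (amb H F (h, k)) ^+ 2)) /=.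
apply: le_trans (_ : \sum_(h : G) n ^+ 2 <= _).
  by apply: ler_sum => h _; apply: amb_fibre_le.
by rewrite sumr_const -[X in X <= _]mulr_natl -exprS.
Qed.

End Bounded.

Lemma amb_swap H F h k : normc (amb F H (h, k)) = normc (amb H F (- h, k)).
Proof.
rewrite /amb /= (reindex_inj (addIr (- h))) /=.
under eq_bigr => x _ do rewrite subrK mulrC mulrBr -[k * x - _]addrC (charD chiP) -mulrA
  [(F _ * _)]mulrC [chi (k * x) * _]mulrC.
by rewrite -mulr_sumr ComplexField.Normc.normcM (char_norm chiP) mul1r.
Qed.

Lemma ambs_opp1 F h k : ambs F (- h, k) = ambs F (h, k).
Proof. by rewrite /ambs -amb_swap. Qed.

(** For a fixed shift h this is the Fourier expansion of an autocorrelation. Its coefficients are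
    symmetric in h and j, which is the source of [ambs_self_dual]. *)
Lemma amb_diag_sqr (F : G -> R) h k :
  (ambs F (h, k))%:C = \sum_j
    (\sum_x F x * F (x + h) * F (x + j) * F (x + h + j))%:C * chi (k * j).
Proof.
rewrite /ambs -mulcJ /amb /= conjc_sum big_distrlr /= exchange_big /=.
under eq_bigr => x _ do rewrite (reindex_inj (addrI x)) /=.
rewrite exchange_big /=; apply: eq_bigr => j _.
rewrite real_complex_sum mulr_suml; apply: eq_bigr => x _.
rewrite conjcM -(charN chiP) mulrACA -(charD chiP) -mulrBr [x + j - x]addrAC subrr add0r.
congr (_ * _); rewrite conjc_real -rmorphM; congr (_%:C).
by rewrite [x + j + h]addrAC; ring.
Qed.

(** Plancherel in k, applied to the expansion [amb_diag_sqr]. *)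
Lemma sum_amb4 F : \sum_u normc (amb F F u) ^+ 4 = n * U3 F.
Proof.
rewrite -(pair_bigA _ (fun h k => normc (amb F F (h, k)) ^+ 4)) /= /U3 mulr_sumr.
apply: eq_bigr => h _.
have -> : \sum_k normc (amb F F (h, k)) ^+ 4 = \sum_k normc ((ambs F (h, k))%:C) ^+ 2.
  by apply: eq_bigr => k _; rewrite normc_realE ger0_norm ?ambs_ge0 // -exprM.
under eq_bigr do rewrite amb_diag_sqr.
rewrite (char_plancherel chiP); congr (_ * _); apply: eq_bigr => j _.
by rewrite normc_realE real_normK ?num_real.
Qed.

(** Self-duality on G x G for the pairing k z + h e. Summing over k isolates the coefficient at j =
    - z, and the symmetry of the coefficients turns the rest into the expansion of
    [ambs F (- z, e)]. *)
Lemma ambs_self_dual F z e :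
  (n * ambs F (z, e))%:C = \sum_u (ambs F u)%:C * chi (u.2 * z + u.1 * e).
Proof.
rewrite -(pair_bigA _ (fun h k => (ambs F (h, k))%:C * chi (k * z + h * e))) /=.
pose c h j := \sum_x F x * F (x + h) * F (x + j) * F (x + h + j).
transitivity (\sum_h n%:C * (c h (- z))%:C * chi (h * e)); last first.
  apply: eq_bigr => h _.
  under eq_bigr => k _ do rewrite amb_diag_sqr mulr_suml.
  rewrite exchange_big /= (bigD1 (- z)) //= [X in _ + X]big1 ?addr0 => [|j jz].
    under eq_bigr => k _ do rewrite (charD chiP) [chi _ * chi (h * e)]mulrC mulrACA -(charD chiP)
      mulrN addNr (char0 chiP) mulr1.
    by rewrite sumr_const rmorph_nat -mulrA mulr_natl.
  under eq_bigr => k _ do rewrite (charD chiP) [chi _ * chi (h * e)]mulrC mulrACA -(charD chiP)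
    -mulrDr mulrC.
  under eq_bigr => k _ do rewrite [k * _]mulrC.
  by rewrite -mulr_suml (char_sum chiP) addr_eq0 (negPf jz) mul0r.
rewrite rmorphM /=; under [RHS]eq_bigr do rewrite -mulrA.
rewrite -mulr_sumr; congr (_ * _).
rewrite -ambs_opp1 amb_diag_sqr; apply: eq_bigr => h _.
rewrite [e * h]mulrC; congr (_%:C * _); rewrite /c; apply: eq_bigr => x _.
by rewrite [x - z + h]addrAC; ring.
Qed.

(** Self-duality writes the sum over Y as a sum of [ambs F v] against the exponential sum E v of Y.
    Cauchy-Schwarz with weight [ambs F], of mass at most n^3, leaves |E v|^2, and self-duality turns
    this back into values at differences of Y. *)
Lemma ambs_posdef F (Y : {set G * G}) : (forall x, `|F x| <= 1) ->
  (\sum_(y in Y) ambs F y) ^+ 2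
    <= n ^+ 2 * \sum_(y in Y) \sum_(z in Y) ambs F (y - z).
Proof.
move=> F1.
pose E (v : G * G) : R[i] := \sum_(y in Y) chi (v.2 * y.1 + v.1 * y.2).
set S := \sum_(y in Y) ambs F y.
have n0 := order_gt0.
have hS : n * S <= \sum_v ambs F v * normc (E v).
  have -> : n * S = normc (\sum_v (ambs F v)%:C * E v).
    have -> : \sum_v (ambs F v)%:C * E v = (n * S)%:C.
      under eq_bigr do rewrite mulr_sumr.
      rewrite exchange_big /= mulr_sumr real_complex_sum; apply: eq_bigr => -[z e] _.
      by rewrite ambs_self_dual.
    rewrite normc_realE ger0_norm //; apply: mulr_ge0; first exact: ltW.
    by apply: sumr_ge0 => y _; apply: ambs_ge0.
  apply: le_trans (normc_sum _ _ _) _; apply: ler_sum => v _.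
  by rewrite ComplexField.Normc.normcM normc_realE ger0_norm ?ambs_ge0.
have S0 : 0 <= S by apply: sumr_ge0 => y _; apply: ambs_ge0.
have hE : \sum_v ambs F v * normc (E v) ^+ 2
    = n * \sum_(y in Y) \sum_(z in Y) ambs F (y - z).
  have hEv v : (normc (E v) ^+ 2)%:C = \sum_(y in Y) \sum_(z in Y)
      chi (v.2 * (y.1 - z.1) + v.1 * (y.2 - z.2)).
    rewrite -mulcJ /E conjc_sum big_distrlr /=.
    apply: eq_bigr => y _; apply: eq_bigr => z _.
    by rewrite -(charN chiP) -(charD chiP); congr chi; ring.
  apply: (@complexI R); rewrite real_complex_sum.
  under eq_bigr => v _ do rewrite real_complexM hEv mulr_sumr.
  rewrite exchange_big mulr_sumr real_complex_sum; apply: eq_bigr => -[y1 y2] _ /=.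
  under eq_bigr do rewrite mulr_sumr.
  rewrite exchange_big mulr_sumr real_complex_sum; apply: eq_bigr => -[z1 z2] _ /=.
  by rewrite ambs_self_dual.
have CS := ler_sqr_sum predT (fun v => normc (amb F F v)) (fun v => normc (amb F F v) * normc (E v)).
have hB : \sum_v ambs F v <= n ^+ 3.
  by apply: amb_sum_le.
have key : (n * S) ^+ 2 <= n ^+ 3 * (n * \sum_(y in Y) \sum_(z in Y) ambs F (y - z)).
  apply: le_trans (_ : (\sum_v ambs F v * normc (E v)) ^+ 2 <= _).
    by rewrite lerXn2r // ?nnegrE ?mulr_ge0 // ?(ltW n0) // sumr_ge0 // => v _;
      rewrite mulr_ge0 ?ambs_ge0 ?normc_ge0.
  have -> : \sum_v ambs F v * normc (E v) =
     \sum_v normc (amb F F v) * (normc (amb F F v) * normc (E v)).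
    by apply: eq_bigr => v _; rewrite /ambs expr2 mulrA.
  apply: le_trans CS _; rewrite -hE ler_pM ?sumr_ge0 //; try by move=> *; apply: sqr_ge0.
  by under eq_bigr do rewrite exprMn.
have n2 : 0 < n ^+ 2 by rewrite exprn_gt0.
rewrite -(ler_pM2l n2); apply: le_trans (_ : (n * S) ^+ 2 <= _); first by rewrite exprMn.
by apply: le_trans key _; rewrite le_eqVlt; apply/orP; left; apply/eqP; ring.
Qed.

Definition largeamb (F : G -> R) (e : R) : {set G * G} := [set u | e * n ^+ 2 <= ambs F u].

Lemma card_largeamb F e : (forall x, `|F x| <= 1) -> 0 < e ->
  #|largeamb F e|%:R * e <= n.
Proof.
move=> F1 e0; have n0 := order_gt0.
have n2 : 0 < n ^+ 2 by rewrite exprn_gt0.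
rewrite -(ler_pM2r n2) -mulrA -exprS.
apply: le_trans (amb_sum_le F1 F1).
rewrite mulr_natl -sumr_const [X in _ <= X](bigID (mem (largeamb F e))) /=.
rewrite -[X in X <= _]addr0 lerD ?sumr_ge0 //; try by move=> *; apply: sqr_ge0.
by apply: ler_sum => u; rewrite inE.
Qed.

Lemma card_largeamb_fibre F e h : (forall x, `|F x| <= 1) -> 0 < e ->
  #|[set k | (h, k) \in largeamb F e]|%:R * e <= 1.
Proof.
move=> F1 e0; have n0 := order_gt0.
have n2 : 0 < n ^+ 2 by rewrite exprn_gt0.
rewrite -(ler_pM2r n2) -mulrA mul1r.
apply: le_trans (amb_fibre_le F1 F1 h).
rewrite mulr_natl -sumr_const [X in _ <= X](bigID (mem [set k | (h, k) \in largeamb F e])) /=.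
rewrite -[X in X <= _]addr0 lerD ?sumr_ge0 //; try by move=> *; apply: sqr_ge0.
by apply: ler_sum => u; rewrite !inE.
Qed.

End Ambiguity.

(** * Separating characters and Bogolyubov's lemma *)

Section Pieces.
Variables (R : realType) (G : finComNzRingType) (chi : G -> R[i]).
Hypothesis chiP : is_char chi.
Let n : R := #|G|%:R.

Lemma sqr_normc_char_sub1 x : normc (chi x - 1) ^+ 2 = 2 - 2 * complex.Re (chi x).
Proof.
have := char_norm chiP x; move/(congr1 (fun t => t ^+ 2)).
rewrite !sqr_normcE /=; case: (chi x) => a b /=; rewrite expr1n subr0 => h.
by rewrite sqrrB1 mulr2n; lra.
Qed.

Lemma normc_charB x y : normc (chi x - chi y) = normc (chi (x - y) - 1).
Proof.
have -> : chi x - chi y = chi y * (chi (x - y) - 1).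
  by rewrite mulrBr mulr1 -(charD chiP) [y + _]addrC subrK.
by rewrite ComplexField.Normc.normcM (char_norm chiP) mul1r.
Qed.

Lemma normc_char_sub1D x y :
  normc (chi (x + y) - 1) <= normc (chi x - 1) + normc (chi y - 1).
Proof.
have -> : chi (x + y) - 1 = chi y * (chi x - 1) + (chi y - 1).
  by rewrite (charD chiP); ring.
apply: le_trans (normcD _ _) _.
by rewrite ComplexField.Normc.normcM (char_norm chiP) mul1r.
Qed.

Lemma exists_char_Re_le0 z : z != 0 -> exists t, complex.Re (chi (z * t)) <= 0.
Proof.
move=> z0; have := char_orth chiP z0 => /(congr1 (@complex.Re R)).
rewrite Re_sum /= => h; apply/existsP; apply: contraT; rewrite negb_exists => /forallP hp.
have : 0 < \sum_y complex.Re (chi (z * y)).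
  rewrite (bigD1 0) //= mulr0 (char0 chiP) /=.
  rewrite ltr_pwDl ?ltr01 // sumr_ge0 // => y _.
  by have := hp y; rewrite -ltNge => /ltW.
by rewrite h ltxx.
Qed.

Definition near1 (z : G) := [set t | normc (chi (t * z) - 1) < 2^-1].

(** Some t has Re chi(z t) <= 0, hence |chi(z t) - 1| > 1. Two values within 1/2 of 1 are less than
    1 apart, so [near1 z] is disjoint from its translate by t. *)
Lemma card_near1 z : z != 0 -> (2 * #|near1 z| <= #|G|)%N.
Proof.
move=> /exists_char_Re_le0[t ht].
pose B' := [set x + t | x in near1 z].
have cB' : #|B'| = #|near1 z| by rewrite card_imset //; apply: addIr.
have dis : [disjoint near1 z & B'].
  rewrite disjoint_sym disjoint_subset; apply/subsetP => y /imsetP[x].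
  rewrite !inE => hx ->; apply/negP => hxt.
  have h1 := normc_charB ((x + t) * z) (x * z).
  have h2 := sqr_normc_char_sub1 (z * t).
  have e : (x + t) * z - x * z = z * t by ring.
  have := normcB (chi ((x + t) * z) - 1) (chi (x * z) - 1).
  rewrite opprB addrA subrK h1 e => h3.
  have h4 := normc_ge0 (chi (z * t) - 1).
  nra.
have [_] := leq_card_setU (near1 z) B'; rewrite dis cB' => /eqP e.
by rewrite mul2n -addnn -e; apply: max_card.
Qed.

(** Union bound: by [card_near1] a random tuple of s frequencies fails for a given nonzero z with
    probability at most 2^-s, and fewer than 2^s values z have to be separated. *)
Lemma exists_separating (Z : {set G}) s : (#|Z| < 2 ^ s)%N ->
  exists th : {ffun 'I_s -> G}, forall z, z \in Z -> z != 0 ->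
    exists i, 2^-1 <= normc (chi (th i * z) - 1).
Proof.
move=> cZ.
pose bad (z : G) := [set th : {ffun 'I_s -> G} | th \in ffun_on (mem (near1 z))].
have cbad z : z != 0 -> (2 ^ s * #|bad z| <= #|G| ^ s)%N.
  move=> z0; rewrite cardsE card_ffun_on card_ord -expnMn.
  by case: (s) => // m; rewrite leq_exp2r //; apply: card_near1.
pose Z0 := Z :\ 0; pose U := \bigcup_(z in Z0) bad z.
have : (2 ^ s * #|U| < 2 ^ s * #|{ffun 'I_s -> G}|)%N.
  rewrite card_ffun card_ord.
  apply: leq_ltn_trans (_ : \sum_(z in Z0) #|G| ^ s < _)%N.
    apply: leq_trans (_ : 2 ^ s * \sum_(z in Z0) #|bad z| <= _)%N.
      rewrite leq_mul2l; apply/orP; right; rewrite /U.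
      elim/big_rec2: _ => [|z a b _ le]; first by rewrite cards0.
      by apply: leq_trans (leq_card_setU _ _).1 _; rewrite leq_add2l.
    by rewrite big_distrr; apply: leq_sum => z; rewrite !inE => /andP[/cbad].
  rewrite sum_nat_const ltn_pmul2r; last first.
    by rewrite expn_gt0; apply/orP; left; apply/card_gt0P; exists 0.
  by apply: leq_ltn_trans cZ; apply: subset_leq_card; apply: subD1set.
rewrite ltn_pmul2l ?expn_gt0 // => lt.
have [th hth] : exists th, th \notin U.
  apply/existsP; apply: contraT; rewrite negb_exists => /forallP h.
  move: lt; rewrite ltnNge => /negP; case; apply: subset_leq_card; apply/subsetP => th _.
  by have := h th; rewrite negbK.
exists th => z Zz z0; apply/existsP; apply: contraT; rewrite negb_exists => /forallP h.
case/negP: hth; apply/bigcupP; exists z; first by rewrite !inE z0.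
rewrite inE; apply/ffun_onP => i; rewrite inE.
by have := h i; rewrite -ltNge.
Qed.

(** Cells of width 1/31 on [-1, 1] have indices at most 62, so 64 suffice. Real and imaginary parts
    together give the 4096 cells per character in [hash_piece]. *)
Definition gridc (x : R) : 'I_64 := inord (Num.truncn ((x + 1) * 31)).

Lemma gridc_eq x y : `|x| <= 1 -> `|y| <= 1 -> gridc x = gridc y -> `|x - y| <= 1 / 31.
Proof.
rewrite !ler_norml => /andP[x0 x1] /andP[y0 y1].
have g (t : R) : -1 <= t -> t <= 1 -> (Num.truncn ((t + 1) * 31) < 64)%N.
  by move=> h1 h2; rewrite truncn_lt_nat; [lra|lra].
move/(congr1 val); rewrite /= !inordK ?g // => e.
have /truncn_itv /andP[ax bx] : 0 <= (x + 1) * 31 by lra.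
have /truncn_itv /andP[ay by_] : 0 <= (y + 1) * 31 by lra.
move: e ax bx ay by_; move: (Num.truncn _) (Num.truncn _) => k k' -> ax.
rewrite -(natr1 k) => bx ay by_.
by apply/andP; split; lra.
Qed.

Lemma normc_le_ReIm (z : R[i]) : normc z <= `|complex.Re z| + `|complex.Im z|.
Proof.
have := sqr_normcE z; have := normc_ge0 z.
have := normr_ge0 (complex.Re z); have := normr_ge0 (complex.Im z).
rewrite -(real_normK (num_real (complex.Re z))) -(real_normK (num_real (complex.Im z))).
move: `|complex.Re z| `|complex.Im z| (normc z) => a b c b0 a0 c0 e.
rewrite -(ler_pXn2r (ltn0Sn 1)) ?nnegrE ?addr_ge0 // e sqrrD -addrA lerD2l.
by rewrite lerDr mulrn_wge0 // mulr_ge0.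
Qed.

Lemma Im_le_normc (z : R[i]) : `|complex.Im z| <= normc z.
Proof.
rewrite -(ler_pXn2r (ltn0Sn 1)) ?nnegrE ?normc_ge0 //.
by rewrite sqr_normcE real_normK ?num_real // lerDr sqr_ge0.
Qed.

Definition cellc (z : R[i]) := (gridc (complex.Re z), gridc (complex.Im z)).

Lemma cellc_eq x y : cellc (chi x) = cellc (chi y) -> normc (chi x - chi y) <= 2 / 31.
Proof.
case=> e1 e2; apply: le_trans (normc_le_ReIm _) _.
have hR t : `|complex.Re (chi t)| <= 1 by rewrite -(char_norm chiP t) Re_le_normc.
have hI t : `|complex.Im (chi t)| <= 1 by rewrite -(char_norm chiP t) Im_le_normc.
have h1 := gridc_eq (hR _) (hR _) e1; have h2 := gridc_eq (hI _) (hI _) e2.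
have -> : complex.Re (chi x - chi y) = complex.Re (chi x) - complex.Re (chi y).
  by case: (chi x) (chi y) => a b [].
have -> : complex.Im (chi x - chi y) = complex.Im (chi x) - complex.Im (chi y).
  by case: (chi x) (chi y) => a b [].
by lra.
Qed.

(** Pigeonhole on the cells of s separating characters of the second coordinate. A difference of two
    6-fold sums of C moves each of these characters by at most 6 * 2/31 < 1/2, so it cannot be a
    nonzero element of Z. *)
Lemma hash_piece (A : {set G * G}) (Z : {set G}) s : (#|Z| < 2 ^ s)%N ->
  exists2 C : {set G * G}, C \subset A & (#|A| <= 4096 ^ s * #|C|)%N /\
    forall z, z \in Z -> (0, z) \in diffset (nsumset 6 C) (nsumset 6 C) -> z = 0.
Proof.
move=> /exists_separating[th hth].
pose q (u : G * G) : {ffun 'I_s -> 'I_64 * 'I_64} :=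
  [ffun i => cellc (chi (th i * u.2))].
have [v hv] : exists v, (#|A| <= 4096 ^ s * #|[set u in A | q u == v]|)%N.
  apply/existsP; apply: contraT; rewrite negb_exists => /forallP h.
  have e : #|A| = (\sum_v #|[set u in A | q u == v]|)%N.
    rewrite -sum1_card (partition_big q predT) //=; apply: eq_bigr => v _.
    by rewrite -sum1_card; apply: eq_bigl => u; rewrite inE.
  have cF : #|{ffun 'I_s -> 'I_64 * 'I_64}| = (4096 ^ s)%N.
    by rewrite card_ffun card_prod !card_ord.
  have : (4096 ^ s * #|A| < 4096 ^ s * #|A|)%N.
    rewrite {1}e -cF big_distrr /= -[X in (_ < X)%N]sum_nat_const.
    have [v0 _] : exists v : {ffun 'I_s -> 'I_64 * 'I_64}, v \in predT.
      by exists (q 0).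
    rewrite (bigD1 v0) //= [X in (_ < X)%N](bigD1 v0) //= -addSn leq_add //.
      by rewrite ltnNge cF.
    by apply: leq_sum => w _; apply: ltnW; rewrite ltnNge cF.
  by rewrite ltnn.
exists [set u in A | q u == v].
  by apply/subsetP => u; rewrite inE => /andP[].
split=> // z Zz hz; apply/eqP; apply: contraT => z0.
have [i hi] := hth z Zz z0.
have step k : forall u w, u \in nsumset k [set u in A | q u == v] ->
    w \in nsumset k [set u in A | q u == v] ->
    normc (chi (th i * (u.2 - w.2)) - 1) <= k%:R * (2 / 31).
  elim: k => [|k IH] u w.
    by rewrite !inE => /eqP-> /eqP->; rewrite subrr mulr0 (char0 chiP) subrr normc_realE normr0 mul0r.
  case/imset2P => a u1; rewrite inE => /andP[Aa /eqP qa] hu1 ->.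
  case/imset2P => b w1; rewrite inE => /andP[Ab /eqP qb] hw1 ->.
  have -> : th i * ((a + u1).2 - (b + w1).2) = (th i * a.2 - th i * b.2) + th i * (u1.2 - w1.2).
    by rewrite /=; ring.
  apply: le_trans (normc_char_sub1D _ _) _; rewrite -normc_charB -natr1 mulrDl mul1r addrC.
  apply: lerD; first exact: IH.
  by apply: cellc_eq; have := congr1 (fun f : {ffun _ -> _} => f i) (etrans qa (esym qb)); rewrite !ffunE.
case/imset2P: hz => u w hu hw e.
have ez : z = u.2 - w.2 by have := congr1 snd e.
by have := step 6 u w hu hw; rewrite -ez; lra.
Qed.

(** Fourier count of the representations of b, with S the large spectrum. Frequency 0 contributes
    m^4, the others in S have nonnegative real part, and those outside S contribute at most m^2 /
    (2c) * n m <= m^4 / 2 in absolute value. *)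
Lemma bogolyubov (H : {set G}) (c : nat) : (0 < #|H|)%N -> (#|G| <= c * #|H|)%N ->
  exists2 S : {set G}, (#|S| <= 2 * c ^ 2)%N &
  forall b, (forall k, k \in S -> 0 <= complex.Re (chi (k * b))) ->
    b \in diffset (sumset H H) (sumset H H).
Proof.
move=> H0 cH.
pose h (x : G) : R[i] := ((x \in H)%:R : R)%:C.
pose fh k := \sum_x h x * chi (k * x).
pose m : R := #|H|%:R.
have m0 : 0 < m by rewrite ltr0n.
have c0 : (0 < c)%N.
  rewrite lt0n; apply: contraTneq cH => ->; rewrite mul0n -ltnNge.
  by apply/card_gt0P; exists 0.
have cR : 0 < (c%:R : R) by rewrite ltr0n.
have nc : n <= c%:R * m by rewrite -natrM ler_nat.
pose S := [set k | m ^+ 2 <= 2 * c%:R * normc (fh k) ^+ 2].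
have hP : \sum_k normc (fh k) ^+ 2 = n * m.
  rewrite (char_plancherel chiP); congr (_ * _).
  under eq_bigr => x _ do rewrite normc_realE real_normK ?num_real // -natrX expnE /=.
  rewrite -natr_sum /m; congr (_%:R); rewrite -sum1_card [RHS]big_mkcond /=.
  by apply: eq_bigr => x _; case: (x \in H).
exists S.
  have : #|S|%:R * m ^+ 2 <= (2 * c%:R * (n * m)).
    rewrite -hP mulr_sumr mulr_natl -sumr_const [X in _ <= X](bigID (mem S)) /=.
    rewrite -[X in X <= _]addr0 lerD ?sumr_ge0 //.
      by apply: ler_sum => u; rewrite inE.
    by move=> k _; apply: mulr_ge0; [lra|exact: sqr_ge0].
  rewrite -(ler_nat R) natrM natrX => h1.
  have : #|S|%:R * m ^+ 2 <= 2 * c%:R ^+ 2 * m ^+ 2.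
    apply: le_trans h1 _.
    have -> : 2 * c%:R ^+ 2 * m ^+ 2 = 2 * c%:R * (c%:R * m * m) :> R by ring.
    by rewrite ler_pM2l ?ler_pM2r // mulr_gt0.
  by rewrite ler_pM2r // exprn_gt0.
move=> b hb; apply: contraT => nb.
have fh0 : fh 0 = m%:C.
  rewrite /fh; under eq_bigr => x _ do rewrite mul0r (char0 chiP) mulr1.
  rewrite -real_complex_sum -natr_sum /m; congr (_%:R%:C).
  by rewrite -sum1_card [RHS]big_mkcond /=; apply: eq_bigr => x _; case: (x \in H).
(* Up to normalisation this counts the representations of b in 2H - 2H, and b is assumed to have
   none. *)
have z0 : \sum_k (normc (fh k) ^+ 4)%:C * chi (- (k * b)) = 0.
  have e k : (normc (fh k) ^+ 4)%:C = (fh k * fh k) * conjc (fh k * fh k).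
    by rewrite mulcJ ComplexField.Normc.normcM; congr (_%:C); ring.
  have e2 k : fh k * fh k = \sum_x (\sum_y h y * h (x - y)) * chi (k * x).
    rewrite {1 2}/fh big_distrlr /=.
    under eq_bigr => y _ do rewrite (reindex_inj (addrI (- y))) /=.
    rewrite exchange_big /=; apply: eq_bigr => x _; rewrite mulr_suml.
    apply: eq_bigr => y _; rewrite mulrACA -(charD chiP) [- y + x]addrC.
    by congr (_ * chi _); ring.
  have e3 k : conjc (fh k * fh k) * chi (- (k * b))
      = conjc (\sum_x (\sum_y h y * h (x - b - y)) * chi (k * x)).
    rewrite (charN chiP) -conjcM e2; congr (conjc _).
    rewrite mulr_suml [RHS](reindex_inj (addIr b)) /=; apply: eq_bigr => x _.
    by rewrite addrK -mulrA -(charD chiP) mulrDr.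
  under eq_bigr => k _ do rewrite e -(mulrA (fh k * fh k)) e3 e2.
  rewrite (char_parseval chiP) big1 ?mulr0 // => x _.
  have [y1 /andP[Hy1 Hy2]|none] := pickP (fun y => (y \in H) && (x - y \in H)); last first.
    rewrite [X in X * _]big1 ?mul0r // => y _; have := none y; rewrite /h.
    by case: (y \in H) => //= [->|]; rewrite ?mulr0 ?mul0r.
  rewrite [X in _ * conjc X]big1 ?conjc0 ?mulr0 // => y _; rewrite /h.
  have [Hy|] := boolP (y \in H); last by rewrite mul0r.
  have [Hxy|] := boolP (x - b - y \in H); last by rewrite mulr0.
  case/negP: nb; apply/imset2P; exists (y1 + (x - y1)) (y + (x - b - y)).
  - by apply: mem_sumset.
  - by apply: mem_sumset.
  - by ring.
have := congr1 (@complex.Re R) z0; rewrite Re_sum /= => zr.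
have : 0 < \sum_k complex.Re ((normc (fh k) ^+ 4)%:C * chi (- (k * b))).
  rewrite (bigD1 0) //= ReZ fh0 mul0r oppr0 (char0 chiP) mulr1 normc_realE ger0_norm ?ltW //.
  suff : - (m ^+ 4 / 2) <= \sum_(k | k != 0) complex.Re ((normc (fh k) ^+ 4)%:C * chi (- (k * b))).
    have : 0 < m ^+ 4 by rewrite exprn_gt0.
    lra.
  apply: le_trans (_ : \sum_(k | k != 0) - (m ^+ 2 / (2 * c%:R) * normc (fh k) ^+ 2) <= _).
    rewrite sumrN lerN2 -mulr_sumr.
    have hs : \sum_(k | k != 0) normc (fh k) ^+ 2 <= c%:R * m ^+ 2.
      apply: le_trans (_ : n * m <= _); last by rewrite expr2 mulrA ler_pM2r.
      by rewrite -hP [X in _ <= X](bigD1 0) //= lerDr sqr_ge0.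
    apply: le_trans (ler_wpM2l _ hs) _; first by rewrite divr_ge0 ?sqr_ge0 // mulr_ge0 // ltW.
    by rewrite le_eqVlt; apply/orP; left; apply/eqP; field; rewrite gt_eqF.
  apply: ler_sum => k k0; rewrite ReZ (charN chiP) Re_conjc.
  have hr : `|complex.Re (chi (k * b))| <= 1 by rewrite -(char_norm chiP (k * b)) Re_le_normc.
  have [kS|kS] := boolP (k \in S).
    apply: le_trans (_ : 0 <= _).
      by rewrite oppr_le0 mulr_ge0 ?sqr_ge0 // divr_ge0 ?sqr_ge0 //; lra.
    by rewrite mulr_ge0 ?hb // exprn_ge0 ?normc_ge0.
  move: kS; rewrite inE -ltNge => kS.
  apply: le_trans (_ : - normc (fh k) ^+ 4 <= _).
    rewrite lerN2 (_ : normc (fh k) ^+ 4 = normc (fh k) ^+ 2 * normc (fh k) ^+ 2); last by rewrite -exprD.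
    by rewrite ler_wpM2r ?sqr_ge0 // ler_pdivlMr ?mulr_gt0 // mulrC ltW.
  have := hr; rewrite ler_norml => /andP[+ _].
  have : 0 <= normc (fh k) ^+ 4 by rewrite exprn_ge0 ?normc_ge0.
  nra.
by rewrite zr ltxx.
Qed.

End Pieces.

(** * Small doubling and strings among the large values *)

Section Structure.
Variables (R : realType) (G : finComNzRingType) (chi : G -> R[i]).
Hypothesis chiP : is_char chi.
Variables (F : G -> R) (X : nat).
Hypotheses (F1 : forall x, `|F x| <= 1) (X_ge : (2 ^ 14 <= X)%N).
Let Lam := largeamb chi F (X%:R ^- 2).

Let X_gt0 : (0 < X)%N. Proof. by apply: leq_trans X_ge. Qed.
Let XR : 0 < X%:R :> R. Proof. by rewrite ltr0n. Qed.

Lemma card_largeambX k : (#|largeamb chi F (X%:R ^- k)| <= X ^ k * #|G|)%N.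
Proof.
have Xk : 0 < (X%:R : R) ^+ k by rewrite exprn_gt0.
have := card_largeamb chiP F1 (_ : 0 < X%:R ^- k); rewrite invr_gt0 Xk => /(_ isT).
by rewrite ler_pdivrMr // -natrX -natrM ler_nat mulnC.
Qed.

(** By Plancherel on a fibre, at most X^2 frequencies over one shift give a large value. *)
Lemma card_proj1 (A : {set G * G}) : A \subset Lam ->
  (#|A| <= X ^ 2 * #|[set u.1 | u in A]|)%N.
Proof.
move=> sA.
have e : #|A| = (\sum_(h in [set u.1 | u in A]) #|[set u in A | u.1 == h]|)%N.
  rewrite -sum1_card (partition_big (fun u => u.1) (mem [set u.1 | u in A])) /=; last first.
    by move=> u Au; apply: imset_f.
  by apply: eq_bigr => v _; rewrite -sum1_card; apply: eq_bigl => u; rewrite inE.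
rewrite e mulnC -sum_nat_const; apply: leq_sum => h _.
apply: leq_trans (_ : #|[set k | (h, k) \in Lam]| <= _)%N.
  rewrite -(@card_in_imset _ _ (fun u : G * G => u.2)).
    apply: subset_leq_card; apply/subsetP => k.
    by move=> /imsetP[[a b] /setIdP[/(subsetP sA) ha /= /eqP <-] ->]; rewrite inE.
  move=> [a b] [a' b']; rewrite !inE /= => /andP[_ /eqP->] /andP[_ /eqP->].
  by move=> /= ->.
have Xk : 0 < (X%:R : R) ^+ 2 by rewrite exprn_gt0.
have := card_largeamb_fibre chiP h F1 (_ : 0 < X%:R ^- 2); rewrite invr_gt0 Xk => /(_ isT).
by rewrite ler_pdivrMr // mul1r => hk; rewrite -(ler_nat R) natrX.
Qed.

(** Positive definiteness supplies the dense graph of differences that [bsg] needs. Y has at least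
    |G| / X^2 points and P at most X^5 |G|, so every ratio is a power of X; the lower bound on X
    absorbs the factors 4 and 4096. *)
Lemma largeamb_small_doubling (Y : {set G * G}) : Y \subset Lam ->
  (#|G| <= X ^ 2 * #|Y|)%N ->
  exists2 A : {set G * G}, A \subset Y &
    (#|G| <= X ^ 8 * #|A|)%N /\ (#|diffset A A| <= X ^ 60 * #|A|)%N.
Proof.
move=> sY cY.
have G0 : (0 < #|G|)%N by apply/card_gt0P; exists 0.
have Y0 : (0 < #|Y|)%N by move: cY; case: #|Y| => //; rewrite muln0 leqNgt G0.
(* This threshold is so low that differences outside P account for at most |Y|^2 / X in
   [ambs_posdef]; at least |Y|^2 / (2 X^4) pairs then have their difference in P. *)
pose P := largeamb chi F (X%:R ^- 5).
pose n : R := #|G|%:R.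
have n0 : 0 < n by rewrite ltr0n.
have dense : (#|Y| ^ 2 <= X ^ 5 * \sum_(y in Y) #|[set a in Y | (a - y)%R \in P]|)%N.
  have h1 := ambs_posdef chiP Y F1; rewrite -/n in h1.
  have h2 : (X%:R ^- 2 * n ^+ 2 * #|Y|%:R) <= \sum_(y in Y) ambs chi F y.
    rewrite mulr_natr -sumr_const; apply: ler_sum => y /(subsetP sY).
    by rewrite inE.
  have h3 : \sum_(y in Y) \sum_(z in Y) ambs chi F (y - z) <=
     n ^+ 2 * (\sum_(y in Y) #|[set a in Y | (a - y)%R \in P]|)%:R + X%:R ^- 5 * n ^+ 2 * #|Y|%:R ^+ 2.
    rewrite exchange_big /=.
    apply: le_trans (_ : \sum_(y in Y) (n ^+ 2 * #|[set a in Y | (a - y)%R \in P]|%:R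
      + X%:R ^- 5 * n ^+ 2 * #|Y|%:R) <= _); last first.
      rewrite big_split /= -mulr_sumr natr_sum lerD2l sumr_const -[X in X <= _]mulr_natr.
      by rewrite [#|Y|%:R ^+ 2]expr2 [in X in _ <= X]mulrA.
    apply: ler_sum => y Yy; rewrite (bigID (fun a => a - y \in P)) /=; apply: lerD.
      apply: le_trans (_ : \sum_(i in Y | i - y \in P) n ^+ 2 <= _).
        apply: ler_sum => a _; rewrite /ambs lerXn2r ?nnegrE ?normc_ge0 ?ler0n //.
        exact: (amb_le chiP F1 F1).
      rewrite sumr_const -[X in X <= _]mulr_natr ler_wpM2l ?sqr_ge0 // ler_nat.
      by apply: eq_leq; rewrite cardsE.
    apply: le_trans (_ : \sum_(i in Y | i - y \notin P) X%:R ^- 5 * n ^+ 2 <= _).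
      by apply: ler_sum => a /andP[_]; rewrite inE -ltNge => /ltW.
    rewrite sumr_const -[X in X <= _]mulr_natr ler_wpM2l //.
      by rewrite mulr_ge0 ?sqr_ge0 // invr_ge0 exprn_ge0 // ltW.
    by rewrite ler_nat; apply: subset_leq_card; apply/subsetP => a /andP[].
  set E := (\sum_(y in Y) _)%N in h3 *.
  have x5 : 0 < (X%:R : R) ^+ 5 by rewrite exprn_gt0.
  have x2 : 0 < (X%:R : R) ^+ 2 by rewrite exprn_gt0.
  have Yr : 0 <= #|Y|%:R :> R by rewrite ler0n.
  have n2 : 0 < n ^+ 2 by rewrite exprn_gt0.
  have h4 : (X%:R ^- 2 * n ^+ 2 * #|Y|%:R) ^+ 2 <= n ^+ 2 *
     (n ^+ 2 * E%:R + X%:R ^- 5 * n ^+ 2 * #|Y|%:R ^+ 2).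
    apply: le_trans (_ : (\sum_(y in Y) ambs chi F y) ^+ 2 <= _).
      rewrite lerXn2r ?nnegrE //; first by rewrite !mulr_ge0 ?invr_ge0 // ltW.
      by apply: sumr_ge0 => y _; apply: ambs_ge0.
    by apply: le_trans h1 _; rewrite ler_pM2l.
  have h5 : #|Y|%:R ^+ 2 <= X%:R ^+ 4 * E%:R + X%:R ^- 1 * #|Y|%:R ^+ 2 :> R.
    rewrite -(ler_pM2l (_ : 0 < X%:R ^- 4 * n ^+ 4)); last first.
      by rewrite mulr_gt0 ?invr_gt0 ?exprn_gt0.
    move: h4; rewrite (_ : _ ^+ 2 = X%:R ^- 4 * n ^+ 4 * #|Y|%:R ^+ 2); last first.
      by field; rewrite gt_eqF.
    move=> /le_trans; apply; rewrite le_eqVlt; apply/orP; left; apply/eqP.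
    by field; rewrite gt_eqF.
  have x1 : (X%:R : R) ^- 1 <= 2^-1.
    rewrite lef_pV2 ?posrE // ?ltr0n // ler_nat; apply: leq_trans X_ge.
    by [].
  rewrite -(ler_nat R) natrX natrM natrX.
  have h6 : #|Y|%:R ^+ 2 <= 2 * (X%:R ^+ 4 * E%:R) :> R.
    have : (X%:R : R) ^- 1 * #|Y|%:R ^+ 2 <= 2^-1 * #|Y|%:R ^+ 2 by rewrite ler_wpM2r ?sqr_ge0.
    lra.
  apply: le_trans h6 _; rewrite mulrA ler_wpM2r ?ler0n // [_ ^+ 5]exprS ler_wpM2r ?exprn_ge0 ?ltW //.
  by rewrite ltr_nat; apply: leq_trans X_ge.
have X5 : (0 < X ^ 5)%N by rewrite expn_gt0 X_gt0.
have [A [sA cA dA]] := bsg X5 dense Y0.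
exists A => //; split.
  apply: leq_trans cY _.
  apply: leq_trans (_ : X ^ 2 * (4 * X ^ 5 * #|A|) <= _)%N; first by rewrite leq_mul2l cA orbT.
  have : (4 <= X)%N by apply: leq_trans X_ge.
  have -> : (X ^ 8 = X ^ 2 * (X * X ^ 5))%N by rewrite -expnS -expnD.
  by move=> h; rewrite -[W in (_ <= W)%N]mulnA leq_mul2l leq_mul2r leq_mul2r h !orbT.
have cP : (#|P| <= X ^ 5 * #|G|)%N by apply: card_largeambX.
have h1 : (#|diffset A A| * #|G| ^ 3 <= X ^ 52 * #|G| * #|G| ^ 3)%N.
  apply: leq_trans (_ : #|diffset A A| * (X ^ 2 * #|Y|) ^ 3 <= _)%N.
    by rewrite leq_mul2l leq_exp2r // cY orbT.
  rewrite expnMn mulnCA.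
  apply: leq_trans (leq_mul (leqnn _) dA) _.
  apply: leq_trans (_ : (X ^ 2) ^ 3 * (4096 * (X ^ 5) ^ 5 * (X ^ 5 * #|G|) ^ 4) <= _)%N.
    by rewrite !leq_mul2l leq_exp2r // cP !orbT.
  have h : (4096 <= X)%N by apply: leq_trans X_ge.
  apply: leq_trans (_ : 4096 * X ^ 51 * #|G| ^ 4 <= _)%N; last first.
    by rewrite -[W in (_ <= W)%N]mulnA -[W in (_ <= _ * W)%N]expnS leq_mul2r (expnS X 51) leq_mul2r h !orbT.
  apply/eq_leq; rewrite expnMn -!expnM (_ : (X ^ 51 = X ^ (2 * 3) * X ^ (5 * 5) * X ^ (5 * 4))%N).
    by move: (X ^ (2 * 3))%N (X ^ (5 * 5))%N (X ^ (5 * 4))%N (#|G| ^ 4)%N => x y z t; lia.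
  by rewrite -!expnD.
have g3 : (0 < #|G| ^ 3)%N by rewrite expn_gt0 G0.
rewrite leq_pmul2r // in h1; apply: leq_trans h1 _.
rewrite (_ : 60 = 52 + 8)%N // expnD -mulnA leq_mul2l; apply/orP; right.
apply: leq_trans cY _.
apply: leq_trans (_ : X ^ 2 * (4 * X ^ 5 * #|A|) <= _)%N; first by rewrite leq_mul2l cA orbT.
have h : (4 <= X)%N by apply: leq_trans X_ge.
have -> : (X ^ 8 = X ^ 2 * (X * X ^ 5))%N by rewrite -expnS -expnD.
by rewrite -[W in (_ <= W)%N]mulnA leq_mul2l leq_mul2r leq_mul2r h !orbT.
Qed.

(** Fix a lift in A of every h in the projection H. Adding (0, z) to the lifts embeds Z x H in 7A -
    6A, of size at most K^13 |A|, while |A| <= X^2 |H|. *)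
Lemma card_zero_fibre (A : {set G * G}) K : A != set0 -> A \subset Lam ->
  (#|diffset A A| <= K * #|A|)%N ->
  (#|[set z | (0%R, z) \in diffset (nsumset 6 A) (nsumset 6 A)]| <= K ^ 13 * X ^ 2)%N.
Proof.
move=> A0 sA dA; set Z := [set z | _].
pose H := [set u.1 | u in A].
pose s (h : G) := if [pick u in A | u.1 == h] is Some u then u else 0.
have sP h : h \in H -> s h \in A /\ (s h).1 = h.
  case/imsetP => u Au ->; rewrite /s; case: pickP => [w /andP[Aw /eqP] //|/(_ u)].
  by rewrite Au eqxx.
have : (#|Z| * #|H| <= K ^ 13 * #|A|)%N.
  apply: leq_trans (_ : #|diffset (nsumset 7 A) (nsumset 6 A)| <= _)%N; last exact: (plunnecke 7 6).
  rewrite -cardsX -(@card_in_imset _ _ (fun p : G * G => s p.2 + (0, p.1))).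
    apply: subset_leq_card; apply/subsetP => u /imsetP[[z h]].
    rewrite in_setX inE /= => /andP[/imset2P[v w hv hw ->] /sP[As _]] ->.
    by rewrite addrA; apply: mem_diffset => //; apply: mem_sumset.
  move=> [z h] [z' h']; rewrite !in_setX /= => /andP[_ /sP[_ e1]] /andP[_ /sP[_ e2]] e.
  have eh : h = h'.
    by have := congr1 fst e; rewrite /= !addr0 e1 e2.
  by move: e; rewrite eh => /addrI [->].
have H0 : (0 < #|H|)%N.
  by rewrite card_gt0; apply: contraNneq A0 => H0; rewrite -(imset_eq0 (fun u => u.1)) -/H H0.
move=> h; rewrite -(leq_pmul2r H0); apply: leq_trans h _.
by rewrite -mulnA leq_mul2l card_proj1 ?orbT.
Qed.

(** What is used of a piece: along any progression l q0 on which the characters of S keep a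
    nonnegative real part, 2C - 2C contains a linear string (l q0, l e). The size of 3C - 2C is the
    cost of averaging along such a string. *)
Definition is_piece (c : nat) (C : {set G * G}) (S : {set G}) :=
  [/\ (#|diffset (nsumset 3 C) (nsumset 2 C)| <= X ^ c * #|G|)%N, (#|S| <= X ^ c)%N &
   forall (q0 : G) (L : nat),
     (forall l k, (l <= L)%N -> k \in S -> 0 <= complex.Re (chi (k * (q0 *+ l)))) ->
     exists e : G, forall l, (l <= L)%N ->
       (q0 *+ l, e *+ l) \in diffset (nsumset 2 C) (nsumset 2 C)].

Lemma nsumset2 (V : finZmodType) (A : {set V}) : nsumset 2 A = sumset A A.
Proof.
rewrite /nsumset /= (_ : sumset A [set 0] = A) //.
apply/setP/subset_eqP; apply/andP; split; apply/subsetP.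
  by move=> _ /imset2P[x y Xx /set1P-> ->]; rewrite addr0.
by move=> x Xx; rewrite -[x]addr0; apply: mem_sumset => //; rewrite inE.
Qed.

(** Bogolyubov's lemma lifts each l q0 to some (l q0, e_l) in 2C - 2C. Then (0, e_(l+1) - e_l - e_1)
    is in 6C - 6C, hence zero, and e_l is linear in l. *)
Lemma graph_string (C : {set G * G}) (S : {set G}) :
  C != set0 ->
  (forall b, (forall k, k \in S -> 0 <= complex.Re (chi (k * b))) ->
    b \in diffset (sumset [set u.1 | u in C] [set u.1 | u in C])
                  (sumset [set u.1 | u in C] [set u.1 | u in C])) ->
  (forall z, (0, z) \in diffset (nsumset 6 C) (nsumset 6 C) -> z = 0) ->
  forall (q0 : G) (L : nat),
     (forall l k, (l <= L)%N -> k \in S -> 0 <= complex.Re (chi (k * (q0 *+ l)))) ->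
     exists e : G, forall l, (l <= L)%N ->
       (q0 *+ l, e *+ l) \in diffset (nsumset 2 C) (nsumset 2 C).
Proof.
move=> /set0Pn[u0 Cu0] bog fib q0 L hq.
pose D := diffset (nsumset 2 C) (nsumset 2 C).
have lift l : (l <= L)%N -> exists e, (q0 *+ l, e) \in D.
  move=> lL; have /bog : forall k, k \in S -> 0 <= complex.Re (chi (k * (q0 *+ l))).
    by move=> k kS; apply: hq.
  case/imset2P => p p' /imset2P[_ _ /imsetP[a Ca ->] /imsetP[b Cb ->] ->].
  move=> /imset2P[_ _ /imsetP[a' Ca' ->] /imsetP[b' Cb' ->] ->] e.
  exists (a.2 + b.2 - (a'.2 + b'.2)); rewrite e.
  rewrite (_ : (_, _) = (a + b) - (a' + b')); last by case: (a) (b) (a') (b') => ? ? [? ?] [? ?] [? ?].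
  by apply: mem_diffset; rewrite nsumset2; apply: mem_sumset.
have [L0|L1] := posnP L.
  exists 0 => l; rewrite L0 leqn0 => /eqP->; rewrite !mulr0n -[(0, 0)](subrr (u0 + u0)).
  by apply: mem_diffset; rewrite nsumset2; apply: mem_sumset.
have [e he] := lift 1%N L1.
exists e; elim=> [|l IH] lL.
  rewrite !mulr0n -[(0, 0)](subrr (u0 + u0)).
  by apply: mem_diffset; rewrite nsumset2; apply: mem_sumset.
have {}IH := IH (ltnW lL).
have [e' he'] := lift _ lL.
suff : e' - e *+ l - e = 0.
  by move/eqP; rewrite subr_eq0 subr_eq -[e + _]mulrS => /eqP <-.
apply: fib.
case/imset2P: IH => a b ha hb ea; case/imset2P: he => a1 b1 ha1 hb1 ea1.
case/imset2P: he' => a2 b2 ha2 hb2 ea2.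
have -> : (0, e' - e *+ l - e) = (a2 + b + b1) - (b2 + a + a1).
  rewrite (_ : (0, _) = (q0 *+ l.+1, e') - (q0 *+ l, e *+ l) - (q0 *+ 1, e)); last first.
    have e0 : q0 *+ l.+1 - q0 *+ l - q0 *+ 1 = 0 by rewrite mulrS mulr1n addrK subrr.
    by rewrite -[X in (X, _)]e0.
  by rewrite ea2 ea ea1; case: (a) (b) (a1) (b1) (a2) (b2) => ? ? [? ?] [? ?] [? ?] [? ?] [? ?];
    congr (_, _); ring.
by apply: mem_diffset; apply: (@mem_nsumsetD _ 4 2) => //; apply: (@mem_nsumsetD _ 2 2).
Qed.

End Structure.

(** The zero fibre has at most X^(60 * 13 + 2) points, so 2^s <= X^783 for the number s of
    separating characters. Hashing costs 4096^s <= X^(12 * 783), small doubling X^8 and the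
    projection X^2. With c their product, Bogolyubov's spectrum has at most 2 c^2 elements. *)
Definition piece_exp : nat := (2 * (10 + 12 * 783)).+1.

Section Cover.
Variables (R : realType) (G : finComNzRingType) (chi : G -> R[i]).
Hypothesis chiP : is_char chi.
Variables (F : G -> R) (X : nat).
Hypotheses (F1 : forall x, `|F x| <= 1) (X_ge : (2 ^ 14 <= X)%N).
Let Lam := largeamb chi F (X%:R ^- 2).
Let X_gt0 : (0 < X)%N. Proof. by apply: leq_trans X_ge. Qed.
Let G0 : (0 < #|G|)%N. Proof. by apply/card_gt0P; exists 0. Qed.
Let Xexp a b : (a <= b)%N -> (X ^ a <= X ^ b)%N.
Proof. by move=> ab; rewrite leq_pexp2l. Qed.

Lemma exists_piece (Y : {set G * G}) : Y \subset Lam -> (#|G| <= X ^ 2 * #|Y|)%N ->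
  exists (C : {set G * G}) (S : {set G}), [/\ C \subset Y, (#|G| <= X ^ piece_exp * #|C|)%N &
    is_piece chi X piece_exp C S].
Proof.
move=> sY cY.
have [A sA [cA dA]] := largeamb_small_doubling chiP F1 X_ge sY cY.
have A0 : A != set0.
  by rewrite -card_gt0; move: cA; case: #|A| => //; rewrite muln0 leqNgt G0.
have sAL : A \subset Lam := subset_trans sA sY.
pose Z := [set z | (0%R, z) \in diffset (nsumset 6 A) (nsumset 6 A)].
have cZ := card_zero_fibre chiP F1 X_ge A0 sAL dA; rewrite -/Z -expnM -expnD in cZ.
have Z0 : (0 < #|Z|)%N.
  apply/card_gt0P; exists 0; rewrite inE.
  have /set0Pn[u Au] := A0.
  have h : forall k, exists v, v \in nsumset k A.
    elim=> [|k [v hv]]; first by exists 0; rewrite inE.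
    by exists (u + v); apply: mem_sumset.
  have [v hv] := h 6%N; rewrite -[(0, 0)](subrr v); exact: mem_diffset.
pose s := (trunc_log 2 #|Z|).+1.
have s1 : (#|Z| < 2 ^ s)%N by apply: trunc_log_ltn.
have s2 : (2 ^ s <= X ^ 783)%N.
  have hZ : (2 ^ trunc_log 2 #|Z| <= #|Z|)%N by apply: trunc_logP.
  rewrite /s [(2 ^ _)%N]expnS; apply: leq_trans (leq_mul (leqnn 2) hZ) _.
  rewrite (expnS X 782); apply: leq_mul; first by apply: leq_trans X_ge.
  exact: cZ.
have [C sC [cC fC]] := hash_piece chiP A s1.
have cAC : (#|A| <= X ^ (783 * 12) * #|C|)%N.
  apply: leq_trans cC _; rewrite leq_mul2r; apply/orP; right.
  by rewrite (_ : 4096 = 2 ^ 12)%N // -expnM mulnC expnM expnM leq_exp2r.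
have cGC : (#|G| <= X ^ (8 + 783 * 12) * #|C|)%N.
  by rewrite expnD -mulnA; apply: leq_trans cA _; rewrite leq_mul2l cAC orbT.
have C0 : C != set0.
  by rewrite -card_gt0; move: cGC; case: #|C| => //; rewrite muln0 leqNgt G0.
have sCL : C \subset Lam := subset_trans sC sAL.
pose H := [set u.1 | u in C].
have cH : (#|G| <= X ^ (10 + 783 * 12) * #|H|)%N.
  apply: leq_trans cGC _; rewrite (_ : 10 + 783 * 12 = (8 + 783 * 12) + 2)%N; last by rewrite addnAC.
  by rewrite [X in (_ <= X * _)%N]expnD -mulnA leq_mul2l (card_proj1 chiP F1 X_ge sCL) orbT.
have H0 : (0 < #|H|)%N by move: cH; case: #|H| => //; rewrite muln0 leqNgt G0.
have [S cS bog] := bogolyubov chiP H0 cH.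
exists C, S; split; first exact: subset_trans sC sA.
  apply: leq_trans cGC _; rewrite leq_mul2r Xexp ?orbT // /piece_exp; lia.
split.
- apply: leq_trans (_ : #|diffset (nsumset 3 A) (nsumset 2 A)| <= _)%N.
    by apply: subset_leq_card; apply: diffsetS; apply: nsumsetS.
  apply: leq_trans (plunnecke 3 2 A0 dA) _.
  apply: leq_trans (_ : (X ^ 60) ^ 5 * (X ^ 2 * #|G|) <= _)%N.
    rewrite leq_mul2l; apply/orP; right; apply: leq_trans (subset_leq_card sAL) _.
    exact: (card_largeambX chiP F1 X_ge).
  by rewrite -expnM mulnA -expnD leq_mul2r Xexp ?orbT // /piece_exp; lia.
- apply: leq_trans cS _; rewrite /piece_exp [(X ^ _.+1)%N]expnS -expnM.
  apply: leq_mul; first by apply: leq_trans X_ge.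
  by apply: Xexp; rewrite mulnC [(12 * _)%N]mulnC.
- apply: (graph_string C0 bog) => z hz; apply: (fC z) => //.
  rewrite inE; apply: (subsetP _ _ hz); apply: diffsetS; exact: nsumsetS.
Qed.

(** Greedy removal: while the uncovered part exceeds |G| / X^2 it contains a further piece of at
    least |G| / X^piece_exp points. Since |Lam| <= X^2 |G|, this stops within X^(piece_exp + 2) + 1
    steps. *)
Lemma largeamb_cover : exists ps : seq ({set G * G} * {set G}),
  [/\ (size ps <= X ^ (piece_exp + 3))%N,
      forall p, p \in ps -> p.1 \subset Lam /\ is_piece chi X piece_exp p.1 p.2 &
      (X ^ 2 * #|Lam :\: \bigcup_(p <- ps) p.1| <= #|G|)%N].
Proof.
pose done_ (m : nat) := exists ps : seq ({set G * G} * {set G}),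
  [/\ (size ps <= m)%N,
      forall p, p \in ps -> p.1 \subset Lam /\ is_piece chi X piece_exp p.1 p.2 &
      (X ^ 2 * #|Lam :\: \bigcup_(p <- ps) p.1| <= #|G|)%N].
have step m : done_ m \/ exists ps : seq ({set G * G} * {set G}),
  [/\ size ps = m,
      forall p, p \in ps -> p.1 \subset Lam /\ is_piece chi X piece_exp p.1 p.2 &
      (X ^ piece_exp * #|Lam :\: \bigcup_(p <- ps) p.1| + m * #|G| <= X ^ piece_exp * #|Lam|)%N].
  elim: m => [|m [[ps [h1 h2 h3]]|[ps [h1 h2 h3]]]].
  - right; exists [::]; split=> //; rewrite big_nil mul0n addn0 leq_mul2l.
    by rewrite subset_leq_card ?orbT // subsetDl.
  - by left; exists ps; split=> //; apply: leqW.
  - set Y := Lam :\: _ in h3.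
    have [le|lt] := leqP (X ^ 2 * #|Y|) #|G|; first by left; exists ps; split=> //; rewrite h1.
    have [C [S [sC cC pC]]] := exists_piece (subsetDl _ _ : Y \subset Lam) (ltnW lt).
    right; exists ((C, S) :: ps); split=> /=; first by rewrite h1.
      move=> p; rewrite inE => /predU1P[->|/h2 //]; split=> //=.
      exact: subset_trans sC (subsetDl _ _).
    apply: leq_trans h3; rewrite big_cons /= mulSn addnA leq_add2r.
    have -> : Lam :\: (C :|: \bigcup_(p <- ps) p.1) = Y :\: C.
      by rewrite /Y setUC setDDl.
    rewrite cardsD (setIidPr sC) mulnBr.
    have aux (a b g : nat) : (g <= b -> b <= a -> a - b + g <= a)%N by lia.
    apply: aux cC _; exact: leq_mul (leqnn _) (subset_leq_card sC).
have [[ps [h1 h2 h3]]|[ps [h1 h2 h3]]] := step (X ^ (piece_exp + 2)).+1%N.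
  exists ps; split=> //; apply: leq_trans h1 _.
  by rewrite (_ : piece_exp + 3 = (piece_exp + 2).+1)%N ?addnS // ltn_exp2l //; apply: leq_trans X_ge.
have cL : (#|Lam| <= X ^ 2 * #|G|)%N by apply: (card_largeambX chiP F1 X_ge).
suff : (X ^ (piece_exp + 2) * #|G| < X ^ (piece_exp + 2) * #|G|)%N by rewrite ltnn.
apply: leq_trans (_ : (X ^ (piece_exp + 2)).+1 * #|G| <= _)%N.
  by rewrite mulSn -[W in (W < _)%N]add0n ltn_add2r.
apply: leq_trans (leq_addl _ _) _; apply: leq_trans h3 _.
by rewrite expnD -mulnA leq_mul2l cL orbT.
Qed.

End Cover.

(** Average over l the translates of C by - w l. As w l is in 2C - 2C, they all lie in 3C - 2C, so a
    bound for the sum along the string from every base point v passes to the sum over C. *)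
Lemma string_sum (R : realType) (V : finZmodType) (C : {set V}) (f : V -> R) (L : nat)
    (w : nat -> V) (beta : R) : (0 < L)%N -> (forall u, 0 <= f u) ->
  (forall l, (l < L)%N -> w l \in diffset (nsumset 2 C) (nsumset 2 C)) ->
  (forall v, \sum_(l < L) f (v + w l) <= L%:R * beta) ->
  \sum_(u in C) f u <= #|diffset (nsumset 3 C) (nsumset 2 C)|%:R * beta.
Proof.
move=> L0 f0 hw hb; set D := diffset (nsumset 3 C) _.
have LR : 0 < L%:R :> R by rewrite ltr0n.
rewrite -(ler_pM2l LR) [leRHS]mulrCA.
have -> : L%:R * \sum_(u in C) f u = \sum_(l < L) \sum_(u in C) f u.
  by rewrite sumr_const card_ord mulr_natl.
apply: le_trans (_ : \sum_(l < L) \sum_(v in D) f (v + w l) <= _).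
  apply: ler_sum => l _; rewrite (reindex_inj (addIr (w l))) /= big_mkcond [leRHS]big_mkcond /=.
  apply: ler_sum => v _; case: ifP => [Cv|_]; last by case: ifP.
  suff -> : v \in D by [].
  have /imset2P[a b ha hb' e] := hw l (ltn_ord l).
  have -> : v = (v + w l + b) - a by rewrite e -[v + (a - b) + b]addrA subrK addrK.
  by apply: mem_diffset => //; apply: mem_sumset.
rewrite exchange_big /= mulr_natl -sumr_const; apply: ler_sum => v _; exact: hb.
Qed.

Lemma sum_bigcup_le (R : realType) (V : finType) (I : Type) (ps : seq I) (c : I -> {set V}) (f : V -> R) :
  (forall u, 0 <= f u) ->
  \sum_(u in \bigcup_(p <- ps) c p) f u <= \sum_(p <- ps) \sum_(u in c p) f u.
Proof.
move=> f0; elim: ps => [|p ps IH].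
  by rewrite !big_nil big1 // => u; rewrite inE.
rewrite !big_cons; apply: le_trans (_ : \sum_(u in c p) f u + \sum_(u in \bigcup_(p <- ps) c p) f u <= _).
  rewrite big_mkcond [X in _ <= X + _]big_mkcond [X in _ <= _ + X]big_mkcond -big_split /=.
  apply: ler_sum => u _; rewrite inE.
  have := f0 u; case: (u \in c p); case: (u \in \bigcup_(_ <- _) _) => //= h; lra.
by rewrite lerD2l.
Qed.

(** * Splitting the correlation over the pieces *)

Section Energy.
Variables (R : realType) (G : finComNzRingType) (chi : G -> R[i]).
Hypothesis chiP : is_char chi.
Variables (H F : G -> R) (X : nat).
Hypotheses (H1 : forall x, `|H x| <= 1) (F1 : forall x, `|F x| <= 1) (X_ge : (2 ^ 14 <= X)%N).
Let n : R := #|G|%:R.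
Let Lam := largeamb chi F (X%:R ^- 2).

(** Three ranges. Off [Lam] two factors [amb chi F F] are below n / X each. The uncovered part of
    [Lam] has at most n / X^2 points, each contributing at most n^4. On a piece, Cauchy-Schwarz
    passes from the first power of [amb chi H F] to the square sum given by hypothesis. *)
Lemma energy_bound (ps : seq ({set G * G} * {set G})) (e : nat) :
  (size ps <= X ^ (e + 3))%N ->
  (X ^ 2 * #|Lam :\: \bigcup_(p <- ps) p.1| <= #|G|)%N ->
  (forall p, p \in ps -> p.1 \subset Lam /\
     exists2 beta : R, 0 <= beta /\ beta * X%:R ^+ (3 * e + 12) <= n ^+ 2 &
     \sum_(u in p.1) normc (amb chi H F u) ^+ 2 <= (X ^ e * #|G|)%:R * beta) ->
  \sum_u normc (amb chi F F u) ^+ 3 * normc (amb chi H F u) <= 3 * n ^+ 5 / X%:R ^+ 2.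
Proof.
move=> sps cov hps.
pose g u := normc (amb chi F F u) ^+ 3 * normc (amb chi H F u).
have g0 u : 0 <= g u by rewrite mulr_ge0 ?exprn_ge0 ?normc_ge0.
have X0 : 0 < X%:R :> R by rewrite ltr0n; apply: leq_trans X_ge.
have X2 : 0 < X%:R ^+ 2 :> R by rewrite exprn_gt0.
have n0 : 0 < n by apply: order_gt0.
have aF u := amb_le chiP F1 F1 u.
have aH u := amb_le chiP H1 F1 u.
set U := \bigcup_(p <- ps) p.1 in cov.
have t1 : \sum_(u | u \notin Lam) g u <= n ^+ 5 / X%:R ^+ 2.
  apply: le_trans (_ : \sum_(u : G * G) n ^+ 2 / X%:R ^+ 2 *
      ((normc (amb chi F F u) ^+ 2 + normc (amb chi H F u) ^+ 2) / 2) <= _); last first.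
    rewrite -mulr_sumr -mulr_suml big_split /=.
    have := amb_sum_le chiP F1 F1; have := amb_sum_le chiP H1 F1; rewrite -/n => h1 h2.
    have -> : n ^+ 5 / X%:R ^+ 2 = n ^+ 2 / X%:R ^+ 2 * n ^+ 3 by rewrite [RHS]mulrAC -exprD.
    by apply: ler_wpM2l; [rewrite divr_ge0 ?exprn_ge0 ?ltW // | lra].
  rewrite big_mkcond; apply: ler_sum => u _; case: ifP => [|_]; last first.
    by rewrite mulr_ge0 ?divr_ge0 ?addr_ge0 ?sqr_ge0 // ltW.
  rewrite inE -ltNge /ambs mulrC -/n => /ltW h.
  rewrite /g exprS mulrAC mulrC; apply: ler_pM; rewrite ?sqr_ge0 ?mulr_ge0 ?normc_ge0 //.
  have := sqr_ge0 (normc (amb chi F F u) - normc (amb chi H F u)).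
  by move: (normc _) (normc _) => x y; rewrite !expr2; lra.
have t2 : \sum_(u in Lam :\: U) g u <= n ^+ 5 / X%:R ^+ 2.
  apply: le_trans (_ : \sum_(u in Lam :\: U) n ^+ 4 <= _).
    apply: ler_sum => u _; rewrite /g (_ : n ^+ 4 = n ^+ 3 * n); last by rewrite -exprSr.
    apply: ler_pM; rewrite ?exprn_ge0 ?normc_ge0 //.
    by rewrite lerXn2r // nnegrE ?normc_ge0 // ltW.
  rewrite sumr_const -[leLHS]mulr_natl ler_pdivlMr // mulrAC.
  have -> : n ^+ 5 = n * n ^+ 4 by rewrite exprS.
  rewrite ler_wpM2r ?exprn_ge0 ?ler0n // mulrC.
  by rewrite -natrX -natrM ler_nat.
have t3 : \sum_(u in U) g u <= n ^+ 5 / X%:R ^+ 2.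
  apply: le_trans (sum_bigcup_le _ _ g0) _.
  (* There are at most X^(e+3) pieces, so each may take n^5 / X^(e+5). Cauchy-Schwarz over at most
     X^2 n points squares the factor X^(e+5), and X^2 X^e X^(2(e+5)) is the power 3e + 12 demanded
     of beta. *)
  have pc p : p \in ps -> \sum_(u in p.1) g u <= n ^+ 5 / X%:R ^+ (e + 5).
    move=> /hps[sC [beta [b0 hb] hC]].
    have Xe5 : 0 < X%:R ^+ (e + 5) :> R by rewrite exprn_gt0.
    have hs : \sum_(u in p.1) normc (amb chi H F u) <= n ^+ 2 / X%:R ^+ (e + 5).
      rewrite -(ler_pXn2r (ltn0Sn 1)) ?nnegrE; last 2 first.
      - by apply: sumr_ge0 => u _; apply: normc_ge0.
      - by rewrite divr_ge0 ?exprn_ge0 // ltW.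
      apply: le_trans (sqr_sum_le _ _) _.
      have cC : #|p.1|%:R <= X%:R ^+ 2 * n.
        rewrite /n -natrX -natrM ler_nat; apply: leq_trans (subset_leq_card sC) _.
        exact: (card_largeambX chiP F1 X_ge).
      apply: le_trans (_ : (X%:R ^+ 2 * n) * ((X ^ e * #|G|)%:R * beta) <= _).
        by apply: ler_pM => //; apply: sumr_ge0 => u _; apply: sqr_ge0.
      rewrite exprMn exprVn ler_pdivlMr ?exprn_gt0 //.
      have -> : X%:R ^+ 2 * n * ((X ^ e * #|G|)%:R * beta) * (X%:R ^+ (e + 5)) ^+ 2 =
          n ^+ 2 * (beta * X%:R ^+ (3 * e + 12)).
        rewrite natrM -/n natrX -exprM.
        have -> : X%:R ^+ (3 * e + 12) = X%:R ^+ 2 * X%:R ^+ e * X%:R ^+ ((e + 5) * 2) :> R.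
          by rewrite -!exprD; congr (_ ^+ _); lia.
        by move: (X%:R ^+ e) (X%:R ^+ (_ * 2)) (X%:R ^+ 2) => x y z; ring.
      have -> : (n ^+ 2) ^+ 2 = n ^+ 2 * n ^+ 2 by rewrite expr2.
      by rewrite ler_wpM2l ?exprn_ge0 // ltW.
    apply: le_trans (_ : \sum_(u in p.1) n ^+ 3 * normc (amb chi H F u) <= _).
      apply: ler_sum => u _; rewrite /g ler_wpM2r ?normc_ge0 //.
      by rewrite lerXn2r // nnegrE ?normc_ge0 // ltW.
    have -> : n ^+ 5 / X%:R ^+ (e + 5) = n ^+ 3 * (n ^+ 2 / X%:R ^+ (e + 5)) by rewrite mulrA -exprD.
    by rewrite -mulr_sumr ler_wpM2l ?exprn_ge0 ?(ltW n0).
  apply: le_trans (_ : \sum_(p <- ps) n ^+ 5 / X%:R ^+ (e + 5) <= _).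
    by rewrite big_seq [leRHS]big_seq; apply: ler_sum.
  rewrite big_const_seq count_predT iter_addr_0 -[leLHS]mulr_natl.
  apply: le_trans (_ : X%:R ^+ (e + 3) * (n ^+ 5 / X%:R ^+ (e + 5)) <= _).
    apply: ler_wpM2r; last by rewrite -natrX ler_nat.
    by rewrite divr_ge0 ?exprn_ge0 ?(ltW n0) ?(ltW X0).
  rewrite (_ : e + 5 = e + 3 + 2)%N; last by lia.
  rewrite [X%:R ^+ (_ + 2)]exprD.
  have x0 : (X%:R ^+ (e + 3) : R) != 0 by rewrite expf_neq0 // gt_eqF.
  have y0 : (X%:R ^+ 2 : R) != 0 by rewrite gt_eqF.
  move: (X%:R ^+ (e + 3) : R) (X%:R ^+ 2 : R) x0 y0 => x y x0 y0.
  by rewrite le_eqVlt; apply/orP; left; apply/eqP; field; rewrite ?x0 ?y0.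
have -> : 3 * n ^+ 5 / X%:R ^+ 2 = n ^+ 5 / X%:R ^+ 2 + (n ^+ 5 / X%:R ^+ 2 + n ^+ 5 / X%:R ^+ 2) by ring.
rewrite (bigID (fun u => u \notin Lam)) /=; apply: lerD => //.
apply: le_trans (lerD t2 t3).
rewrite big_mkcond [X in _ <= X + _]big_mkcond [X in _ <= _ + X]big_mkcond -big_split /=.
apply: ler_sum => u _.
rewrite -/(g u) in_setD negbK; have := g0 u; case: (u \in Lam); case: (u \in U) => /= h0.
- by rewrite add0r.
- by rewrite addr0.
- by rewrite add0r.
- by rewrite addr0.
Qed.

End Energy.

From mathcomp Require Import boolp trigo.

(** * Diophantine approximation *)

Section ExpCircle.
Import mathcomp_extra boolp classical_sets functions topology normedtype derive realfun exp trigo.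
Import numFieldNormedType.Exports.
Variable R : realType.
Implicit Types s t : R.

Definition ec (t : R) : R[i] := cos (2 * pi * t) +i* sin (2 * pi * t).

Lemma ecD s t : ec (s + t) = ec s * ec t.
Proof.
rewrite /ec mulrDr cosD sinD; apply/eqP; rewrite eq_complex /=.
by apply/andP; split; apply/eqP => //; rewrite addrC.
Qed.

Lemma ec0 : ec 0 = 1.
Proof. by rewrite /ec mulr0 cos0 sin0. Qed.

Lemma normc_ec t : normc (ec t) = 1.
Proof. by rewrite /= cos2Dsin2 sqrtr1. Qed.

Lemma ecN t : ec (- t) = conjc (ec t).
Proof. by rewrite /ec mulrN cosN sinN. Qed.

Lemma ec_nat (n : nat) : ec n%:R = 1.
Proof.
elim: n => [|n IH]; first exact: ec0.
rewrite -natr1 ecD IH mul1r /ec mulr1.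
by rewrite (_ : 2 * pi = pi *+ 2) ?cos2pi ?sin2pi // mulr2n; ring.
Qed.

Lemma ec_int (z : int) : ec z%:~R = 1.
Proof.
case: z => n; first exact: ec_nat.
by rewrite NegzE mulrNz ecN ec_nat conjc1.
Qed.

Lemma ecM (n : nat) t : ec (n%:R * t) = ec t ^+ n.
Proof.
elim: n => [|n IH]; first by rewrite mul0r ec0 expr0.
by rewrite -natr1 mulrDl mul1r ecD IH exprSr.
Qed.

Lemma ec_addz t (z : int) : ec (t - z%:~R) = ec t.
Proof. by rewrite ecD ecN ec_int conjc1 mulr1. Qed.

Lemma ec_near t s (z : int) : t - s = z%:~R -> ec t = ec s.
Proof. by move=> e; rewrite -(ec_addz t z) -e opprB addrC subrK. Qed.

Lemma sqr_normc_ec1 t : normc (ec t - 1) ^+ 2 = 2 - 2 * cos (2 * pi * t).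
Proof.
rewrite sqr_normcE /= subr0 sqrrB1 mulr2n.
by have := cos2Dsin2 (2 * pi * t); lra.
Qed.

Lemma sin_le_norm (x : R) : `|sin x| <= `|x|.
Proof.
wlog x0 : x / 0 <= x.
  move=> h; have [/h //|/ltW x0] := leP 0 x.
  by rewrite -normrN -sinN -[W in _ <= W]normrN; apply: h; rewrite oppr_ge0.
have hd (y : R) : y \in `]0, x[%R -> is_derive y 1 sin (cos y).
  by move=> _; apply: is_derive_sin.
have hc : ({within `[0, x], continuous (@sin R)})%classic.
  by apply: continuous_subspaceT => y; apply: continuous_sin.
have [c _] := MVT_segment x0 hd hc.
rewrite sin0 !subr0 => ->; rewrite normrM ler_piMl ?normr_ge0 //.
exact: cos_max.
Qed.

Lemma pi_le4 : pi <= 4 :> R.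
Proof. by have := @pihalf_lt2 R; lra. Qed.

Lemma normc_ec1_le t : normc (ec t - 1) <= 8 * `|t|.
Proof.
have h : normc (ec t - 1) ^+ 2 <= (2 * (4 * `|t|)) ^+ 2.
  rewrite sqr_normc_ec1 (_ : 2 * pi * t = (pi * t) *+ 2); last by rewrite mulr2n; ring.
  rewrite cos_mulr2n; have := cos2Dsin2 (pi * t).
  have S4 : `|sin (pi * t)| <= 4 * `|t|.
    apply: le_trans (sin_le_norm _) _; rewrite normrM (ger0_norm (pi_ge0 R)).
    by rewrite ler_wpM2r // pi_le4.
  have : `|sin (pi * t)| ^+ 2 <= (4 * `|t|) ^+ 2 by rewrite lerXn2r // nnegrE // mulr_ge0.
  by rewrite real_normK ?num_real // [(2 * _) ^+ 2]exprMn mulr2n; lra.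
rewrite -(ler_pXn2r (ltn0Sn 1)) ?nnegrE ?normc_ge0 ?mulr_ge0 //.
by apply: le_trans h _; rewrite mulrA -natrM.
Qed.

Lemma cos_circle_ge0 t : `|t| <= 4^-1 -> 0 <= cos (2 * pi * t).
Proof.
rewrite ler_norml => /andP[h1 h2]; apply: cos_ge0_pihalf.
have := pi_gt0 R; move: pi => p p0; apply/andP; split; nra.
Qed.

Lemma Re_ec_ge0 t (z : int) : `|t - z%:~R| <= 4^-1 -> 0 <= complex.Re (ec t).
Proof. by move=> /cos_circle_ge0; rewrite -(ec_addz t z). Qed.

Lemma normc_ec1_ge1 t : 4^-1 <= `|t| <= 2^-1 -> 1 <= normc (ec t - 1).
Proof.
move=> /andP[h1 h2].
have : cos (2 * pi * t) <= 0.
  rewrite -cos_norm -(subrK pi `|_|) cosDpi oppr_le0; apply: cos_ge0_pihalf.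
  rewrite !normrM (ger0_norm (pi_ge0 R)) (@ger0_norm _ 2) //.
  have := pi_gt0 R; move: pi `|t| h1 h2 => p T h1 h2 p0; apply/andP; split; nra.
have := sqr_normc_ec1 t; have := normc_ge0 (ec t - 1).
by move: (normc _) (cos _) => x y; nra.
Qed.

Lemma normc_ec1_muln n t : normc (ec (n%:R * t) - 1) <= n%:R * normc (ec t - 1).
Proof.
elim: n => [|n IH]; first by rewrite !mul0r ec0 subrr normc_realE normr0.
rewrite -natr1 !mulrDl !mul1r ecD.
have -> : ec (n%:R * t) * ec t - 1 = ec t * (ec (n%:R * t) - 1) + (ec t - 1) by ring.
apply: le_trans (normcD _ _) _; rewrite ComplexField.Normc.normcM normc_ec mul1r.
by rewrite lerD2r.
Qed.

(** For n = floor(1 / (2|t|)) the multiple n t has absolute value in [1/4, 1/2], where |e(n t) - 1|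
    >= 1; and |e(n t) - 1| <= n |e(t) - 1|. *)
Lemma normc_ec1_ge t : `|t| <= 2^-1 -> 2 * `|t| <= normc (ec t - 1).
Proof.
move=> t2; have [->|t0] := eqVneq t 0; first by rewrite normr0 mulr0 normc_ge0.
have tp : 0 < `|t| by rewrite normr_gt0.
pose n := Num.truncn (2^-1 / `|t|).
have q0 : 0 <= 2^-1 / `|t| by rewrite divr_ge0 ?invr_ge0 ?ler0n // ltW.
have /andP[n1 n2] := truncn_itv q0; rewrite -/n in n1 n2.
have np : (0 < n)%N.
  by rewrite lt0n; apply/eqP => n0; move: n2; rewrite n0 ltr_pdivrMr // mul1r; lra.
have n1' : n%:R * `|t| <= 2^-1 by rewrite -ler_pdivlMr.
have n2' : 2^-1 < (n%:R + 1) * `|t| by rewrite natr1 -ltr_pdivrMr.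
have np' : 1 <= n%:R :> R by rewrite ler1n.
have : 1 <= normc (ec (n%:R * t) - 1).
  apply: normc_ec1_ge1; rewrite normrM normr_nat n1' andbT.
  have : `|t| <= n%:R * `|t| by rewrite ler_peMl // ltW.
  lra.
move=> /le_trans/(_ (normc_ec1_muln n t)) h.
have n0 : 0 < n%:R :> R by lra.
rewrite -(ler_pM2l n0); apply: le_trans h; lra.
Qed.

Definition nearz t (k : R) := exists z : int, `|t - z%:~R| <= k.

Lemma nearz_half t : nearz t 2^-1.
Proof.
exists (Num.floor (t + 2^-1)).
have /andP[h1 h2] := mem_rg1_floor (t + 2^-1).
by rewrite ler_norml; apply/andP; split; lra.
Qed.

Lemma nearz_normc_ec1 t k : normc (ec t - 1) <= k -> nearz t (k / 2).
Proof.
move=> h; have [z hz] := nearz_half t; exists z.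
have := normc_ec1_ge hz; rewrite (ec_addz t z) => h2.
by rewrite ler_pdivlMr // mulrC; apply: le_trans h2 h.
Qed.

Lemma normc_ec1_nearz t k : nearz t k -> normc (ec t - 1) <= 8 * k.
Proof.
move=> [z hz]; rewrite -(ec_addz t z); apply: le_trans (normc_ec1_le _) _.
by rewrite ler_wpM2l.
Qed.

Lemma nearz_mulz t k (c : int) : nearz t k -> nearz (c%:~R * t) (`|c|%:~R * k).
Proof.
move=> [z hz]; exists (c * z); rewrite intrM -mulrBr normrM intr_norm ler_wpM2l //.
Qed.

Lemma nearz_muln t k (c : nat) : nearz t k -> nearz (c%:R * t) (c%:R * k).
Proof.
move=> [z hz]; exists (c%:Z * z); rewrite intrM -mulrBr normrM normr_nat.
by rewrite ler_wpM2l.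
Qed.

Lemma nearzD s t k l : nearz s k -> nearz t l -> nearz (s + t) (k + l).
Proof.
move=> [z hz] [w hw]; exists (z + w); rewrite intrD opprD addrACA.
by apply: le_trans (ler_normD _ _) _; apply: lerD.
Qed.

Lemma nearz_sum (I : Type) (r : seq I) (P : pred I) (f k : I -> R) :
  (forall i, P i -> nearz (f i) (k i)) ->
  nearz (\sum_(i <- r | P i) f i) (\sum_(i <- r | P i) k i).
Proof.
move=> h; elim/big_rec2: _ => [|i a b Pi H]; first by exists 0; rewrite subrr normr0.
by apply: nearzD => //; apply: h.
Qed.

Lemma nearzW t k l : k <= l -> nearz t k -> nearz t l.
Proof. by move=> kl [z hz]; exists z; apply: le_trans kl. Qed.

Lemma normc_geom_le (N : nat) t k :
  k <= normc (\sum_(i < N) ec (i%:R * t)) -> 0 < k -> nearz t k^-1.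
Proof.
move=> hk k0.
have e : (\sum_(i < N) ec (i%:R * t)) * (ec t - 1) = ec t ^+ N - 1.
  rewrite mulrC subrX1; congr (_ * _); apply: eq_bigr => i _; exact: ecM.
have : normc (\sum_(i < N) ec (i%:R * t)) * normc (ec t - 1) <= 2.
  rewrite -ComplexField.Normc.normcM e; apply: le_trans (normcB _ _) _.
  by rewrite -ecM normc_ec normc_realE normr1.
move=> h; apply: nearzW (@nearz_normc_ec1 t (2 / k) _).
  by rewrite mulrAC divff ?mul1r // pnatr_eq0.
rewrite ler_pdivlMr // mulrC; apply: le_trans h; rewrite ler_wpM2r ?normc_ge0 //.
Qed.

Lemma dirichlet (r B : nat) (th : 'I_r -> R) : (0 < B)%N ->
  exists2 q : nat, (0 < q <= B ^ r)%N & forall i, nearz (q%:R * th i) B%:R^-1.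
Proof.
move=> B0.
have BR : 0 < B%:R :> R by rewrite ltr0n.
pose fr (t : R) := t - (Num.floor t)%:~R.
have fr0 t : 0 <= fr t by rewrite subr_ge0 floor_le.
have fr1 t : fr t < 1 by rewrite ltrBlDl; have := mem_rg1_floor t => /andP[].
have lt t : (Num.truncn (B%:R * fr t) < B)%N.
  by rewrite truncn_lt_nat ?mulr_ge0 ?ler0n // -[W in _ < W]mulr1 ltr_pM2l.
pose f (q : 'I_(B ^ r).+1) : {ffun 'I_r -> 'I_B} := [ffun i => Ordinal (lt (q%:R * th i)%R)].
have [q1 [q2 [q12 ef]]] : exists q1 q2 : 'I_(B ^ r).+1, (q1 < q2)%N /\ f q1 = f q2.
  have /injectivePn[x [y xy e]] : ~~ injectiveb f.
    apply/injectiveP => /leq_card; rewrite card_ffun !card_ord ltnn //.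
  have [lxy|lyx|/val_inj exy] := ltngtP x y; first by exists x, y.
    by exists y, x.
  by rewrite exy eqxx in xy.
exists (q2 - q1)%N.
  by rewrite subn_gt0 q12 /=; apply: leq_trans (leq_subr _ _) _; rewrite -ltnS.
move=> i; rewrite natrB ?(ltnW q12) // mulrBl.
exists (Num.floor (q2%:R * th i) - Num.floor (q1%:R * th i)).
have := congr1 (fun g : {ffun 'I_r -> 'I_B} => val (g i)) ef; rewrite !ffunE /=.
have := mulr_ge0 (ltW BR) (fr0 (q1%:R * th i)) => /truncn_itv /andP[a1 b1].
have := mulr_ge0 (ltW BR) (fr0 (q2%:R * th i)) => /truncn_itv /andP[a2 b2].
move=> e; rewrite e -(natr1 _) in a1 b1; rewrite -(natr1 _) in b2.
rewrite intrB -(ler_pM2l BR) divff ?gt_eqF // -[B%:R as X in X * _]ger0_norm ?ltW // -normrM.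
have -> : B%:R * (q2%:R * th i - q1%:R * th i -
  ((Num.floor (q2%:R * th i))%:~R - (Num.floor (q1%:R * th i))%:~R))
  = B%:R * fr (q2%:R * th i) - B%:R * fr (q1%:R * th i) by rewrite /fr; ring.
by rewrite ltr_norml; apply/andP; split; lra.
Qed.

End ExpCircle.

Lemma card_le_ord (T : finType) (A : {set T}) m (g : T -> 'I_m) :
  {in A &, injective g} -> (#|A| <= m)%N.
Proof.
move=> inj; rewrite -(card_in_imset inj); apply: leq_trans (max_card _) _.
by rewrite card_ord.
Qed.

(** * Quadratic Weyl sums *)

Section Weyl.
Variable R : realType.

Lemma close_pair (H B : nat) (S : {set 'I_H}) : (0 < B)%N -> (H < B * #|S|.-1)%N ->
  exists h1 h2 : 'I_H, [/\ h1 \in S, h2 \in S, (h1 < h2)%N & (h2 - h1 < B)%N].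
Proof.
move=> B0 cS.
pose f (h : 'I_H) := (h %/ B)%N.
have hf h : (f h < (H %/ B).+1)%N by rewrite ltnS leq_div2r // ltnW.
pose g (h : 'I_H) : 'I_(H %/ B).+1 := Ordinal (hf h).
have [inj|] := boolP [forall x in S, forall y in S, (g x == g y) ==> (x == y)].
  have : (#|S| <= (H %/ B).+1)%N.
    apply: (@card_le_ord _ _ _ g) => x y Sx Sy /eqP e; apply/eqP.
    by have /forall_inP/(_ x Sx)/forall_inP/(_ y Sy)/implyP := inj; apply.
  have : (B * (H %/ B) <= H)%N by rewrite mulnC leq_divM.
  move: cS; nia.
rewrite negb_forall_in => /exists_inP[x Sx]; rewrite negb_forall_in => /exists_inP[y Sy].
rewrite negb_imply => /andP[/eqP/(congr1 val) /= e nxy].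
wlog lxy : x y Sx Sy e nxy / (x < y)%N.
  move=> h; have [lxy|lyx|exy] := ltngtP x y; first exact: (h x y).
    by apply: (h y x) => //; rewrite eq_sym.
  by rewrite (val_inj exy) eqxx in nxy.
exists x, y; split=> //.
have := divn_eq x B; have := divn_eq y B.
have := ltn_pmod y B0; have := ltn_pmod x B0; rewrite /f in e; rewrite e; lia.
Qed.

(** Take the residue class mod q richest in S and its least and greatest elements. *)
Lemma spread_pair (H q : nat) (S : {set 'I_H}) : (0 < q)%N -> (0 < #|S|)%N ->
  exists h1 h2 : 'I_H, exists t : nat, [/\ h1 \in S, h2 \in S,
    h2 = (h1 + q * t)%N :> nat & (#|S| <= q * t.+1)%N].
Proof.
move=> q0 S0.
have [r hr] : exists r : 'I_q, (#|S| <= q * #|[set h in S | (h %% q)%N == r]|)%N.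
  apply/existsP; apply: contraT; rewrite negb_exists => /forallP h.
  have e : #|S| = (\sum_(r < q) #|[set h in S | (h %% q)%N == r]|)%N.
    rewrite -sum1_card (partition_big (fun h : 'I_H => Ordinal (ltn_pmod h q0)) predT) //=.
    apply: eq_bigr => r _; rewrite -sum1_card; apply: eq_bigl => x; rewrite inE.
    by rewrite -val_eqE.
  have : (q * #|S| < q * #|S|)%N.
    rewrite {1}e big_distrr /=.
    have -> : (q * #|S| = \sum_(i < q) #|S|)%N by rewrite sum_nat_const card_ord.
    have r0 : 'I_q by exists 0%N.
    rewrite (bigD1 r0) //= [X in (_ < X)%N](bigD1 r0) //= -addSn leq_add //.
      by rewrite ltnNge.
    by apply: leq_sum => w _; apply: ltnW; rewrite ltnNge.
  by rewrite ltnn.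
set C := [set h in S | _] in hr.
have [c0 Cc0] : exists c, c \in C.
  by apply/card_gt0P; move: hr; case: #|C| => //; rewrite muln0 leqNgt S0.
pose h1 := [arg min_(i < c0 in C) (i : nat)].
pose h2 := [arg max_(i > c0 in C) (i : nat)].
have [Ch1 min1] : h1 \in C /\ forall i, i \in C -> (h1 <= i)%N.
  by rewrite /h1; case: arg_minnP.
have [Ch2 max2] : h2 \in C /\ forall i, i \in C -> (i <= h2)%N.
  by rewrite /h2; case: arg_maxnP.
have Cmod h : h \in C -> (h : nat) = (h %/ q * q + r)%N.
  by rewrite inE => /andP[_ /eqP e]; rewrite {1}(divn_eq h q) e.
have e1 := Cmod _ Ch1; have e2 := Cmod _ Ch2.
have le12 := min1 _ Ch2.
exists h1, h2, (h2 %/ q - h1 %/ q)%N; split.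
- by move: Ch1; rewrite inE => /andP[].
- by move: Ch2; rewrite inE => /andP[].
- have : (h1 %/ q <= h2 %/ q)%N by apply: leq_div2r.
  by move: e1 e2 => {2}-> {2}->; nia.
apply: leq_trans hr _; rewrite leq_mul2l; apply/orP; right.
have hf (h : 'I_H) : h \in C -> (h %/ q - h1 %/ q < (h2 %/ q - h1 %/ q).+1)%N.
  by move=> Ch; rewrite ltnS leq_sub2r // leq_div2r // max2.
pose g (h : 'I_H) : 'I_(h2 %/ q - h1 %/ q).+1 := inord (h %/ q - h1 %/ q).
apply: (@card_le_ord _ _ _ g) => x y Cx Cy /(congr1 val); rewrite /= !inordK ?hf // => e.
apply: val_inj => /=; rewrite (Cmod _ Cx) (Cmod _ Cy).
have lx : (h1 %/ q <= x %/ q)%N by apply: leq_div2r; apply: min1.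
have ly : (h1 %/ q <= y %/ q)%N by apply: leq_div2r; apply: min1.
suff -> : (x %/ q = y %/ q)%N by [].
by rewrite -(subnK lx) e subnK.
Qed.

Lemma nearz_small (x k : R) : `|x| <= 4^-1 -> k <= 4^-1 -> nearz x k -> `|x| <= k.
Proof.
move=> hx hk [z hz].
have [z0|z0] := eqVneq z 0; first by move: hz; rewrite z0 subr0.
have : 1 <= `|z%:~R : R|.
  by rewrite -intr_norm -[1]/(1%:~R) ler_int -gtz0_ge1 normr_gt0.
have := ler_distD x z%:~R 0; rewrite !subr0 distrC; lra.
Qed.

(** A close pair in S gives a small q with q phi within 2k of an integer; call the error psi. A
    distant pair congruent mod q gives t >= H / (256 E^4) with t psi within 2k of an integer. As t
    |psi| <= 2 k H <= 1/4, that integer is 0 and |psi| <= 2k / t. *)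
Lemma clustered_multiples (phi : R) (h' : nat) (E H : nat) (k : R) (S : {set 'I_H}) :
  (0 < E)%N -> (2 ^ 12 * E ^ 6 <= H)%N -> (H <= 8 * E ^ 2 * #|S|)%N ->
  0 <= k -> 8 * k * H%:R <= 1 ->
  (forall h, h \in S -> nearz (phi * (h%:R - h'%:R)) k) ->
  exists2 q : nat, (0 < q <= 16 * E ^ 2)%N &
    nearz (q%:R * phi) (2 ^+ 9 * k * E%:R ^+ 4 / H%:R).
Proof.
move=> E0 hH cS k0 kH hS.
have E2 : (0 < E ^ 2)%N by rewrite expn_gt0 E0.
have E4 : (E ^ 4 = E ^ 2 * E ^ 2)%N by rewrite -expnD.
have E6 : (E ^ 6 = E ^ 2 * E ^ 2 * E ^ 2)%N by rewrite -!expnD.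
have H0 : (0 < H)%N by apply: leq_trans hH; rewrite muln_gt0 ![(0 < _ ^ _)%N]expn_gt0 E0.
have [||h1 [h2 [S1 S2 lt12 lt]]] := @close_pair H (16 * E ^ 2) S.
- by rewrite muln_gt0.
- by move: cS hH; rewrite E6; move: (E ^ 2)%N E2 #|S| => e; nia.
pose q := (h2 - h1)%N.
have q0 : (0 < q)%N by rewrite subn_gt0.
have S0 : (0 < #|S|)%N by apply/card_gt0P; exists h1.
have diff (x y : 'I_H) : x \in S -> y \in S -> nearz ((y%:R - x%:R) * phi) (2 * k).
  move=> Sx Sy; have [z hz] := hS _ Sx; have [w hw] := hS _ Sy.
  exists (w - z); rewrite intrB.
  have -> : (y%:R - x%:R) * phi - (w%:~R - z%:~R) =
    (phi * (y%:R - h'%:R) - w%:~R) - (phi * (x%:R - h'%:R) - z%:~R) by ring.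
  by apply: le_trans (ler_normB _ _) _; lra.
have [z hz] := diff _ _ S1 S2.
rewrite -natrB ?(ltnW lt12) // -/q in hz.
have [g1 [g2 [t [G1 G2 eg ct]]]] := spread_pair q0 S0.
exists q; first by rewrite q0 ltnW.
exists z; set psi := q%:R * phi - z%:~R in hz *.
have HR : 0 < H%:R :> R by rewrite ltr0n.
have k8 : 8 * k <= 1.
  apply: le_trans kH; rewrite ler_peMr ?mulr_ge0 //; by rewrite ler1n.
have tH : (q * t <= H)%N by have := ltn_ord g2; rewrite eg; lia.
have tpsi : `|t%:R * psi| <= 2 * k.
  apply: nearz_small.
  - rewrite normrM normr_nat.
    have tH' : t%:R <= H%:R :> R.
      by rewrite ler_nat; apply: leq_trans tH; rewrite leq_pmull.
    have : t%:R * `|psi| <= H%:R * (2 * k) by rewrite ler_pM.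
    lra.
  - lra.
  - have := diff _ _ G1 G2; rewrite eg natrD natrM addrAC subrr add0r => -[w hw].
    exists (w - t%:Z * z); rewrite intrB intrM.
    by have -> : t%:R * psi - (w%:~R - t%:Z%:~R * z%:~R) = q%:R * t%:R * phi - w%:~R
      by rewrite /psi -pmulrn; ring.
have hHt : (H <= 256 * E ^ 4 * t)%N.
  have hq : (q * t.+1 <= 16 * E ^ 2 * t.+1)%N by rewrite leq_mul2r ltnW ?orbT.
  have h3 : (H <= 128 * E ^ 4 * t.+1)%N.
    rewrite E4; apply: leq_trans cS _.
    apply: leq_trans (_ : 8 * E ^ 2 * (16 * E ^ 2 * t.+1) <= _)%N; last by lia.
    by rewrite leq_mul2l (leq_trans ct hq) orbT.
  move: h3 hH; rewrite E6 E4; case: (t) => [|t']; move: (E ^ 2)%N E2 => e; nia.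
rewrite normrM normr_nat in tpsi.
rewrite ler_pdivlMr // mulrC.
have : H%:R <= 256 * E%:R ^+ 4 * t%:R :> R by rewrite -natrX -!natrM ler_nat.
move=> hR; apply: le_trans (ler_wpM2r (normr_ge0 _) hR) _.
have E4R : 0 <= E%:R ^+ 4 :> R by rewrite exprn_ge0.
have : E%:R ^+ 4 * (t%:R * `|psi|) <= E%:R ^+ 4 * (2 * k) by rewrite ler_wpM2l.
have -> : (2 : R) ^+ 9 = 512 by rewrite -natrX.
lra.
Qed.

(** Van der Corput: average over shifts h < H, apply Cauchy-Schwarz and fix one shift h' by
    pigeonhole. The differenced sums are geometric with ratio e(2 th (h - h')), so a proportion 1 /
    (8 E^2) of the h makes 2 th (h - h') nearly integral, and [clustered_multiples] extracts one
    small denominator. *)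
Lemma weyl (th : R) (E H : nat) : (0 < E)%N -> (2 ^ 12 * E ^ 6 <= H)%N ->
  (64 * E ^ 2 * H)%:R <= E%:R * normc (\sum_(i < 64 * E ^ 2 * H) ec (th * (i.+1)%:R ^+ 2)) ->
  exists2 q : nat, (0 < q <= 32 * E ^ 2)%N &
    nearz (q%:R * th) (2 ^+ 18 * E%:R ^+ 8 / (64 * E ^ 2 * H)%:R ^+ 2).
Proof.
move=> E0 hH; set N := (64 * E ^ 2 * H)%N => hS.
have E2 : (0 < E ^ 2)%N by rewrite expn_gt0 E0.
have H0 : (0 < H)%N by apply: leq_trans hH; rewrite muln_gt0 ![(0 < _ ^ _)%N]expn_gt0 E0.
have N0 : (0 < N)%N by rewrite /N muln_gt0 H0 andbT; move: E2; move: (E ^ 2)%N => e; lia.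
have ER : 1 <= E%:R :> R by rewrite ler1n.
have HR : 1 <= H%:R :> R by rewrite ler1n.
have NR : 0 < N%:R :> R by rewrite ltr0n.
have NE : N%:R = 64 * E%:R ^+ 2 * H%:R :> R by rewrite /N natrM natrM natrX.
pose u (x : nat) : R[i] := ec (th * x.+1%:R ^+ 2).
have uN x : normc (u x) = 1 by apply: normc_ec.
pose S := \sum_(i < N) u i.
(* Shifting the window by h exchanges h terms at each end, all of modulus 1. *)
have shift h : normc (S - \sum_(i < N) u (i + h)%N) <= 2 * h%:R.
  elim: h => [|h IH].
    rewrite (_ : _ - _ = 0) ?normc_realE ?normr0 ?mulr0 //.
    by apply/eqP; rewrite subr_eq0; apply/eqP/eq_bigr => i _; rewrite addn0.
  have e : \sum_(i < N) u (i + h.+1)%N = \sum_(i < N) u (i + h)%N - u h + u (N + h)%N.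
    have e1 : \sum_(i < N.+1) u (i + h)%N = u h + \sum_(i < N) u (i + h.+1)%N.
      rewrite big_ord_recl add0n; congr (_ + _); apply: eq_bigr => i _.
      by rewrite /= /bump leq0n add1n addSnnS.
    have e2 : \sum_(i < N.+1) u (i + h)%N = \sum_(i < N) u (i + h)%N + u (N + h)%N.
      by rewrite big_ord_recr.
    by rewrite e2 in e1; rewrite addrAC e1 addrAC subrr add0r.
  rewrite e; have -> : S - (\sum_(i < N) u (i + h)%N - u h + u (N + h)%N)
    = (S - \sum_(i < N) u (i + h)%N) + (u h - u (N + h)%N) by ring.
  apply: le_trans (normcD _ _) _; have := normcB (u h) (u (N + h)%N); rewrite !uN -natr1; lra.
have hSS : N%:R <= E%:R * normc S := hS.
pose Q i := \sum_(h < H) u (i + h)%N.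
have h1 : H%:R * N%:R <= 2 * E%:R * \sum_(i < N) normc (Q i).
  have h2 : H%:R * normc S <= \sum_(i < N) normc (Q i) + 2 * H%:R ^+ 2.
    have -> : H%:R * normc S = normc (\sum_(h < H) S).
      by rewrite sumr_const card_ord -[S *+ H]mulr_natl ComplexField.Normc.normcM -(rmorph_nat (real_complex R)) normc_realE normr_nat.
    have -> : \sum_(h < H) S = \sum_(i < N) Q i + \sum_(h < H) (S - \sum_(i < N) u (i + h)%N).
      rewrite -[\sum_(i < N) Q i]exchange_big /= -big_split /=; apply: eq_bigr => h _.
      by rewrite addrC subrK.
    apply: le_trans (normcD _ _) _; apply: lerD; first exact: normc_sum.
    apply: le_trans (normc_sum _ _ _) _.
    apply: le_trans (_ : \sum_(h < H) 2 * H%:R <= _).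
      apply: ler_sum => h _; apply: le_trans (shift _) _.
      by rewrite ler_wpM2l // ler_nat ltnW.
    by rewrite sumr_const card_ord -mulr_natl; lra.
  have h3 : H%:R * N%:R <= E%:R * (\sum_(i < N) normc (Q i) + 2 * H%:R ^+ 2).
    apply: le_trans (_ : H%:R * (E%:R * normc S) <= _); first by rewrite ler_wpM2l.
    by rewrite mulrCA ler_wpM2l.
  have : E%:R * (2 * H%:R ^+ 2) * 2 <= H%:R * N%:R :> R.
    rewrite NE; have : E%:R <= E%:R ^+ 2 :> R by rewrite expr2 ler_peMl // ltW // (lt_le_trans ltr01).
    have : 0 <= H%:R ^+ 2 :> R by apply: sqr_ge0.
    have -> : H%:R * (64 * E%:R ^+ 2 * H%:R) = 64 * E%:R ^+ 2 * H%:R ^+ 2 :> R by ring.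
    move: (H%:R ^+ 2) (E%:R ^+ 2) => a b; nra.
  lra.
have h4 : H%:R ^+ 2 * N%:R <= 4 * E%:R ^+ 2 * \sum_(i < N) normc (Q i) ^+ 2.
  have h5 := sqr_sum_le predT (fun i : 'I_N => normc (Q i)).
  rewrite card_ord in h5.
  have h6 : (H%:R * N%:R) ^+ 2 <= (2 * E%:R * \sum_(i < N) normc (Q i)) ^+ 2.
    rewrite lerXn2r // nnegrE; first by rewrite mulr_ge0.
    by rewrite !mulr_ge0 ?ler0n // sumr_ge0 // => i _; apply: normc_ge0.
  rewrite -(ler_pM2r NR); apply: le_trans (_ : (H%:R * N%:R) ^+ 2 <= _); first by rewrite exprMn expr2 mulrA.
  apply: le_trans h6 _; rewrite !exprMn -natrX.
  apply: le_trans (ler_wpM2l _ h5) _; first by rewrite mulr_ge0 ?ler0n // exprn_ge0.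
  by rewrite le_eqVlt; apply/orP; left; apply/eqP; ring.
pose D (x : R) := normc (\sum_(i < N) ec (i%:R * x)).
have h7 : \sum_(i < N) normc (Q i) ^+ 2 <=
    \sum_(h' < H) \sum_(h < H) D (2 * th * (h%:R - h'%:R)).
  have e : \sum_(i < N) (normc (Q i) ^+ 2)%:C = \sum_(h' < H) \sum_(h < H)
      ec (th * ((h.+1)%:R ^+ 2 - (h'.+1)%:R ^+ 2)) *
      \sum_(i < N) ec (i%:R * (2 * th * (h%:R - h'%:R))).
    transitivity (\sum_(i < N) \sum_(h' < H) \sum_(h < H) u (i + h)%N * conjc (u (i + h')%N)).
      by apply: eq_bigr => i _; rewrite -mulcJ /Q conjc_sum big_distrlr exchange_big.
    rewrite exchange_big; apply: eq_bigr => h' _; rewrite exchange_big; apply: eq_bigr => h _.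
    rewrite mulr_sumr; apply: eq_bigr => i _.
    rewrite /u -ecN -!ecD; congr ec; rewrite -!natr1 !natrD; ring.
  have : (\sum_(i < N) normc (Q i) ^+ 2) = normc (\sum_(i < N) (normc (Q i) ^+ 2)%:C).
    rewrite -real_complex_sum normc_realE ger0_norm // sumr_ge0 // => i _.
    exact: sqr_ge0.
  rewrite e => ->; apply: le_trans (normc_sum _ _ _) _; apply: ler_sum => h' _.
  apply: le_trans (normc_sum _ _ _) _; apply: ler_sum => h _.
  by rewrite ComplexField.Normc.normcM normc_ec mul1r.
have [h' hh'] : exists h' : 'I_H, H%:R * N%:R <= 4 * E%:R ^+ 2 * \sum_(h < H) D (2 * th * (h%:R - h'%:R)).
  apply/existsP; apply: contraT; rewrite negb_exists => /forallP h.
  have : \sum_(h' < H) (4 * E%:R ^+ 2 * \sum_(h < H) D (2 * th * (h%:R - h'%:R)))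
      < \sum_(h' < H) H%:R * N%:R.
    apply: ltr_sum; first by apply/hasP; exists (Ordinal H0); rewrite ?mem_index_enum.
    by move=> i _; have := h i; rewrite -ltNge.
  rewrite -mulr_sumr sumr_const card_ord -[X in _ < X]mulr_natl [X in _ < X]mulrA -expr2 => lt.
  have : 4 * E%:R ^+ 2 * \sum_(i < N) normc (Q i) ^+ 2 <=
     4 * E%:R ^+ 2 * \sum_(h' < H) \sum_(h < H) D (2 * th * (h%:R - h'%:R)).
    by rewrite ler_wpM2l // mulr_ge0 // exprn_ge0.
  lra.
pose T := [set h : 'I_H | N%:R <= 8 * E%:R ^+ 2 * D (2 * th * (h%:R - h'%:R))].
have DN x : D x <= N%:R.
  apply: le_trans (normc_sum _ _ _) _; under eq_bigr do rewrite normc_ec.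
  by rewrite sumr_const card_ord.
have E2R : 0 < E%:R ^+ 2 :> R by rewrite exprn_gt0 // (lt_le_trans ltr01).
have cT : (H <= 8 * E ^ 2 * #|T|)%N.
  rewrite -(ler_nat R) natrM natrM natrX.
  move: (hh'); set sD := \sum_(h < H) D _ => hD.
  have : 8 * E%:R ^+ 2 * sD <= 8 * E%:R ^+ 2 * (N%:R * #|T|%:R) + N%:R * H%:R.
    rewrite /sD (bigID (mem T)) /= mulrDr; apply: lerD.
      rewrite ler_wpM2l ?mulr_ge0 ?(ltW E2R) //.
      by rewrite mulr_natr -sumr_const; apply: ler_sum => h _; apply: DN.
    rewrite mulr_sumr; apply: le_trans (_ : \sum_(h < H | h \notin T) N%:R <= _).
      by apply: ler_sum => h; rewrite inE -ltNge => /ltW.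
    rewrite sumr_const -[X in X <= _]mulr_natr ler_wpM2l // ler_nat.
    by apply: leq_trans (max_card _) _; rewrite card_ord.
  move=> h8; have h9 : N%:R * H%:R <= N%:R * (8 * E%:R ^+ 2 * #|T|%:R) :> R.
    by move: hD h8; move: sD (#|T|%:R : R) (N%:R : R) (H%:R : R) (E%:R ^+ 2 : R) => a b c d e; lra.
  by rewrite ler_pM2l in h9.
have [|||q /andP[q0 q1] hq] := @clustered_multiples (2 * th) h' E H (8 * E%:R ^+ 2 / N%:R) T E0 hH cT.
- by rewrite divr_ge0 // mulr_ge0 // ltW.
- rewrite NE le_eqVlt; apply/orP; left; apply/eqP; field.
  by rewrite !gt_eqF // (lt_le_trans ltr01).
- move=> h; rewrite inE => hT.
  have p8 : 0 < 8 * E%:R ^+ 2 :> R by rewrite mulr_gt0.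
  have Dp : N%:R / (8 * E%:R ^+ 2) <= D (2 * th * (h%:R - h'%:R)).
    by rewrite ler_pdivrMr // mulrC.
  by have := normc_geom_le Dp (divr_gt0 NR p8); rewrite invf_div.
exists (2 * q)%N; first by rewrite muln_gt0 q0 /=; lia.
rewrite natrM -mulrA mulrCA; apply: nearzW hq.
have H1 : 0 < H%:R :> R by apply: lt_le_trans HR.
have E1' : 0 < E%:R :> R by apply: lt_le_trans ER.
rewrite NE le_eqVlt; apply/orP; left; apply/eqP; field.
by rewrite !gt_eqF.
Qed.

End Weyl.

(** * Integer row spaces with bounded denominators *)

Section RowSpace.
Import all_fingroup.

Definition intmx_rat m n (A : 'M[int]_(m, n)) : 'M[rat]_(m, n) := map_mx intr A.

Lemma normr_det_le n (A : 'M[int]_n) (K : nat) :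
  (forall i j, `|A i j| <= K%:Z) -> `|\det A| <= (n`! * K ^ n)%:Z.
Proof.
move=> hA; apply: le_trans (ler_norm_sum _ _ _) _.
apply: le_trans (_ : \sum_(s : 'S_n) (K ^ n)%:Z <= _).
  apply: ler_sum => s _; rewrite normrM normrX normrN1 expr1n mul1r normr_prod.
  apply: le_trans (_ : \prod_(i < n) K%:Z <= _); last first.
    by rewrite prodr_const card_ord -[K%:Z]natz -natrX natz.
  by apply: ler_prod => i _; rewrite normr_ge0 hA.
by rewrite sumr_const card_Sn -mulr_natl PoszM natz.
Qed.

Lemma normr_adj_le n (A : 'M[int]_n) (K : nat) i j :
  (forall i j, `|A i j| <= K%:Z) -> `|(\adj A) i j| <= (n.-1`! * K ^ n.-1)%:Z.
Proof.
move=> hA; rewrite mxE /cofactor normrM normrX normrN1 expr1n mul1r.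
by apply: normr_det_le => i' j'; rewrite !mxE.
Qed.

Lemma row_free_col_mx (F : fieldType) s m (K : 'M[F]_(s, m)) (k : 'rV[F]_m) :
  row_free K -> ~~ (k <= K)%MS -> row_free (col_mx K k).
Proof.
move=> fK nk; rewrite /row_free -addsmxE.
have k0 : k != 0 by apply: contraNneq nk => ->; apply: sub0mx.
have c0 : (K :&: k)%MS = 0.
  apply/eqP; rewrite -mxrank_eq0; apply: contraT; rewrite -lt0n => hr.
  case/negP: nk; apply: submx_trans (capmxSl K k).
  rewrite -(geq_leqif (mxrank_leqif_sup (capmxSr K k))) rank_rV k0.
  exact: hr.
by rewrite mxrank_disjoint_sum // (eqnP fK) rank_rV k0.
Qed.

(* Cramer's rule: one denominator serves all integer vectors in the row space. *)
Lemma row_space_denominator s m (K : 'M[int]_(s, m)) (B : nat) :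
  (forall i j, `|K i j| <= B%:Z) -> row_free (intmx_rat K) ->
  exists2 D : int, D != 0 /\ `|D| <= (s`! * B ^ s)%:Z &
  forall k : 'rV[int]_m, (forall j, `|k 0 j| <= B%:Z) ->
    (intmx_rat k <= intmx_rat K)%MS ->
    exists2 c : 'rV[int]_s, (forall j, `|c 0 j| <= (s`! * B ^ s)%:Z) & D *: k = c *m K.
Proof.
move=> hK fK.
have fT : row_full (intmx_rat K)^T by rewrite /row_full mxrank_tr.
pose f := fullrankfun fT.
pose M := colsub f K.
have hM i j : `|M i j| <= B%:Z by rewrite mxE.
have Mq : intmx_rat M = (rowsub f (intmx_rat K)^T)^T.
  by apply/matrixP => i j; rewrite !mxE.
have uM : intmx_rat M \in unitmx by rewrite Mq unitmx_tr fullrowsub_unit.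
have dM : \det (intmx_rat M) = (\det M)%:~R by rewrite det_map_mx.
exists (\det M).
  split; last exact: normr_det_le.
  apply: contraTneq uM => d0; rewrite unitmxE dM d0; by rewrite unitr0.
move=> k hk /submxP[x ex].
exists (colsub f k *m \adj M).
  move=> j; rewrite mxE; apply: le_trans (ler_norm_sum _ _ _) _.
  apply: le_trans (_ : \sum_(i < s) B%:Z * (s.-1`! * B ^ s.-1)%:Z <= _).
    apply: ler_sum => i _; rewrite normrM ler_pM //; first by rewrite mxE.
    exact: normr_adj_le.
  rewrite sumr_const card_ord -mulr_natl natz -!PoszM lez_nat.
  case: (s) j => [[]//|s' _ /=]; rewrite factS expnS; nia.
have inj : injective (map_mx (intr : int -> rat) : 'rV[int]_m -> 'rV[rat]_m).
  move=> a b /matrixP h; apply/matrixP => i j; have := h i j; rewrite !mxE => /eqP.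
  by rewrite eqr_int => /eqP.
apply: inj; rewrite map_mxZ !map_mxM map_mx_adj /= -/(intmx_rat k) -/(intmx_rat K) -/(intmx_rat M).
have ek : map_mx intr (colsub f k) = x *m intmx_rat M.
  have -> : map_mx intr (colsub f k) = colsub f (intmx_rat k).
    by apply/matrixP => i j; rewrite !mxE.
  rewrite ex; apply/matrixP => i j; rewrite !mxE; apply: eq_bigr => l _; by rewrite !mxE.
rewrite ek -(mulmxA x) mul_mx_adj dM mul_mx_scalar -scalemxAl -ex.
by [].
Qed.

End RowSpace.

(** * Schmidt's theorem on simultaneous approximation by squares *)

Section Schmidt.
Variables (R : realType) (m B : nat) (al : 'I_m -> R).
Hypotheses (m_gt0 : (0 < m)%N) (B_ge : (8 * m <= B)%N).

(** [Rk] bounds the frequencies of the test kernel. [E] is such that frequencies of mean at most 1/E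
    destroy at most half of the zero frequency. [E1] dominates the determinants s! Rk^s of Cramer's
    rule. [len s] is the range of the multiplier once s relations are known: it has the shape 64 E^2
    H required by [weyl], and shrinks by [g] at each stage to absorb the losses. *)
Let Rk : nat := (2 * m * B ^ 2)%N.
Let E : nat := (2 * Rk ^ m)%N.
Let E1 : nat := ((m * Rk) ^ m)%N.
Let g : nat := (2 ^ 13 * m * E1 * E ^ 6)%N.
Let len s : nat := (64 * E ^ 2 * g ^ (m.+1 - s))%N.

Definition dotz (k : 'rV[int]_m) : R := \sum_i (k 0 i)%:~R * al i.

(** Index set of the kernel. The product over i of the 2m-th power of a B^2-term geometric sum in x
    al_i is expanded by choosing a term in each factor; [sig f] is the resulting frequency vector
    and [kvec f f'] a frequency of the squared modulus. *)
Let fld := {ffun 'I_m * 'I_(2 * m) -> 'I_(B ^ 2)}.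
Let sig (f : fld) (i : 'I_m) : nat := \sum_(j < 2 * m) f (i, j).
Let kvec (f f' : fld) : 'rV[int]_m := \row_i ((sig f i)%:Z - (sig f' i)%:Z).

Let B_gt0 : (0 < B)%N. Proof. by apply: leq_trans B_ge; rewrite muln_gt0. Qed.
Let B2_gt0 : (0 < B ^ 2)%N. Proof. by rewrite expn_gt0 B_gt0. Qed.
Let Rk_gt0 : (0 < Rk)%N. Proof. by rewrite /Rk muln_gt0 B2_gt0 andbT muln_gt0 m_gt0. Qed.
Let E_gt0 : (0 < E)%N. Proof. by rewrite /E muln_gt0 [(0 < Rk ^ m)%N]expn_gt0 Rk_gt0. Qed.
Let E1_gt0 : (0 < E1)%N. Proof. by rewrite /E1 expn_gt0 muln_gt0 m_gt0 Rk_gt0. Qed.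
Let g_gt0 : (0 < g)%N.
Proof.
by rewrite /g muln_gt0 [(0 < E ^ 6)%N]expn_gt0 E_gt0 andbT muln_gt0 E1_gt0 andbT muln_gt0 m_gt0.
Qed.

Lemma sig_lt f i : (sig f i < Rk)%N.
Proof.
apply: leq_trans (_ : (\sum_(j < 2 * m) (B ^ 2).-1).+1 <= _)%N.
  by rewrite ltnS; apply: leq_sum => j _; rewrite -ltnS prednK.
rewrite sum_nat_const card_ord /Rk; move: B2_gt0; case: (B ^ 2)%N => //= b _; nia.
Qed.

Lemma kvec_le f f' j : `|kvec f f' 0 j| <= Rk%:Z.
Proof.
rewrite mxE; have := sig_lt f j; have := sig_lt f' j.
move: (sig f j) (sig f' j) => a b ha hb; rewrite ler_norml; lia.
Qed.

Let P (t : R) : R[i] := \sum_(r < B ^ 2) ec (r%:R * t).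

Lemma prod_P (x : R) : \prod_(ij : 'I_m * 'I_(2 * m)) P (x * al ij.1)
  = \sum_(f : fld) ec (x * \sum_i (sig f i)%:R * al i).
Proof.
rewrite bigA_distr_bigA /=; apply: eq_bigr => f _.
have -> : x * \sum_i (sig f i)%:R * al i
   = \sum_(ij : 'I_m * 'I_(2 * m)) (f ij)%:R * (x * al ij.1).
  have -> : \sum_(ij : 'I_m * 'I_(2 * m)) (f ij)%:R * (x * al ij.1)
      = \sum_(i < m) \sum_(j < 2 * m) (f (i, j))%:R * (x * al i).
    by rewrite pair_bigA; apply: eq_bigr => -[].
  rewrite mulr_sumr; apply: eq_bigr => i _; rewrite -mulr_suml natr_sum; ring.
by rewrite (big_morph _ (@ecD R) (@ec0 R)).
Qed.

Lemma sqr_prod_P (x : R) :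
  (normc (\prod_(ij : 'I_m * 'I_(2 * m)) P (x * al ij.1)) ^+ 2)%:C
  = \sum_(f : fld) \sum_(f' : fld) ec (x * dotz (kvec f f')).
Proof.
rewrite -mulcJ prod_P conjc_sum big_distrlr.
apply: eq_bigr => f _; apply: eq_bigr => f' _.
rewrite -[LHS]/(ec _ * conjc (ec _)) -ecN -ecD; congr ec.
rewrite -mulrN -mulrDr; congr (_ * _); rewrite /dotz -sumrB.
by apply: eq_bigr => i _; rewrite mxE intrB mulrBl.
Qed.

(** A bad coordinate replaces B^2 by B in its 2m factors, a gain of B^(2m) over the trivial
    bound. *)
Lemma prod_P_bad (x : R) : ~ (forall i, nearz (x * al i) B%:R^-1) ->
  normc (\prod_(ij : 'I_m * 'I_(2 * m)) P (x * al ij.1)) <=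
    B%:R ^+ (2 * m) * (B ^ 2)%:R ^+ (2 * m * m.-1).
Proof.
move=> bad.
have [i hi] : exists i, normc (P (x * al i)) <= B%:R.
  apply/existsP; apply: contraT; rewrite negb_exists => /forallP h; case: bad => i.
  apply: (@normc_geom_le _ (B ^ 2) (x * al i) B%:R); last by rewrite ltr0n.
  by have := h i; rewrite -ltNge => /ltW.
have hP t : normc (P t) <= (B ^ 2)%:R.
  apply: le_trans (normc_sum _ _ _) _; under eq_bigr do rewrite normc_ec.
  by rewrite sumr_const card_ord.
have nprod : normc (\prod_(ij : 'I_m * 'I_(2 * m)) P (x * al ij.1))
    = \prod_(ij : 'I_m * 'I_(2 * m)) normc (P (x * al ij.1)).
  apply: (big_morph _ (@ComplexField.Normc.normcM R)); exact: ComplexField.Normc.normc1.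
rewrite nprod -(pair_bigA _ (fun i j => normc (P (x * al i)))) /= (bigD1 i) //=.
apply: ler_pM.
- by apply: prodr_ge0 => j _; apply: normc_ge0.
- by apply: prodr_ge0 => j _; apply: prodr_ge0 => l _; apply: normc_ge0.
- by rewrite prodr_const card_ord lerXn2r // nnegrE ?normc_ge0 ?ler0n.
- have -> : (B ^ 2)%:R ^+ (2 * m * m.-1) = \prod_(j | j != i) ((B ^ 2)%:R ^+ (2 * m)) :> R.
    by rewrite prodr_const exprM cardC1 card_ord.
  apply: ler_prod => j _; apply/andP; split.
    by apply: prodr_ge0 => l _; apply: normc_ge0.
  by rewrite prodr_const card_ord lerXn2r // nnegrE ?normc_ge0 ?ler0n.
Qed.

(** [sig f] takes at most Rk^m values, so by Cauchy-Schwarz many pairs share one; these are the zero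
    frequencies of the squared modulus. *)
Lemma card_diag : (#|fld| ^ 2 <= Rk ^ m * \sum_(f : fld) \sum_(f' : fld) (kvec f f' == 0%R))%N.
Proof.
pose s (f : fld) : {ffun 'I_m -> 'I_Rk} := [ffun i => Ordinal (sig_lt f i)].
have e f f' : (kvec f f' == 0) = (s f == s f').
  apply/eqP/eqP => [/rowP h|/ffunP h].
    apply/ffunP => i; have := h i; rewrite !mxE !ffunE => /eqP.
    by rewrite subr_eq0 => /eqP [e]; apply: val_inj.
  apply/rowP => i; have := congr1 val (h i); rewrite !mxE !ffunE /= => ->.
  by rewrite subrr.
have h := sqrn_sum_le predT (fun v : {ffun 'I_m -> 'I_Rk} => #|[set f | s f == v]|).
have e1 : (\sum_v #|[set f | s f == v]| = #|fld|)%N.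
  rewrite -[RHS]sum1_card (partition_big s predT) //=; apply: eq_bigr => v _.
  by rewrite -sum1_card; apply: eq_bigl => f; rewrite inE.
have e2 : (\sum_v #|[set f | s f == v]| ^ 2 =
    \sum_(f : fld) \sum_(f' : fld) (kvec f f' == 0%R))%N.
  have -> : (\sum_(f : fld) \sum_(f' : fld) (kvec f f' == 0%R) =
     \sum_(f : fld) #|[set f' | s f' == s f]|)%N.
    apply: eq_bigr => f _; rewrite -sum1_card [RHS]big_mkcond /=; apply: eq_bigr => f' _.
    by rewrite inE e eq_sym; case: eqP.
  rewrite [RHS](partition_big s predT) //=; apply: eq_bigr => v _.
  rewrite -mulnn -sum_nat_const; apply: eq_big => f; first by rewrite inE.
  by rewrite inE => /eqP->.
rewrite e1 e2 in h; apply: leq_trans h _.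
by rewrite leq_mul2r (_ : #|_| = Rk ^ m)%N ?leqnn ?orbT // card_ffun !card_ord.
Qed.

(* The mean of the nonnegative kernel over a is at least its zero frequency minus 1/E. *)
Lemma schmidt_test (q N : nat) (U : pred 'rV[int]_m) : (0 < N)%N ->
  (forall k : 'rV[int]_m, (forall j, `|k 0 j| <= Rk%:Z) -> U k ->
    forall a, (a < N)%N -> 0 <= complex.Re (ec (q%:R ^+ 2 * a.+1%:R ^+ 2 * dotz k))) ->
  (forall k : 'rV[int]_m, (forall j, `|k 0 j| <= Rk%:Z) -> ~~ U k ->
    E%:R * normc (\sum_(a < N) ec (q%:R ^+ 2 * dotz k * a.+1%:R ^+ 2)) <= N%:R) ->
  exists2 a : nat, (a < N)%N & forall i, nearz ((q * a.+1)%:R ^+ 2 * al i) B%:R^-1.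
Proof.
move=> N0 hU hnU.
case: (pselect (exists2 a : nat, (a < N)%N & forall i, nearz ((q * a.+1)%:R ^+ 2 * al i) B%:R^-1)) => //.
move=> none; exfalso.
pose W (a : nat) := normc (\prod_(ij : 'I_m * 'I_(2 * m)) P ((q * a.+1)%:R ^+ 2 * al ij.1)) ^+ 2.
pose F : R := #|fld|%:R.
have FE : F = (B ^ 2)%:R ^+ (2 * m * m).
  by rewrite /F card_ffun card_prod !card_ord natrX mulnC.
have F0 : 0 < F by rewrite FE exprn_gt0 // ltr0n.
have NR : 0 < N%:R :> R by rewrite ltr0n.
have BR : 0 < B%:R :> R by rewrite ltr0n.
have up : \sum_(a < N) W a * B%:R ^+ (4 * m) <= N%:R * F ^+ 2.
  have -> : N%:R * F ^+ 2 = \sum_(a < N) F ^+ 2 by rewrite sumr_const card_ord mulr_natl.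
  apply: ler_sum => a _.
  have : normc (\prod_(ij : 'I_m * 'I_(2 * m)) P ((q * a.+1)%:R ^+ 2 * al ij.1)) <=
    B%:R ^+ (2 * m) * (B ^ 2)%:R ^+ (2 * m * m.-1).
    by apply: prod_P_bad => h; apply: none; exists a.
  move=> h; have : W a <= (B%:R ^+ (2 * m) * (B ^ 2)%:R ^+ (2 * m * m.-1)) ^+ 2.
    by rewrite /W lerXn2r // nnegrE ?normc_ge0 // mulr_ge0 // exprn_ge0.
  move=> h2; apply: le_trans (ler_wpM2r _ h2) _; first by rewrite exprn_ge0 // ltW.
  rewrite FE natrX -!exprM -exprD -exprM -exprD le_eqVlt; apply/orP; left; apply/eqP.
  congr (_ ^+ _); move: m_gt0; case: (m) => // m' _ /=; nia.
have low : N%:R * F ^+ 2 <= 2 * Rk%:R ^+ m * \sum_(a < N) W a.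
  have sumW : \sum_(a < N) W a = \sum_(f : fld) \sum_(f' : fld)
      \sum_(a < N) complex.Re (ec (q%:R ^+ 2 * dotz (kvec f f') * a.+1%:R ^+ 2)).
    have eW a : W a = \sum_(f : fld) \sum_(f' : fld)
       complex.Re (ec (q%:R ^+ 2 * dotz (kvec f f') * a.+1%:R ^+ 2)).
      have := congr1 (@complex.Re R) (sqr_prod_P ((q * a.+1)%:R ^+ 2)); rewrite Re_realc => e.
      rewrite /W e Re_sum; apply: eq_bigr => f _; rewrite Re_sum; apply: eq_bigr => f' _.
      by congr (complex.Re (ec _)); rewrite natrM exprMn; ring.
    under eq_bigr do rewrite eW.
    rewrite exchange_big /=; apply: eq_bigr => f _; exact: exchange_big.
  have term f f' : N%:R * (kvec f f' == 0)%:R - N%:R / E%:R <=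
      \sum_(a < N) complex.Re (ec (q%:R ^+ 2 * dotz (kvec f f') * a.+1%:R ^+ 2)).
    have ER : 0 < E%:R :> R by rewrite ltr0n.
    have NE : 0 <= N%:R / E%:R :> R by rewrite divr_ge0.
    have [k0|k0] := eqVneq (kvec f f') 0.
      have -> : dotz (kvec f f') = 0 by rewrite k0 /dotz big1 // => i _; rewrite mxE mul0r.
      rewrite mulr1.
      under eq_bigr do rewrite mulr0 mul0r ec0.
      by rewrite sumr_const card_ord /= lerBlDr lerDl.
    rewrite mulr0 sub0r; have [Uk|nUk] := boolP (U (kvec f f')).
      apply: le_trans (_ : 0 <= _); first by rewrite oppr_le0.
      apply: sumr_ge0 => a _; rewrite mulrAC; apply: hU => //; exact: kvec_le.
    have := hnU _ (kvec_le f f') nUk; rewrite mulrC -ler_pdivlMr // => h.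
    rewrite lerNl -Re_sum; apply: le_trans h; apply: le_trans (Re_le_normc _).
    by rewrite -normrN ler_norm.
  have cd : F ^+ 2 <= Rk%:R ^+ m * \sum_(f : fld) \sum_(f' : fld) (kvec f f' == 0)%:R.
    rewrite /F -natrX -natrX; under eq_bigr do rewrite -natr_sum.
    by rewrite -natr_sum -natrM ler_nat; exact: card_diag.
  have : \sum_(f : fld) \sum_(f' : fld) (N%:R * (kvec f f' == 0)%:R - N%:R / E%:R) <= \sum_(a < N) W a.
    by rewrite sumW; apply: ler_sum => f _; apply: ler_sum => f' _; apply: term.
  have -> : \sum_(f : fld) \sum_(f' : fld) (N%:R * (kvec f f' == 0)%:R - N%:R / E%:R)
     = N%:R * (\sum_(f : fld) \sum_(f' : fld) (kvec f f' == 0)%:R) - N%:R / E%:R * F ^+ 2.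
    have sc (w : R) : \sum_(f : fld) \sum_(f' : fld) w = w * F ^+ 2.
      by rewrite !sumr_const -mulrnA -[LHS]mulr_natr natrM -expr2.
    under eq_bigr do rewrite sumrB -mulr_sumr.
    by rewrite sumrB -mulr_sumr sc.
  set D := \sum_(f : fld) _ in cd *; move=> h.
  have RkR : 0 < Rk%:R ^+ m :> R by rewrite exprn_gt0 // ltr0n.
  have ERk : E%:R = 2 * Rk%:R ^+ m :> R by rewrite /E natrM natrX.
  have h2 : 2 * Rk%:R ^+ m * (N%:R * D - N%:R / E%:R * F ^+ 2) <= 2 * Rk%:R ^+ m * \sum_(a < N) W a.
    by rewrite ler_pM2l // mulr_gt0.
  apply: le_trans h2; rewrite ERk.
  have -> : 2 * Rk%:R ^+ m * (N%:R * D - N%:R / (2 * Rk%:R ^+ m) * F ^+ 2)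
    = N%:R * (2 * (Rk%:R ^+ m * D) - F ^+ 2) by field; rewrite gt_eqF.
  rewrite ler_pM2l //; lra.
rewrite -mulr_suml in up.
(* If every a is bad, the kernel has mean at most F^2 / B^(4m), while the zero frequency forces at
   least F^2 / (2 Rk^m). As Rk = 2 m B^2 and 8m <= B, these are incompatible. *)
have : N%:R * F ^+ 2 * B%:R ^+ (4 * m) <= 2 * Rk%:R ^+ m * (N%:R * F ^+ 2).
  apply: le_trans (ler_wpM2r _ low) _; first by rewrite exprn_ge0 // ltW.
  by rewrite -[leLHS]mulrA ler_wpM2l // mulr_ge0 // exprn_ge0.
rewrite mulrC ler_pM2r ?mulr_gt0 ?exprn_gt0 // -!natrX -natrM ler_nat.
apply/negP; rewrite -ltnNge /Rk.
have aux x : (0 < x)%N -> (2 * (2 * x) ^ m < (8 * x) ^ m)%N.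
  move=> x0; rewrite !expnMn mulnA ltn_pmul2r ?expn_gt0 ?x0 //.
  by rewrite -expnS (_ : 8 = 2 ^ 3)%N // -expnM ltn_exp2l //; move: m_gt0; lia.
apply: (@leq_trans ((8 * (m * B ^ 2)) ^ m)); first by rewrite -mulnA; apply: aux; rewrite muln_gt0 m_gt0.
rewrite mulnA.
rewrite [(B ^ (4 * m))%N]expnM leq_exp2r //.
rewrite (_ : 4 = 2 + 2)%N // expnD leq_mul2r; apply/orP; right.
by apply: leq_trans B_ge _; rewrite -mulnn leq_pmull.
Qed.

Lemma dotzZ (c : int) k : dotz (c *: k) = c%:~R * dotz k.
Proof.
by rewrite /dotz mulr_sumr; apply: eq_bigr => i _; rewrite mxE intrM mulrA.
Qed.

Lemma dotz_mulmx s (c : 'rV[int]_s) (K : 'M[int]_(s, m)) :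
  dotz (c *m K) = \sum_j (c 0 j)%:~R * dotz (row j K).
Proof.
rewrite /dotz; under [RHS]eq_bigr do rewrite mulr_sumr.
rewrite exchange_big /=; apply: eq_bigr => i _; rewrite mxE rmorph_sum mulr_suml /=.
by apply: eq_bigr => j _; rewrite mxE intrM mulrA.
Qed.

Lemma fact_exp_le s : (s <= m)%N -> (s`! * Rk ^ s <= E1)%N.
Proof.
move=> sm; rewrite /E1 expnMn leq_mul // ?leq_pexp2l //.
apply: leq_trans (_ : m ^ s <= _)%N; last by rewrite leq_pexp2l.
elim: s sm => // s IH sm; rewrite factS expnS leq_mul // IH // ltnW //.
Qed.

Lemma len_succ s : (s <= m)%N -> len s = (g * len s.+1)%N.
Proof.
by move=> sm; rewrite /len subSn // subSS [(g ^ _.+1)%N]expnS mulnCA.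
Qed.

Lemma len_gt0 s : (0 < len s)%N.
Proof.
by rewrite /len muln_gt0 [(0 < g ^ _)%N]expn_gt0 g_gt0 andbT muln_gt0 [(0 < E ^ 2)%N]expn_gt0 E_gt0.
Qed.

(** Independent integer relations that hold almost exactly after multiplication by q^2. The
    precision leaves room for a denominator and coefficients up to E1, m rows, and all squares up to
    (len s)^2, ending within 1/4 of an integer. *)
Definition is_stage s (K : 'M[int]_(s, m)) (q : nat) : Prop :=
  [/\ (0 < q)%N, (q <= (32 * E ^ 2 * E1) ^ s)%N, forall i j, `|K i j| <= Rk%:Z,
      row_free (intmx_rat K) & forall j, nearz (q%:R ^+ 2 * dotz (row j K))
     (4 * m%:R * E1%:R ^+ 2 * (len s)%:R ^+ 2)^-1].

(** Apply the test with U the row space of K. Its frequencies have nonnegative real part: putting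
    the common denominator D into the multiplier makes them integer combinations of almost integral
    rows. If the test does not apply, some k outside the row space has a large Weyl sum, and [weyl]
    turns k into a new independent row. *)
Lemma schmidt_step s (K : 'M[int]_(s, m)) (q : nat) : (s <= m)%N -> is_stage K q ->
  (exists2 a : nat, (0 < a <= (32 * E ^ 2 * E1) ^ m * E1 * len 0)%N &
    forall i, nearz (a%:R ^+ 2 * al i) B%:R^-1) \/
  exists (K' : 'M[int]_(s + 1, m)) (q' : nat), is_stage K' q'.
Proof.
move=> sm [q0 qle hK fK near].
have [D [D0 Dle] hD] := row_space_denominator hK fK.
pose Dn := absz D; pose qt := (q * Dn)%N; pose N := len s.
have DnR : Dn%:R = (`|D|%:~R : R) by rewrite -abszE.
have DnE : Dn%:R ^+ 2 = (D%:~R : R) ^+ 2 by rewrite DnR intr_norm real_normK ?num_real.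
have Dn0 : (0 < Dn)%N by rewrite absz_gt0.
have Dn1 : (Dn <= E1)%N.
  by rewrite -lez_nat abszE; apply: le_trans Dle _; rewrite lez_nat fact_exp_le.
have N0 : (0 < N)%N by apply: len_gt0.
have NR : 0 < N%:R :> R by rewrite ltr0n.
have E1R : 0 < E1%:R :> R by rewrite ltr0n.
have mR : 0 < m%:R :> R by rewrite ltr0n.
set sg := (_^-1) in near.
have sg0 : 0 <= sg by rewrite invr_ge0 !mulr_ge0 ?exprn_ge0 // ltW.
have span (k : 'rV[int]_m) : (forall j, `|k 0 j| <= Rk%:Z) -> (intmx_rat k <= intmx_rat K)%MS ->
  forall a, (a < N)%N -> 0 <= complex.Re (ec (qt%:R ^+ 2 * a.+1%:R ^+ 2 * dotz k)).
  move=> hk /(hD _ hk)[c hc eDk] a aN.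
  have e : qt%:R ^+ 2 * a.+1%:R ^+ 2 * dotz k =
     (a.+1 ^ 2)%:R * (D%:~R * \sum_j (c 0 j)%:~R * (q%:R ^+ 2 * dotz (row j K))).
    have := congr1 dotz eDk; rewrite dotzZ dotz_mulmx => e1.
    have -> : \sum_j (c 0 j)%:~R * (q%:R ^+ 2 * dotz (row j K)) = q%:R ^+ 2 * (D%:~R * dotz k).
      by rewrite e1 mulr_sumr; apply: eq_bigr => j _; ring.
    by rewrite /qt natrM exprMn DnE natrX; ring.
  have : nearz (qt%:R ^+ 2 * a.+1%:R ^+ 2 * dotz k) (4^-1).
    rewrite e; apply: (@nearzW _ _ ((a.+1 ^ 2)%:R * (`|D|%:~R * \sum_(j < s) (E1%:R * sg)))).
      rewrite sumr_const card_ord -[_ *+ s]mulr_natl -DnR.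
      have h1 : (a.+1 ^ 2)%:R <= N%:R ^+ 2 :> R by rewrite natrX lerXn2r // ?nnegrE // ler_nat.
      have h2 : Dn%:R <= E1%:R :> R by rewrite ler_nat.
      have h3 : s%:R <= m%:R :> R by rewrite ler_nat.
      apply: le_trans (_ : N%:R ^+ 2 * (E1%:R * (m%:R * (E1%:R * sg))) <= _).
        apply: ler_pM; rewrite ?ler0n //; first by rewrite !mulr_ge0 ?ler0n.
        apply: ler_pM; rewrite ?ler0n //; first by rewrite !mulr_ge0 ?ler0n.
        by apply: ler_wpM2r => //; rewrite mulr_ge0 ?ler0n.
      by rewrite /sg le_eqVlt; apply/orP; left; apply/eqP; field; rewrite !gt_eqF.
    apply: nearz_muln; apply: nearz_mulz; apply: nearz_sum => j _.
    apply: nearzW (nearz_mulz (c 0 j) (near j)); rewrite ler_wpM2r // -[E1%:R]/(E1%:Z%:~R) ler_int.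
    by apply: le_trans (hc j) _; rewrite lez_nat fact_exp_le.
  by move=> [z hz]; apply: Re_ec_ge0 hz.
have qtle : (qt <= (32 * E ^ 2 * E1) ^ s * E1)%N by apply: leq_mul.
have qt0 : (0 < qt)%N by rewrite muln_gt0 q0.
have [[k [hk nk big]]|none] := pselect (exists k : 'rV[int]_m,
   [/\ forall j, `|k 0 j| <= Rk%:Z, ~~ (intmx_rat k <= intmx_rat K)%MS &
     N%:R <= E%:R * normc (\sum_(a < N) ec (qt%:R ^+ 2 * dotz k * a.+1%:R ^+ 2))]); last first.
  left; have [|a aN ha] := @schmidt_test qt N (fun k => (intmx_rat k <= intmx_rat K)%MS) N0 span.
    by move=> k hk nk; rewrite leNgt; apply/negP => /ltW lt; apply: none; exists k.
  exists (qt * a.+1)%N; last exact: ha.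
  rewrite muln_gt0 qt0 /=; apply: leq_mul.
    apply: leq_trans qtle _; apply: leq_mul => //; apply: leq_pexp2l => //.
    by rewrite muln_gt0 E1_gt0 andbT muln_gt0 [(0 < E ^ 2)%N]expn_gt0 E_gt0.
  by apply: leq_trans aN _; rewrite /N /len; apply: leq_mul => //; apply: leq_pexp2l => //; apply: leq_sub2l.
right.
have fK' := row_free_col_mx fK nk.
have gH : (2 ^ 12 * E ^ 6 <= g ^ (m.+1 - s))%N.
  apply: leq_trans (_ : g <= _)%N.
    rewrite /g (_ : 2 ^ 13 = 2 * 2 ^ 12)%N //.
    have : (0 < m * E1)%N by rewrite muln_gt0 m_gt0.
    move: (E ^ 6)%N (2 ^ 12)%N (m * E1)%N E1 => x y z w; nia.
  by rewrite -{1}[g]expn1 leq_pexp2l // subn_gt0.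
have [q' /andP[q'0 q'le] hq'] := weyl E_gt0 gH big.
exists (col_mx K k), (q' * qt)%N; split.
- by rewrite muln_gt0 q'0.
- rewrite addn1 expnS; apply: leq_trans (leq_mul q'le qtle) _.
  by rewrite [(_ ^ s * E1)%N]mulnC mulnA.
- by move=> i j; rewrite mxE; case: splitP => i' _ //; rewrite ord1.
- by rewrite /intmx_rat map_col_mx.
have lenE : (len s)%:R = g%:R * (len (s + 1))%:R :> R by rewrite len_succ // natrM addn1.
have l1 : 0 < (len (s + 1))%:R :> R by rewrite ltr0n len_gt0.
have gR : 0 < g%:R :> R by rewrite ltr0n.
have gE : g%:R = 2 ^+ 13 * m%:R * E1%:R * E%:R ^+ 6 :> R.
  by rewrite /g natrM natrM natrM !natrX.
have ER : 1 <= E%:R :> R by rewrite ler1n.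
have mR1 : 1 <= m%:R :> R by rewrite ler1n.
have E1R1 : 1 <= E1%:R :> R by rewrite ler1n.
have q'R : q'%:R <= 32 * E%:R ^+ 2 :> R by rewrite -natrX -natrM ler_nat.
have g1 : 32 * E%:R ^+ 2 * E1%:R <= g%:R :> R.
  rewrite gE; apply: le_trans (_ : 2 ^+ 13 * 1 * E1%:R * E%:R ^+ 6 <= _).
    rewrite mulr1 [leRHS]mulrAC ler_wpM2r ?(ltW E1R) //.
    apply: ler_pM; rewrite ?exprn_ge0 //; first by rewrite -natrX ler_nat.
    exact: ler_weXn2l.
  rewrite mulr1; apply: ler_wpM2r; first by rewrite exprn_ge0 // ler0n.
  by apply: ler_wpM2r; [exact: ltW | rewrite ler_peMr // exprn_ge0].
(* An old row loses (q' Dn)^2 <= (32 E^2 E1)^2 <= g^2, paid for by the shorter range. The new row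
   has the precision of [weyl], worsened by one further factor q'. *)
move=> j; case: (splitP j) => [i ji|i ji].
  have -> : row j (col_mx K k) = row i K.
    apply/rowP => l; rewrite !mxE; case: splitP => i' ji'.
      by congr (K _ _); apply: ord_inj; rewrite -ji' -ji.
    by have := ltn_ord i; rewrite -ji ji' ltnNge leq_addr.
  have -> : (q' * qt)%:R ^+ 2 * dotz (row i K) = ((q' * Dn) ^ 2)%:R * (q%:R ^+ 2 * dotz (row i K)).
    by rewrite /qt natrX !natrM; ring.
  apply: nearzW (nearz_muln _ (near i)).
  rewrite /sg -/N lenE natrX ler_pdivrMr ?mulr_gt0 ?exprn_gt0 ?mulr_gt0 //.
  rewrite mulrC -ler_pdivrMr ?invr_gt0 ?mulr_gt0 ?exprn_gt0 // invrK.
  have -> : 4 * m%:R * E1%:R ^+ 2 * (g%:R * (len (s + 1))%:R) ^+ 2 =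
    g%:R ^+ 2 * (4 * m%:R * E1%:R ^+ 2 * (len (s + 1))%:R ^+ 2) :> R by ring.
  rewrite ler_pM2r ?mulr_gt0 ?exprn_gt0 // lerXn2r ?nnegrE ?ler0n //.
  rewrite natrM; apply: le_trans g1; apply: ler_pM; rewrite ?ler0n //.
  by rewrite ler_nat.
have -> : row j (col_mx K k) = k.
  apply/rowP => l; rewrite !mxE; case: splitP => i' ji'.
    by have := ltn_ord i'; rewrite -ji' ji ltnNge leq_addr.
  by rewrite [i']ord1.
have -> : (q' * qt)%:R ^+ 2 * dotz k = q'%:R * (q'%:R * (qt%:R ^+ 2 * dotz k)).
  by rewrite natrM; ring.
apply: nearzW (nearz_muln _ hq').
rewrite -/(len s) lenE.
have -> : q'%:R * (2 ^+ 18 * E%:R ^+ 8 / (g%:R * (len (s + 1))%:R) ^+ 2) =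
   q'%:R * (2 ^+ 18 * E%:R ^+ 8) / g%:R ^+ 2 / (len (s + 1))%:R ^+ 2 :> R.
  by field; rewrite !gt_eqF.
rewrite [X in _ <= X]invfM ler_wpM2r ?invr_ge0 ?exprn_ge0 //.
rewrite ler_pdivrMr ?exprn_gt0 // ler_pdivlMl ?mulr_gt0 ?exprn_gt0 //.
apply: le_trans (_ : 4 * m%:R * E1%:R ^+ 2 * (32 * E%:R ^+ 2 * (2 ^+ 18 * E%:R ^+ 8)) <= _).
  apply: ler_wpM2l; first by rewrite !mulr_ge0 ?exprn_ge0.
  by apply: ler_wpM2r => //; rewrite mulr_ge0 ?exprn_ge0.
rewrite gE.
have -> : (2 ^+ 13 * m%:R * E1%:R * E%:R ^+ 6) ^+ 2 =
   4 * m%:R * E1%:R ^+ 2 * (32 * E%:R ^+ 2 * (2 ^+ 18 * E%:R ^+ 8)) * (2 * m%:R * E%:R ^+ 2) :> R by ring.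
apply: ler_peMr; first by rewrite !mulr_ge0 ?exprn_ge0.
have : 1 <= E%:R ^+ 2 :> R by rewrite exprn_ege1.
by move=> h; nra.
Qed.

(** Dimension m has no m + 1 independent rows, so the first alternative of the step occurs at s = m
    at the latest. *)
Lemma schmidt_stage d s (K : 'M[int]_(s, m)) (q : nat) : (s + d = m)%N -> is_stage K q ->
  exists2 a : nat, (0 < a <= (32 * E ^ 2 * E1) ^ m * E1 * len 0)%N &
    forall i, nearz (a%:R ^+ 2 * al i) B%:R^-1.
Proof.
elim: d s K q => [|d IH] s K q sd Kq; have sm : (s <= m)%N by rewrite -sd leq_addr.
  have [//|[K' [q' [_ _ _ /eqnP fK' _]]]] := schmidt_step sm Kq.
  have := rank_leq_col (intmx_rat K'); by rewrite fK' -{1}sd addn0 addn1 ltnn.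
have [//|[K' [q' Kq']]] := schmidt_step sm Kq.
by apply: (IH (s + 1)%N K' q' _ Kq'); rewrite -sd addn1 addSn addnS.
Qed.

(** Each quantity is bounded by a power of B; the exponents add up to 32 m^2 + 48 m + 16, at most
    100 m^2. *)
Lemma schmidt : exists2 a : nat, (0 < a <= B ^ (100 * m ^ 2))%N &
  forall i, nearz (a%:R ^+ 2 * al i) B%:R^-1.
Proof.
have st0 : is_stage (0 : 'M[int]_(0, m)) 1%N.
  split=> //; [by case | by rewrite /row_free flatmx0 mxrank0 | by case].
have [a /andP[a0 ale] ha] := schmidt_stage (add0n m) st0.
exists a => //; rewrite a0 /=; apply: leq_trans ale _.
have B8 : (8 <= B)%N by move: B_ge m_gt0; lia.
have B1 : (0 < B)%N by [].
have ex2 x y e : (x <= y -> x ^ e <= y ^ e)%N by move=> xy; case: e => // e; rewrite leq_exp2r.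
have mB : (2 * m <= B)%N by move: B_ge; lia.
have bRk : (Rk <= B ^ 3)%N by rewrite /Rk [(B ^ 3)%N]expnS leq_mul2r mB orbT.
have bE : (E <= B ^ (3 * m).+1)%N.
  rewrite /E expnS expnM; apply: leq_mul; first by apply: leq_trans B8.
  exact: ex2.
have bE1 : (E1 <= B ^ (4 * m))%N.
  rewrite /E1 expnM; apply: ex2; rewrite [(B ^ 4)%N]expnS leq_mul //.
  by move: mB; lia.
have b32 : (64 <= B ^ 2)%N by rewrite (_ : 64 = 8 ^ 2)%N //; apply: ex2.
have bg : (g <= B ^ (22 * m + 12))%N.
  have -> : (B ^ (22 * m + 12) = B ^ 5 * B ^ 1 * B ^ (4 * m) * (B ^ (3 * m).+1) ^ 6)%N.
    by rewrite -expnM -!expnD; congr (_ ^ _)%N; lia.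
  rewrite /g; apply: leq_mul; last exact: ex2.
  apply: leq_mul => //; apply: leq_mul; last by rewrite expn1; move: mB; lia.
  apply: leq_trans (_ : 8 ^ 5 <= _)%N; last exact: ex2.
  by rewrite (_ : 8 = 2 ^ 3)%N // -expnM leq_exp2l.
have bE2 : (E ^ 2 <= B ^ ((3 * m).+1 * 2))%N by rewrite expnM; apply: ex2.
apply: leq_trans (_ : (B ^ 2 * B ^ ((3 * m).+1 * 2) * B ^ (4 * m)) ^ m * B ^ (4 * m) *
   (B ^ 2 * B ^ ((3 * m).+1 * 2) * (B ^ (22 * m + 12)) ^ m.+1) <= _)%N.
  apply: leq_mul; [apply: leq_mul => //; apply: ex2; apply: leq_mul => //; apply: leq_mul => // |].
    by apply: leq_trans b32.
  by rewrite /len; apply: leq_mul; [apply: leq_mul | rewrite subn0; apply: ex2].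
rewrite -!expnD -!expnM -!expnD leq_pexp2l //.
by rewrite -mulnn; nia.
Qed.

End Schmidt.

(** * Local Fourier analysis on cells *)

Section ZpCharacter.
Variables (R : realType) (p : nat).

Definition zchi (x : 'I_p.+2) : R[i] := ec ((x : nat)%:R / p.+2%:R).

Lemma zchi_nat (k : nat) : zchi k%:R = ec (k%:R / p.+2%:R).
Proof.
rewrite /zchi Zp_nat /=; apply: (@ec_near _ _ _ (- (k %/ p.+2)%:Z)).
have n0 : (p.+2%:R : R) != 0 by rewrite pnatr_eq0.
rewrite {2}(divn_eq k p.+2) natrD natrM mulrNz -pmulrn.
by move: (p.+2%:R : R) n0 => w w0; field.
Qed.

Lemma zchiD : {morph zchi : x y / x + y >-> x * y}.
Proof.
by move=> x y; rewrite -[x]natr_Zp -[y]natr_Zp -natrD !zchi_nat natrD mulrDl ecD.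
Qed.

Lemma zchi_mul (x y : 'I_p.+2) : zchi (x * y) = ec (x%:R / p.+2%:R * y%:R).
Proof.
have -> : x * y = (x * y)%N%:R :> 'I_p.+2 by rewrite natrM !natr_Zp.
by rewrite zchi_nat natrM mulrAC.
Qed.

Lemma zchi_is_char : is_char zchi.
Proof.
split=> [|x|x x0]; [exact: zchiD | exact: normc_ec|].
have z1 : zchi x != 1.
  apply/eqP => e1; have [|z] := @nearz_normc_ec1 R ((x : nat)%:R / p.+2%:R) 0.
    by rewrite -/(zchi x) e1 subrr normc_realE normr0.
  rewrite mul0r normr_le0 subr_eq0 => /eqP ez.
  have xp : (0 < x)%N by rewrite lt0n; apply: contraNneq x0 => h; apply/eqP/val_inj.
  have : 0 < (z%:~R : R) by rewrite -ez divr_gt0 // ltr0n.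
  have : (z%:~R : R) < 1 by rewrite -ez ltr_pdivrMr ?ltr0n // mul1r ltr_nat.
  by rewrite ltr0z ltrz1; lia.
set S := \sum_y _.
have e : zchi x * S = S.
  rewrite /S mulr_sumr [RHS](reindex_inj (addrI 1)) /=; apply: eq_bigr => y _.
  by rewrite mulrDr mulr1 zchiD.
have /eqP : (zchi x - 1) * S = 0 by rewrite mulrBl e mul1r subrr.
by rewrite mulf_eq0 subr_eq0 (negPf z1) => /eqP.
Qed.

End ZpCharacter.

Section Correlation.
Variables (R : realType).

(** The Fourier transform of the correlation is a product, so Plancherel pulls out the supremum of
    the transform of a. *)
Lemma corr_bound (G : finComNzRingType) (chi : G -> R[i]) (a b : G -> R[i]) (s : R) :
  is_char chi -> (forall k, normc (\sum_j a j * chi (k * j)) <= s) ->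
  \sum_l normc (\sum_j a j * b (j + l)) ^+ 2 <= s ^+ 2 * \sum_x normc (b x) ^+ 2.
Proof.
move=> chiP hs.
have n0 : 0 < #|G|%:R :> R by rewrite ltr0n; apply/card_gt0P; exists 0.
rewrite -(ler_pM2l n0) mulrCA -!(char_plancherel chiP) mulr_sumr; apply: ler_sum => k _.
have -> : \sum_l (\sum_j a j * b (j + l)) * chi (k * l) =
    (\sum_j a j * chi (- k * j)) * (\sum_i b i * chi (k * i)).
  rewrite big_distrlr /=; under eq_bigr do rewrite mulr_suml.
  rewrite exchange_big /=; apply: eq_bigr => j _; rewrite [RHS](reindex_inj (addrI j)) /=.
  apply: eq_bigr => l _; rewrite mulrDr (charD chiP).
  have e : chi (- k * j) * chi (k * j) = 1 by rewrite -(charD chiP) mulNr addNr (char0 chiP).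
  rewrite -[LHS]mulr1 -e; ring.
rewrite ComplexField.Normc.normcM exprMn ler_wpM2r ?sqr_ge0 // lerXn2r // nnegrE ?normc_ge0 //.
exact: le_trans (normc_ge0 _) (hs k).
Qed.

Lemma sum_ord_if (V : nmodType) (m L : nat) (F : nat -> V) : (L <= m)%N ->
  \sum_(x < m) (if (x < L)%N then F x else 0) = \sum_(j < L) F j.
Proof. by move=> Lm; rewrite (big_ord_widen _ _ Lm) [RHS]big_mkcond. Qed.

(** The sequences are placed in Z/2L, where j + l does not wrap around for j, l < L. *)
Lemma corr_bound_nat (L : nat) (a b : nat -> R[i]) (s : R) : (0 < L)%N ->
  (forall th : R, normc (\sum_(j < L) a j * ec (th * j%:R)) <= s) ->
  \sum_(l < L) normc (\sum_(j < L) a j * b (j + l)%N) ^+ 2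
    <= s ^+ 2 * \sum_(i < 2 * L) normc (b i) ^+ 2.
Proof.
move=> L0 hs.
have [p pE] : exists p, (2 * L = p.+2)%N by exists (2 * L - 2)%N; lia.
have Lp : (L <= p.+2)%N by rewrite -pE; lia.
pose a' (x : 'I_p.+2) : R[i] := if (x < L)%N then a x else 0.
pose b' (x : 'I_p.+2) : R[i] := b x.
have := @corr_bound _ (@zchi R p) a' b' s (@zchi_is_char R p).
rewrite pE => h; apply: le_trans (h _); last first.
  move=> k; have -> : \sum_j a' j * zchi R (k * j) = \sum_(j < L) a j * ec (k%:R / p.+2%:R * j%:R).
    rewrite -(sum_ord_if (fun j => a j * ec (k%:R / p.+2%:R * j%:R)) Lp).
    by apply: eq_bigr => x _; rewrite /a' zchi_mul; case: ifP => // _; rewrite mul0r.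
  exact: hs.
rewrite -(sum_ord_if (fun l => normc (\sum_(j < L) a j * b (j + l)%N) ^+ 2) Lp).
apply: ler_sum => l _; case: ifP => [lL|_]; last exact: sqr_ge0.
rewrite (_ : \sum_(j < L) _ = \sum_j a' j * b' (j + l)) //.
rewrite -(sum_ord_if (fun j => a j * b (j + l)%N) Lp); apply: eq_bigr => j _.
rewrite /a' /b'; case: ifP => [jL|_]; last by rewrite mul0r.
have jl : (j + l < 2 * L)%N by move: jL lL; lia.
by move: jl; rewrite pE => jl; rewrite /= modn_small.
Qed.

End Correlation.

(** * Averaging along progressions without changing the Fourier sums *)

Section Smoothing.
Variables (R : realType) (T K L : nat) (a : nat -> R).
Hypotheses (T_gt0 : (0 < T)%N) (K_gt0 : (0 < K)%N).
Hypothesis L_ge : (6 * K * T * (24 * K * T) ^ (1536 * K ^ 3) <= L)%N.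
Hypothesis a01 : forall j, 0 <= a j <= 1.

(** Average of a over the T-term progression of step d ending at j. Where the progression would
    start before 0 the value is 0, so that a density bound for progressions bounds all values. *)
Definition smoothed (d j : nat) : R :=
  if (j < d * T.-1)%N then 0 else T%:R^-1 * \sum_(t < T) a (j - d * t)%N.

Let ah (th : R) : R[i] := \sum_(j < L) (a j)%:C * ec (th * j%:R).

Let a_le j : normc (a j)%:C <= 1.
Proof. by rewrite normc_realE; have := a01 j; rewrite ler_norml; lra. Qed.

Let term_le (th : R) (j : nat) : normc ((a j)%:C * ec (th * j%:R)) <= 1.
Proof. by rewrite ComplexField.Normc.normcM normc_ec mulr1. Qed.

Lemma normc_sum_nat (F : nat -> R[i]) x y : (x <= y)%N -> (forall i, normc (F i) <= 1) ->
  normc (\sum_(x <= i < y) F i) <= (y - x)%:R.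
Proof.
move=> xy hF; apply: le_trans (normc_sum _ _ _) _.
apply: le_trans (_ : \sum_(x <= i < y) 1 <= _); first by apply: ler_sum.
by rewrite sumr_const_nat.
Qed.

Let ah_le th : normc (ah th) <= L%:R.
Proof.
apply: le_trans (normc_sum _ _ _) _; rewrite -[L in L%:R]card_ord -sumr_const.
by apply: ler_sum => j _; apply: term_le.
Qed.

Let ah_lip th th' : normc (ah th - ah th') <= 8 * L%:R ^+ 2 * `|th - th'|.
Proof.
rewrite /ah -sumrB; apply: le_trans (normc_sum _ _ _) _.
have -> : 8 * L%:R ^+ 2 * `|th - th'| = \sum_(j < L) 8 * L%:R * `|th - th'|.
  by rewrite sumr_const card_ord -mulr_natl; ring.
apply: ler_sum => j _.
have -> : (a j)%:C * ec (th * j%:R) - (a j)%:C * ec (th' * j%:R) =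
    (a j)%:C * ec (th' * j%:R) * (ec ((th - th') * j%:R) - 1).
  have -> : th * j%:R = th' * j%:R + (th - th') * j%:R by ring.
  by rewrite ecD; ring.
rewrite ComplexField.Normc.normcM.
apply: le_trans (_ : 1 * (8 * `|(th - th') * j%:R|) <= _).
  by apply: ler_pM; rewrite ?normc_ge0 // normc_ec1_le.
rewrite mul1r normrM normr_nat -mulrA ler_wpM2l // mulrC ler_wpM2r // ler_nat.
exact: ltnW.
Qed.

Let ah_addz th (z : int) : ah (th - z%:~R) = ah th.
Proof.
apply: eq_bigr => j _; congr (_ * _); apply: (@ec_near _ _ _ (- (z * j%:Z))).
by rewrite mulrNz intrM -pmulrn; ring.
Qed.

(** Plancherel on the grid allows at most 96 K L * L * (4K / L)^2 = 1536 K^3 large values. *)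
Lemma card_large_freq p : (96 * K * L = p.+2)%N ->
  (#|[set r : 'I_p.+2 | (L%:R / (4 * K%:R) <= normc (ah ((r : nat)%:R / p.+2%:R)))%R]| <= 1536 * K ^ 3)%N.
Proof.
move=> pE; set Lam := [set r | _].
have L0 : (0 < L)%N.
  by apply: leq_trans L_ge; rewrite muln_gt0 [(0 < (24 * K * T) ^ _)%N]expn_gt0 !muln_gt0 K_gt0 T_gt0.
have LR : 0 < L%:R :> R by rewrite ltr0n.
have KR : 0 < K%:R :> R by rewrite ltr0n.
have Lp : (L <= p.+2)%N by rewrite -pE leq_pmull // muln_gt0.
pose a' (x : 'I_p.+2) : R[i] := if (x < L)%N then (a x)%:C else 0.
have := char_plancherel (@zchi_is_char R p) a'.
have eh (k : 'I_p.+2) : \sum_x a' x * zchi R (k * x) = ah ((k : nat)%:R / p.+2%:R).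
  rewrite /ah -(sum_ord_if (fun j => (a j)%:C * ec ((k : nat)%:R / p.+2%:R * j%:R)) Lp).
  by apply: eq_bigr => x _; rewrite /a' zchi_mul; case: ifP => // _; rewrite mul0r.
under eq_bigr do rewrite eh.
move=> pl.
have up : \sum_x normc (a' x) ^+ 2 <= L%:R.
  have -> : \sum_x normc (a' x) ^+ 2 = \sum_(j < L) normc (a j)%:C ^+ 2.
    rewrite -(sum_ord_if (fun j => normc (a j)%:C ^+ 2) Lp); apply: eq_bigr => x _.
    by rewrite /a'; case: ifP => // _; rewrite normc_realE normr0 expr0n.
  rewrite -[L in L%:R]card_ord -sumr_const; apply: ler_sum => j _.
  by rewrite exprn_ile1 ?normc_ge0 ?a_le.
have low : #|Lam|%:R * (L%:R / (4 * K%:R)) ^+ 2 <= p.+2%:R * L%:R :> R.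
  apply: le_trans (_ : p.+2%:R * \sum_x normc (a' x) ^+ 2 <= _); last by rewrite ler_wpM2l.
  move: pl; rewrite card_ord => <-; rewrite (bigID (mem Lam)) /=.
  rewrite -[X in X <= _]addr0; apply: lerD; last by apply: sumr_ge0 => i _; apply: sqr_ge0.
  rewrite mulr_natl -sumr_const; apply: ler_sum => r; rewrite inE => hr.
  by rewrite lerXn2r // nnegrE ?normc_ge0 // divr_ge0 ?mulr_ge0.
rewrite -(ler_nat R) natrM natrX.
have e : p.+2%:R * L%:R = 1536 * K%:R ^+ 3 * (L%:R / (4 * K%:R)) ^+ 2 :> R.
  by rewrite -pE natrM natrM; field; rewrite gt_eqF.
by move: low; rewrite e ler_pM2r // exprn_gt0 // divr_gt0 // mulr_gt0.
Qed.

Lemma smoothed_fourier d t (th : R) : (t < T)%N -> (d * T.-1 <= L)%N ->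
  normc (ec (th * (d * t)%:R) * ah th - \sum_(d * T.-1 <= j < L) (a (j - d * t)%N)%:C * ec (th * j%:R))
    <= (d * T.-1)%:R.
Proof.
move=> tT DL; set s := (d * t)%N; set D := (d * T.-1)%N.
have sD : (s <= D)%N by rewrite leq_mul2l; apply/orP; right; move: tT T_gt0; lia.
have -> : \sum_(D <= j < L) (a (j - s)%N)%:C * ec (th * j%:R) =
    ec (th * s%:R) * \sum_(D - s <= i < L - s) (a i)%:C * ec (th * i%:R).
  rewrite -{1}(subnK sD) big_addn mulr_sumr; apply: eq_bigr => i _.
  by rewrite addnK natrD mulrDr ecD; ring.
rewrite -mulrBr ComplexField.Normc.normcM normc_ec mul1r.
have -> : ah th = \sum_(0 <= i < L) (a i)%:C * ec (th * i%:R) by rewrite big_mkord.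
have h1 : (D - s <= L - s)%N by apply: leq_sub2r.
rewrite (big_cat_nat (leq0n _) (leq_trans h1 (leq_subr _ _))) /= (big_cat_nat h1 (leq_subr _ _)) /=.
rewrite addrCA addrAC subrr add0r.
apply: le_trans (normcD _ _) _.
apply: le_trans (lerD (normc_sum_nat (leq0n _) (term_le th)) (normc_sum_nat (leq_subr s L) (term_le th))) _.
by rewrite -natrD ler_nat; move: DL sD; rewrite -/D; lia.
Qed.

(** Averaging over shifts multiplies the Fourier sum at th by the mean of e(th d t), up to boundary
    terms. Dirichlet's theorem brings this mean close to 1 at the large frequencies of the grid, and
    elsewhere the sum may be lost entirely. With mesh 1 / (96 K L) and Lipschitz constant 8 L^2,
    passing to the grid costs L / (12K), the gap between the thresholds L / (3K) and L / (4K). *)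
Lemma smoothing : exists2 d : nat, (0 < d)%N & forall th : R,
  normc (\sum_(j < L) (a j - smoothed d j)%:C * ec (th * j%:R)) <= L%:R / K%:R.
Proof.
have L0 : (0 < L)%N.
  by apply: leq_trans L_ge; rewrite muln_gt0 [(0 < (24 * K * T) ^ _)%N]expn_gt0 !muln_gt0 K_gt0 T_gt0.
have LR : 0 < L%:R :> R by rewrite ltr0n.
have KR : 0 < K%:R :> R by rewrite ltr0n.
have TR : 0 < T%:R :> R by rewrite ltr0n.
have K1 : 1 <= K%:R :> R by rewrite ler1n.
have [p pE] : exists p, (96 * K * L = p.+2)%N.
  by exists (96 * K * L - 2)%N; move: (leq_mul K_gt0 L0); lia.
have := card_large_freq pE; set Lam := [set r | _] => cL.
have B0 : (0 < 24 * K * T)%N by rewrite !muln_gt0 K_gt0.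
have [d /andP[d0 dle] hd] :=
  dirichlet (fun i : 'I_#|Lam| => ((enum_val i : 'I_p.+2) : nat)%:R / p.+2%:R : R) B0.
have dL : (6 * K * T * d <= L)%N.
  apply: leq_trans L_ge; rewrite leq_mul2l; apply/orP; right; apply: leq_trans dle _.
  exact: leq_pexp2l.
exists d => // th.
have DT : (d * T.-1 <= d * T)%N by rewrite leq_mul2l leq_pred orbT.
have DL : (d * T.-1 <= L)%N.
  apply: leq_trans DT _; apply: leq_trans dL; rewrite mulnC -mulnA.
  by rewrite leq_pmull // muln_gt0 K_gt0.
have dLR : 6 * K%:R * T%:R * d%:R <= L%:R :> R by rewrite -!natrM ler_nat.
have DR : (d * T.-1)%:R <= L%:R / K%:R / 6 :> R.
  apply: le_trans (_ : d%:R * T%:R <= _); first by rewrite -natrM ler_nat.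
  by rewrite -mulrA -invfM ler_pdivlMr ?mulr_gt0 //; lra.
pose inner t := \sum_(d * T.-1 <= j < L) (a (j - d * t)%N)%:C * ec (th * j%:R).
have eS : \sum_(j < L) (a j - smoothed d j)%:C * ec (th * j%:R) =
   (T%:R^-1)%:C * \sum_(t < T) (ah th - inner t).
  have e1 : \sum_(j < L) (a j - smoothed d j)%:C * ec (th * j%:R) =
     ah th - \sum_(j < L) (smoothed d j)%:C * ec (th * j%:R).
    by rewrite /ah -sumrB; apply: eq_bigr => j _; rewrite rmorphB /= mulrBl.
  have e2 : \sum_(j < L) (smoothed d j)%:C * ec (th * j%:R) =
     (T%:R^-1)%:C * \sum_(t < T) inner t.
    rewrite -(big_mkord predT (fun j => (smoothed d j)%:C * ec (th * j%:R))).
    rewrite (big_cat_nat (leq0n _) DL) /= big_nat_cond big1 ?add0r; last first.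
      by move=> j /andP[/andP[_ jD] _]; rewrite /smoothed jD mul0r.
    rewrite /inner exchange_big /= mulr_sumr; apply: eq_big_nat => j /andP[Dj _].
    rewrite /smoothed ltnNge Dj /= rmorphM /= rmorph_sum /= -mulrA; congr (_ * _).
    by rewrite mulr_suml.
  rewrite e1 e2 sumrB mulrBr; congr (_ - _).
  rewrite sumr_const card_ord -[ah th *+ T]mulr_natl mulrA -(rmorph_nat (real_complex R)) -rmorphM /=.
  by rewrite mulVf ?gt_eqF // mul1r.
rewrite eS ComplexField.Normc.normcM normc_realE ger0_norm ?invr_ge0 ?ler0n //.
rewrite mulrC ler_pdivrMr //.
(* The boundary terms take at most 1/6 of L / K, so an allowance of 2/3 for the phases is
   affordable. *)
suff hphase : forall t : 'I_T, normc ((1 - ec (th * (d * t)%:R)) * ah th) <= L%:R / K%:R * (2 / 3).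
  apply: le_trans (normc_sum _ _ _) _.
  apply: le_trans (_ : \sum_(t < T) L%:R / K%:R <= _); last by rewrite sumr_const card_ord mulr_natr.
  apply: ler_sum => t _.
  have -> : ah th - inner t = (1 - ec (th * (d * t)%:R)) * ah th + (ec (th * (d * t)%:R) * ah th - inner t).
    by ring.
  apply: le_trans (normcD _ _) _.
  have h1 := smoothed_fourier th (ltn_ord t) DL.
  have h2 := hphase t.
  apply: le_trans (lerD h2 (le_trans h1 DR)) _.
  have : 0 <= L%:R / K%:R :> R by rewrite divr_ge0.
  lra.
move=> t; rewrite ComplexField.Normc.normcM.
have [small|big] := ltP (normc (ah th)) (L%:R / (3 * K%:R)).
  apply: le_trans (_ : 2 * (L%:R / (3 * K%:R)) <= _); last first.
    by rewrite le_eqVlt; apply/orP; left; apply/eqP; field; rewrite gt_eqF.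
  apply: ler_pM; rewrite ?normc_ge0 //; last exact: ltW.
  apply: le_trans (normcB _ _) _; rewrite normc_ec normc_realE normr1; lra.
pose x := th - (Num.floor th)%:~R.
have x0 : 0 <= x by rewrite subr_ge0 floor_le.
have x1 : x < 1 by rewrite ltrBlDl; have := mem_rg1_floor th => /andP[].
have mR : 0 < p.+2%:R :> R by rewrite ltr0n.
have mx0 : 0 <= p.+2%:R * x by rewrite mulr_ge0 // ltW.
have rlt : (Num.truncn (p.+2%:R * x) < p.+2)%N.
  by rewrite truncn_lt_nat // -[W in _ < W]mulr1 ltr_pM2l.
pose r : 'I_p.+2 := Ordinal rlt.
have rx : `|x - (r : nat)%:R / p.+2%:R| <= p.+2%:R^-1.
  have /andP[h1 h2] := truncn_itv mx0.
  rewrite -(ler_pM2l mR) divff ?gt_eqF // -[p.+2%:R as W in W * _]ger0_norm ?ler0n // -normrM.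
  have -> : p.+2%:R * (x - (r : nat)%:R / p.+2%:R) = p.+2%:R * x - (r : nat)%:R.
    by rewrite mulrBr [p.+2%:R * (_ / _)]mulrC divfK ?gt_eqF.
  have h3 : p.+2%:R * x < (r : nat)%:R + 1 by rewrite natr1.
  have h4 : (r : nat)%:R <= p.+2%:R * x by [].
  by rewrite ler_norml; apply/andP; split; move: h3 h4; lra.
have mE : p.+2%:R = 96 * K%:R * L%:R :> R by rewrite -pE natrM natrM.
have rLam : r \in Lam.
  rewrite inE.
  have h1 : normc (ah th - ah ((r : nat)%:R / p.+2%:R)) <= L%:R / (12 * K%:R).
    rewrite -(ah_addz th (Num.floor th)) -/x; apply: le_trans (ah_lip _ _) _.
    apply: le_trans (_ : 8 * L%:R ^+ 2 * p.+2%:R^-1 <= _).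
      by rewrite ler_wpM2l // mulr_ge0 // exprn_ge0.
    by rewrite mE le_eqVlt; apply/orP; left; apply/eqP; field; rewrite !gt_eqF.
  have h2 : normc (ah th) <= normc (ah ((r : nat)%:R / p.+2%:R)) + L%:R / (12 * K%:R).
    have -> : ah th = ah ((r : nat)%:R / p.+2%:R) + (ah th - ah ((r : nat)%:R / p.+2%:R)) by ring.
    by apply: le_trans (normcD _ _) _; rewrite lerD2l.
  have e3 : L%:R / (3 * K%:R) = L%:R / (4 * K%:R) + L%:R / (12 * K%:R) :> R.
    by field; rewrite gt_eqF.
  by rewrite -(lerD2r (L%:R / (12 * K%:R))) -e3; apply: le_trans big h2.
have nr : nearz (d%:R * ((r : nat)%:R / p.+2%:R)) ((24 * K * T)%:R^-1 : R).
  by have := hd (enum_rank_in rLam r); rewrite enum_rankK_in.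
have nth_ : nearz (th * (d * t)%:R) (t%:R * ((24 * K * T)%:R^-1 + d%:R / p.+2%:R)).
  have -> : th * (d * t)%:R = t%:R * (d%:R * ((r : nat)%:R / p.+2%:R) + d%:R * (th - (r : nat)%:R / p.+2%:R)).
    by rewrite natrM; ring.
  apply: nearz_muln; apply: nearzD nr _; exists (d%:Z * Num.floor th).
  rewrite intrM -pmulrn -mulrBr normrM normr_nat ler_wpM2l //.
  by have -> : th - (r : nat)%:R / p.+2%:R - (Num.floor th)%:~R = x - (r : nat)%:R / p.+2%:R by rewrite /x; ring.
have hph := normc_ec1_nearz nth_.
have -> : normc (1 - ec (th * (d * t)%:R)) = normc (ec (th * (d * t)%:R) - 1) by rewrite -normc_opp opprB.
apply: le_trans (_ : (8 * (t%:R * ((24 * K * T)%:R^-1 + d%:R / p.+2%:R))) * L%:R <= _).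
  by apply: ler_pM; rewrite ?normc_ge0.
have -> : L%:R / K%:R * (2 / 3) = (2 / 3 / K%:R) * L%:R :> R by ring.
rewrite ler_wpM2r //.
apply: le_trans (_ : 8 * (T%:R * ((24 * K * T)%:R^-1 + d%:R / p.+2%:R)) <= _).
  rewrite ler_wpM2l // ler_wpM2r ?addr_ge0 ?invr_ge0 ?divr_ge0 ?ler0n // ler_nat.
  exact: ltnW.
have -> : 8 * (T%:R * ((24 * K * T)%:R^-1 + d%:R / p.+2%:R)) = 3^-1 / K%:R + (6 * K%:R * T%:R * d%:R / L%:R) / (72 * K%:R ^+ 2) :> R.
  by rewrite mE !natrM; field; rewrite !gt_eqF.
have h6 : 6 * K%:R * T%:R * d%:R / L%:R <= 1 :> R by rewrite ler_pdivrMr // mul1r.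
apply: le_trans (_ : 3^-1 / K%:R + 1 / (72 * K%:R) <= _).
  rewrite lerD2l; apply: le_trans (_ : 1 / (72 * K%:R ^+ 2) <= _).
    by rewrite ler_wpM2r // invr_ge0 mulr_ge0 // exprn_ge0.
  rewrite !mul1r lef_pV2 ?posrE ?mulr_gt0 ?exprn_gt0 // ler_pM2l //.
  by rewrite expr2 ler_peMl // ltW.
have -> : 3^-1 / K%:R + 1 / (72 * K%:R) = (3^-1 + 72^-1) / K%:R :> R by field; rewrite gt_eqF.
by rewrite ler_wpM2r ?invr_ge0 //; lra.
Qed.

End Smoothing.

Lemma sum_mul_nat (V : nmodType) (n k : nat) (g : nat -> V) :
  \sum_(x < n * k) g x = \sum_(i < n) \sum_(j < k) g (i * k + j)%N.
Proof.
rewrite -(big_mkord predT g) big_nat_mul big_mkord; apply: eq_bigr => i _.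
rewrite -{1}[(i * k)%N]add0n big_addn mulSn addnK big_mkord; apply: eq_bigr => j _.
by rewrite addnC.
Qed.

Lemma sum_cells (V : nmodType) (Q q L : nat) (g : nat -> V) :
  \sum_(x < Q * (q * L)) g x =
  \sum_(s < Q) \sum_(i < q) \sum_(j < L) g (s * (q * L) + i + j * q)%N.
Proof.
rewrite sum_mul_nat; apply: eq_bigr => s _.
have e := sum_mul_nat L q (fun x => g (s * (q * L) + x)%N).
rewrite [(L * q)%N]mulnC in e; rewrite e exchange_big /=.
by apply: eq_bigr => i _; apply: eq_bigr => j _; rewrite [(j * q + i)%N]addnC addnA.
Qed.

(** * Square sums of the ambiguity function along a string *)

Section String.
Variables (R : realType) (G : finComNzRingType) (chi : G -> R[i]).
Hypothesis chiP : is_char chi.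

Lemma charX x k : chi (x *+ k) = chi x ^+ k.
Proof.
elim: k => [|k IH]; first by rewrite mulr0n (char0 chiP).
by rewrite mulrS (charD chiP) IH exprS.
Qed.

Lemma normcX1 (z : R[i]) k : normc z = 1 -> normc (z ^+ k - 1) <= k%:R * normc (z - 1).
Proof.
move=> z1; elim: k => [|k IH]; first by rewrite expr0 subrr normc_realE normr0 mul0r.
have -> : z ^+ k.+1 - 1 = z * (z ^+ k - 1) + (z - 1) by rewrite exprS; ring.
apply: le_trans (normcD _ _) _; rewrite ComplexField.Normc.normcM z1 mul1r -natr1 mulrDl mul1r.
by rewrite lerD2r.
Qed.

(** [amb] for a function supported on the first N residues, summed over natural numbers so that
    cells can be cut without wrapping around. *)
Definition namb (N : nat) (h : nat -> R) (F : G -> R) (u : G * G) : R[i] :=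
  \sum_(x < N) (h x * F (x%:R + u.1))%:C * chi (u.2 * x%:R).

Variables (N q L K : nat) (h : nat -> R) (F : G -> R) (v : G * G) (eta : G).
Hypotheses (q_gt0 : (0 < q)%N) (L_gt0 : (0 < L)%N) (K_gt0 : (0 < K)%N).
Hypotheses (h1 : forall x, `|h x| <= 1) (F1 : forall x, `|F x| <= 1).
Hypothesis cell_small : forall (s i : nat) (xi : G) (th : R),
  (s < N %/ (q * L))%N -> (i < q)%N ->
  normc (\sum_(j < L) (h (s * (q * L) + i + j * q)%N)%:C * chi xi ^+ j * ec (th * j%:R))
    <= L%:R / K%:R.
Hypothesis N_ge : (K * (q * L) <= N)%N.
Hypothesis phase_small : L%:R ^+ 2 * normc (chi (eta * q%:R) - 1) <= K%:R^-1.

Let E := normc (chi (eta * q%:R) - 1).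
Let c (y j : nat) : R[i] := (h (y + j * q)%N)%:C * chi (v.2 * q%:R) ^+ j.
Let b (y i : nat) : R[i] := (F (y%:R + v.1 + q%:R *+ i))%:C.
Let W (y l : nat) : R[i] := \sum_(j < L) c y j * b y (j + l)%N.
Let term (l x : nat) : R[i] :=
  (h x * F (x%:R + (v.1 + q%:R *+ l)))%:C * chi ((v.2 + eta *+ l) * x%:R).

Let c_le y j : normc (c y j) <= 1.
Proof.
rewrite ComplexField.Normc.normcM normc_realE -charX (char_norm chiP) mulr1; exact: h1.
Qed.

Let b_le y i : normc (b y i) <= 1.
Proof. rewrite normc_realE; exact: F1. Qed.

Let term_le l x : normc (term l x) <= 1.
Proof.
rewrite ComplexField.Normc.normcM normc_realE (char_norm chiP) mulr1; exact: normM_le1.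
Qed.

Let cell_le (l y : nat) : (l < L)%N ->
  normc (\sum_(j < L) term l (y + j * q)%N) <= normc (W y l) + L%:R / K%:R.
Proof.
move=> lL; pose om := chi (eta * q%:R); pose P := chi ((v.2 + eta *+ l) * y%:R).
have om1 : normc om = 1 by apply: (char_norm chiP).
have -> : \sum_(j < L) term l (y + j * q)%N =
   P * (W y l + \sum_(j < L) c y j * b y (j + l)%N * (om ^+ (l * j) - 1)).
  rewrite /W -big_split /= mulr_sumr; apply: eq_bigr => j _; rewrite /term /c /b.
  have -> : (y + j * q)%:R + (v.1 + q%:R *+ l) = y%:R + v.1 + q%:R *+ (j + l) :> G.
    by rewrite -[q%:R *+ (j + l)]mulr_natr -[q%:R *+ l]mulr_natr !natrD natrM; ring.
  have -> : (v.2 + eta *+ l) * (y + j * q)%:R =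
     (v.2 + eta *+ l) * y%:R + ((v.2 * q%:R) *+ j + (eta * q%:R) *+ (l * j)).
    rewrite -[(v.2 * q%:R) *+ j]mulr_natr -[(eta * q%:R) *+ _]mulr_natr -[eta *+ l]mulr_natr.
    by rewrite natrD !natrM; ring.
  by rewrite !(charD chiP) !charX -/om -/P rmorphM /=; ring.
rewrite ComplexField.Normc.normcM (char_norm chiP) mul1r; apply: le_trans (normcD _ _) _.
rewrite lerD2l; apply: le_trans (normc_sum _ _ _) _.
have -> : L%:R / K%:R = \sum_(j < L) K%:R^-1 :> R by rewrite sumr_const card_ord -[RHS]mulr_natl.
apply: ler_sum => j _.
rewrite ComplexField.Normc.normcM [normc (c _ _ * _)]ComplexField.Normc.normcM.
apply: le_trans (_ : 1 * (L%:R ^+ 2 * E) <= _); last by rewrite mul1r.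
apply: ler_pM; rewrite ?mulr_ge0 ?normc_ge0 //; first by apply: mulr_ile1; rewrite ?normc_ge0.
apply: le_trans (normcX1 _ om1) _; rewrite ler_wpM2r ?normc_ge0 //.
by rewrite -natrX ler_nat -mulnn leq_mul // ltnW.
Qed.

(** On a cell y + j q the summand at the l-th point of the string is c j times b (j + l), up to the
    mixed phase eta q l j that [phase_small] makes negligible. For the sum of squares over l,
    [corr_bound_nat] then reduces to the Fourier sums of c, small by [cell_small]. *)
Lemma string_bound :
  \sum_(l < L) normc (namb N h F (v.1 + q%:R *+ l, v.2 + eta *+ l)) ^+ 2
    <= L%:R * (12 * N%:R ^+ 2 / K%:R ^+ 2).
Proof.
have KR : 0 < K%:R :> R by rewrite ltr0n.
have LR : 0 < L%:R :> R by rewrite ltr0n.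
have qL0 : (0 < q * L)%N by rewrite muln_gt0 q_gt0.
pose Q := (N %/ (q * L))%N.
have QN : (Q * (q * L) <= N)%N by apply: leq_divM.
have NQ : (N - Q * (q * L) <= q * L)%N.
  by rewrite {1}(divn_eq N (q * L)) addKn ltnW // ltn_pmod.
have QNR : Q%:R * q%:R * L%:R <= N%:R :> R by rewrite -!natrM ler_nat -mulnA.
have KqL : q%:R * L%:R <= N%:R / K%:R :> R.
  by rewrite ler_pdivlMr // mulrC -!natrM ler_nat.
pose SW (l : nat) := \sum_(p : 'I_Q * 'I_q) normc (W (p.1 * (q * L) + p.2)%N l).
have SW0 l : 0 <= SW l by apply: sumr_ge0 => p _; apply: normc_ge0.
have amb_le l : (l < L)%N ->
    normc (namb N h F (v.1 + q%:R *+ l, v.2 + eta *+ l)) <= SW l + 2 * (N%:R / K%:R).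
  move=> lL; rewrite /namb -(big_mkord predT (term l)) (big_cat_nat (leq0n _) QN) /= big_mkord sum_cells.
  apply: le_trans (normcD _ _) _.
  have r1 : normc (\sum_(Q * (q * L) <= i < N) term l i) <= N%:R / K%:R.
    apply: le_trans (normc_sum_nat QN (term_le l)) _; apply: le_trans KqL.
    by rewrite -natrM ler_nat.
  have r2 : normc (\sum_(s < Q) \sum_(i < q) \sum_(j < L) term l (s * (q * L) + i + j * q)%N)
     <= SW l + N%:R / K%:R.
    apply: le_trans (_ : SW l + \sum_(p : 'I_Q * 'I_q) L%:R / K%:R <= _); last first.
      rewrite lerD2l sumr_const card_prod !card_ord -[X in X <= _]mulr_natr natrM.
      by rewrite mulrAC ler_pM2r ?invr_gt0 // mulrC.
    rewrite /SW -big_split /= pair_bigA /=; apply: le_trans (normc_sum _ _ _) _.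
    by apply: ler_sum => p _; apply: cell_le.
  by apply: le_trans (lerD r2 r1) _; lra.
have corr (p : 'I_Q * 'I_q) :
    \sum_(l < L) normc (W (p.1 * (q * L) + p.2)%N l) ^+ 2 <= (L%:R / K%:R) ^+ 2 * (2 * L%:R).
  have := @corr_bound_nat R L (c (p.1 * (q * L) + p.2)%N) (b (p.1 * (q * L) + p.2)%N) (L%:R / K%:R) L_gt0.
  move=> hc; apply: le_trans (hc _) _.
    by move=> th; apply: cell_small; apply: ltn_ord.
  rewrite ler_wpM2l ?sqr_ge0 // -natrM -[(2 * L)%N in X in _ <= X]card_ord -sumr_const.
  by apply: ler_sum => i _; rewrite exprn_ile1 ?normc_ge0.
(* Origin of the 12: the error 2 N / K contributes 8, and twice the square of SW contributes 4
   because the correlation meets 2L values of b. *)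
have sq l : (l < L)%N -> normc (namb N h F (v.1 + q%:R *+ l, v.2 + eta *+ l)) ^+ 2 <=
   2 * SW l ^+ 2 + 8 * (N%:R / K%:R) ^+ 2.
  move=> /amb_le hl; apply: le_trans (_ : (SW l + 2 * (N%:R / K%:R)) ^+ 2 <= _).
    by rewrite lerXn2r // nnegrE ?normc_ge0 // addr_ge0 // mulr_ge0 // divr_ge0.
  have := sqr_ge0 (SW l - 2 * (N%:R / K%:R)).
  by move: (SW l) (N%:R / K%:R) => x y; rewrite -subr_ge0 !expr2; lra.
apply: le_trans (_ : \sum_(l < L) (2 * SW l ^+ 2 + 8 * (N%:R / K%:R) ^+ 2) <= _).
  by apply: ler_sum => l _; apply: sq.
have sSW : \sum_(l < L) SW l ^+ 2 <= (Q%:R * q%:R) ^+ 2 * ((L%:R / K%:R) ^+ 2 * (2 * L%:R)).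
  apply: le_trans (_ : \sum_(l < L) (Q%:R * q%:R) *
       \sum_(p : 'I_Q * 'I_q) normc (W (p.1 * (q * L) + p.2)%N l) ^+ 2 <= _).
    apply: ler_sum => l _.
    have := sqr_sum_le predT (fun p : 'I_Q * 'I_q => normc (W (p.1 * (q * L) + p.2)%N l)).
    have -> : #|@predT ('I_Q * 'I_q)%type| = (Q * q)%N.
      by rewrite -[in RHS](card_ord Q) -[in RHS](card_ord q) -card_prod; apply: eq_card.
    by rewrite natrM.
  rewrite -mulr_sumr exchange_big /= [in leRHS]expr2 -[in leRHS]mulrA.
  rewrite ler_wpM2l ?mulr_ge0 //.
  apply: le_trans (_ : \sum_(p : 'I_Q * 'I_q) (L%:R / K%:R) ^+ 2 * (2 * L%:R) <= _).
    by apply: ler_sum => p _; apply: corr.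
  by rewrite sumr_const card_prod !card_ord -[X in X <= _]mulr_natl natrM.
rewrite big_split /= -mulr_sumr sumr_const card_ord -[X in _ + X <= _]mulr_natl.
have e1 : (Q%:R * q%:R) ^+ 2 * ((L%:R / K%:R) ^+ 2 * (2 * L%:R)) =
   2 * L%:R * ((Q%:R * q%:R * L%:R) ^+ 2 / K%:R ^+ 2) :> R by field; rewrite gt_eqF.
have e2 : (Q%:R * q%:R * L%:R) ^+ 2 <= N%:R ^+ 2 :> R.
  by rewrite lerXn2r // nnegrE ?mulr_ge0.
have e3 : (Q%:R * q%:R * L%:R) ^+ 2 / K%:R ^+ 2 <= N%:R ^+ 2 / K%:R ^+ 2 :> R.
  by rewrite ler_wpM2r // invr_ge0 exprn_ge0 // ltW.
have e4 : 2 * L%:R * ((Q%:R * q%:R * L%:R) ^+ 2 / K%:R ^+ 2) <= 2 * L%:R * (N%:R ^+ 2 / K%:R ^+ 2) :> R.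
  by rewrite ler_wpM2l // mulr_ge0 // ltW.
rewrite e1 in sSW.
have -> : L%:R * (12 * N%:R ^+ 2 / K%:R ^+ 2) = 12 * (L%:R * (N%:R ^+ 2 / K%:R ^+ 2)) :> R by ring.
have -> : L%:R * (8 * (N%:R / K%:R) ^+ 2) = 8 * (L%:R * (N%:R ^+ 2 / K%:R ^+ 2)) :> R.
  by rewrite exprMn exprVn; ring.
move: sSW e4; rewrite -!mulrA; lra.
Qed.

End String.

(** * Counting and the near-minimiser *)

Section VonNeumann.
Variables (R : rcfType) (G : finComNzRingType).
Let n : R := #|G|%:R.

(** Substituting z = x + t d isolates b; after Cauchy-Schwarz the two copies of d are written d and
    d + h. *)
Lemma cauchy_schwarz_elim (b : G -> R) (K : G -> G -> R) (t : G) : (forall x, `|b x| <= 1) ->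
  (\sum_x \sum_d b (x + t * d) * K d x) ^+ 2
    <= n * \sum_h \sum_x \sum_d K d x * K (d + h) (x - t * h).
Proof.
move=> b1.
have -> : \sum_x \sum_d b (x + t * d) * K d x = \sum_z b z * \sum_d K d (z - t * d).
  rewrite exchange_big /=; under [RHS]eq_bigr do rewrite mulr_sumr.
  rewrite [RHS]exchange_big /=; apply: eq_bigr => d _.
  by rewrite [RHS](reindex_inj (addIr (t * d))) /=; apply: eq_bigr => x _; rewrite addrK.
apply: le_trans (ler_sqr_sum predT _ _) _.
apply: ler_pM; [by apply: sumr_ge0 => z _; apply: sqr_ge0 | by apply: sumr_ge0 => z _; apply: sqr_ge0 | |].
  rewrite /n -sumr_const; apply: ler_sum => x _.
  by rewrite -real_normK ?num_real // exprn_ile1 ?normr_ge0.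
rewrite le_eqVlt; apply/orP; left; apply/eqP.
under eq_bigr do rewrite expr2 big_distrlr /=.
transitivity (\sum_z \sum_d \sum_h K d (z - t * d) * K (d + h) (z - t * (d + h))).
  by apply: eq_bigr => z _; apply: eq_bigr => d _; rewrite (reindex_inj (addrI d)).
transitivity (\sum_d \sum_h \sum_x K d x * K (d + h) (x - t * h)).
  rewrite exchange_big /=; apply: eq_bigr => d _; rewrite exchange_big /=; apply: eq_bigr => h _.
  rewrite (reindex_inj (addIr (t * d))) /=; apply: eq_bigr => x _.
  by rewrite addrK; congr (_ * K _ _); ring.
by rewrite exchange_big /=; apply: eq_bigr => h _; exact: exchange_big.
Qed.

(** Two eliminations remove b2 and b1. The weight depends on d alone, so it then splits off as a
    factor of size at most n, whatever the set of differences. A last Cauchy-Schwarz produces U3;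
    regularity of s and t makes - (t * h) and - (s * k) free variables. *)
Lemma von_neumann (w F b1 b2 : G -> R) (s t : G) :
  GRing.lreg s -> GRing.lreg t ->
  (forall x, `|w x| <= 1) -> (forall x, `|b1 x| <= 1) -> (forall x, `|b2 x| <= 1) ->
  (\sum_x \sum_d w d * F x * b1 (x + s * d) * b2 (x + t * d)) ^+ 8 <= n ^+ 12 * U3 F.
Proof.
move=> us ut w1 hb1 hb2.
have n0 : 0 <= n by rewrite ler0n.
pose c h k := \sum_x F x * F (x + h) * F (x + k) * F (x + h + k).
set I := \sum_x _.
pose J h := \sum_x \sum_d (w d * w (d + h)) * (F x * F (x - t * h)) *
   (b1 (x + s * d) * b1 (x + s * d + (s - t) * h)).
have I2 : I ^+ 2 <= n * \sum_h `|J h|.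
  have -> : I = \sum_x \sum_d b2 (x + t * d) * (w d * F x * b1 (x + s * d)).
    by apply: eq_bigr => x _; apply: eq_bigr => d _; rewrite mulrC.
  apply: le_trans (cauchy_schwarz_elim (fun d x => w d * F x * b1 (x + s * d)) t hb2) _.
  rewrite ler_wpM2l //; apply: ler_sum => h _; apply: le_trans (ler_norm _) _.
  rewrite le_eqVlt; apply/orP; left; apply/eqP; congr `|_|.
  apply: eq_bigr => x _; apply: eq_bigr => d _.
  have -> : x - t * h + s * (d + h) = x + s * d + (s - t) * h by ring.
  ring.
have J2 h : J h ^+ 2 <= n ^+ 2 * \sum_k `|c (- (t * h)) (- (s * k))|.
  pose b y := b1 y * b1 (y + (s - t) * h).
  pose K d x := w d * w (d + h) * (F x * F (x - t * h)).
  have -> : J h = \sum_x \sum_d b (x + s * d) * K d x.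
    by apply: eq_bigr => x _; apply: eq_bigr => d _; rewrite mulrC.
  have hb y : `|b y| <= 1 by apply: normM_le1.
  apply: le_trans (cauchy_schwarz_elim K s hb) _.
  rewrite expr2 -mulrA ler_wpM2l // mulr_sumr; apply: ler_sum => k _.
  have -> : \sum_x \sum_d K d x * K (d + k) (x - s * k) =
      (\sum_d w d * w (d + h) * (w (d + k) * w (d + k + h))) * c (- (t * h)) (- (s * k)).
    rewrite /c big_distrlr /= exchange_big /=; apply: eq_bigr => d _; apply: eq_bigr => x _.
    rewrite /K; have -> : x - s * k - t * h = x + - (t * h) + - (s * k) by ring.
    ring.
  apply: le_trans (ler_norm _) _; rewrite normrM ler_wpM2r ?normr_ge0 //.
  apply: le_trans (ler_norm_sum _ _ _) _; rewrite /n -sumr_const; apply: ler_sum => d _.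
  by apply: normM_le1; apply: normM_le1.
have inj (r : G) : GRing.lreg r -> injective (fun h => - (r * h)).
  by move=> ur x y /oppr_inj /ur.
pose S := \sum_h \sum_k `|c h k|.
have eS : \sum_h \sum_k `|c (- (t * h)) (- (s * k))| = S.
  rewrite /S [RHS](reindex_inj (inj t ut)); apply: eq_bigr => h _.
  by rewrite [RHS](reindex_inj (inj s us)).
have cG : #|@predT G| = #|G| by apply: eq_card.
have sJ : (\sum_h `|J h|) ^+ 2 <= n ^+ 3 * S.
  have := sqr_sum_le predT (fun h => `|J h|); rewrite cG => h; apply: le_trans h _.
  rewrite exprS -mulrA ler_wpM2l // -eS mulr_sumr; apply: ler_sum => h _.
  by rewrite real_normK ?num_real.
have sS : S ^+ 2 <= n ^+ 2 * U3 F.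
  have := sqr_sum_le predT (fun u : G * G => `|c u.1 u.2|).
  have -> : #|@predT (G * G)%type| = (#|G| * #|G|)%N by rewrite -card_prod; apply: eq_card.
  rewrite -(pair_bigA _ (fun h k => `|c h k|)) /= natrM -expr2 => h; apply: le_trans h _.
  rewrite -(pair_bigA _ (fun h k => `|c h k| ^+ 2)) /= /U3.
  rewrite ler_wpM2l ?exprn_ge0 //; apply: ler_sum => h _; apply: ler_sum => k _.
  by rewrite real_normK ?num_real.
have S0 : 0 <= S by apply: sumr_ge0 => h _; apply: sumr_ge0.
have J0 : 0 <= \sum_h `|J h| by apply: sumr_ge0.
have -> : I ^+ 8 = (I ^+ 2) ^+ 4 by rewrite -exprM.
apply: le_trans (_ : (n * \sum_h `|J h|) ^+ 4 <= _).
  by rewrite lerXn2r // nnegrE ?sqr_ge0 // mulr_ge0.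
have -> : (n * \sum_h `|J h|) ^+ 4 = n ^+ 4 * ((\sum_h `|J h|) ^+ 2) ^+ 2 by rewrite exprMn -exprM.
apply: le_trans (_ : n ^+ 4 * (n ^+ 3 * S) ^+ 2 <= _).
  rewrite ler_wpM2l ?exprn_ge0 // lerXn2r // nnegrE ?sqr_ge0 // mulr_ge0 ?exprn_ge0 //.
have -> : n ^+ 4 * (n ^+ 3 * S) ^+ 2 = n ^+ 10 * S ^+ 2 by ring.
have -> : n ^+ 12 * U3 F = n ^+ 10 * (n ^+ 2 * U3 F) by ring.
by rewrite ler_wpM2l ?exprn_ge0.
Qed.

End VonNeumann.

(** The second-order error collects 22 from the products with |z|^2 and 225 from the square of the
    increment, rounded up to 256. *)
Lemma normc_expand4 (R : rcfType) (z v r : R[i]) (n t : R) :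
  normc z <= n -> normc v <= 2 * n -> normc r <= n -> 0 <= t <= 1 ->
  normc (z + (t%:C * v + (t ^+ 2)%:C * r)) ^+ 4 <=
  normc z ^+ 4 + 4 * t * (normc z ^+ 2 * complex.Re (z * conjc v)) + 256 * t ^+ 2 * n ^+ 4.
Proof.
move=> hz hv hr /andP[t0 t1].
have z0 := normc_ge0 z; have v0 := normc_ge0 v; have r0 := normc_ge0 r.
have n0 : 0 <= n by apply: le_trans hz.
have tt : t ^+ 2 <= t by rewrite expr2 ler_piMl.
have tt0 : 0 <= t ^+ 2 by apply: sqr_ge0.
set y := t%:C * v + _.
have yle : normc y <= 3 * t * n.
  apply: le_trans (normcD _ _) _; rewrite !ComplexField.Normc.normcM !normc_realE.
  rewrite !ger0_norm //; nra.
have y2 : normc y ^+ 2 <= 9 * (t ^+ 2 * n ^+ 2).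
  have -> : 9 * (t ^+ 2 * n ^+ 2) = (3 * t * n) ^+ 2 by ring.
  by rewrite lerXn2r // nnegrE ?normc_ge0 // !mulr_ge0.
have -> : normc (z + y) ^+ 4 = (normc (z + y) ^+ 2) ^+ 2 by rewrite -exprM.
have -> : normc z ^+ 4 = (normc z ^+ 2) ^+ 2 by rewrite -exprM.
rewrite sqr_normcD.
have -> : complex.Re (z * conjc y) = t * complex.Re (z * conjc v) + t ^+ 2 * complex.Re (z * conjc r).
  rewrite /y conjcD !conjcM mulrDr ReD !conjc_real.
  by rewrite ![z * (_%:C * _)]mulrCA !ReZ.
have hrho : `|complex.Re (z * conjc v)| <= 2 * n ^+ 2.
  apply: le_trans (Re_le_normc _) _; rewrite ComplexField.Normc.normcM normc_conj; nra.
have hrho' : `|complex.Re (z * conjc r)| <= n ^+ 2.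
  apply: le_trans (Re_le_normc _) _; rewrite ComplexField.Normc.normcM normc_conj; nra.
have a0 : 0 <= normc z ^+ 2 by apply: sqr_ge0.
have an : normc z ^+ 2 <= n ^+ 2 by rewrite lerXn2r.
have Y0 : 0 <= normc y ^+ 2 by apply: sqr_ge0.
move: (complex.Re (z * conjc v)) (complex.Re (z * conjc r)) (normc z ^+ 2) (normc y ^+ 2)
  hrho hrho' a0 an Y0 y2 => rho rho' a Y hrho hrho' a0 an Y0 y2.
pose D := 2 * (t * rho + t ^+ 2 * rho') + Y.
have n2 : 0 <= n ^+ 2 by apply: sqr_ge0.
have tn0 : 0 <= t ^+ 2 * n ^+ 2 by apply: mulr_ge0.
have tn : t ^+ 2 * n ^+ 2 <= t * n ^+ 2 by rewrite ler_wpM2r.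
have hr1 : `|t * rho| <= 2 * (t * n ^+ 2).
  by rewrite normrM (ger0_norm t0) mulrCA ler_wpM2l.
have hr2 : `|t ^+ 2 * rho'| <= t ^+ 2 * n ^+ 2.
  by rewrite normrM (ger0_norm tt0) ler_wpM2l.
have hD : `|D| <= 15 * (t * n ^+ 2).
  move: hr1 hr2; rewrite !ler_norml /D => /andP[? ?] /andP[? ?]; apply/andP; split; lra.
have hD2 : D ^+ 2 <= 225 * (t ^+ 2 * n ^+ 4).
  have -> : 225 * (t ^+ 2 * n ^+ 4) = (15 * (t * n ^+ 2)) ^+ 2 by ring.
  rewrite -real_normK ?num_real // lerXn2r // nnegrE ?normr_ge0 // !mulr_ge0 //.
have haY : a * (2 * (t ^+ 2 * rho') + Y) <= 11 * (t ^+ 2 * n ^+ 4).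
  have -> : 11 * (t ^+ 2 * n ^+ 4) = n ^+ 2 * (11 * (t ^+ 2 * n ^+ 2)) by ring.
  apply: le_trans (_ : a * (11 * (t ^+ 2 * n ^+ 2)) <= _).
    rewrite ler_wpM2l //; move: hr2; rewrite ler_norml => /andP[_]; lra.
  by rewrite ler_wpM2r // mulr_ge0.
have -> : a + 2 * (t * rho + t ^+ 2 * rho') + Y = a + D by rewrite /D addrA.
have -> : (a + D) ^+ 2 = a ^+ 2 + 4 * t * (a * rho) + 2 * (a * (2 * (t ^+ 2 * rho') + Y)) + D ^+ 2.
  by rewrite /D; ring.
have : 0 <= t ^+ 2 * n ^+ 4 by rewrite mulr_ge0 // exprn_ge0.
lra.
Qed.

(** * First variation at a near-minimiser *)

Section NearMinimiser.
Import mathcomp_extra classical_sets.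
Variables (R : realType) (G : finComNzRingType) (chi : G -> R[i]).
Hypothesis chiP : is_char chi.
Let n : R := #|G|%:R.

(** Move from g to g + t (f' - g), which stays in the convex class. An infimum approached within t^2
    avoids compactness. For t = 1 / (256 n^6) the second-order error equals t, so after division by
    8t both errors fit into the slack 1. *)
Lemma near_minimiser (f e : G -> R) :
  (forall x, 0 <= f x <= 1) -> (forall x, 0 <= e x <= 1) ->
  exists2 g : G -> R, forall x, 0 <= g x <= e x &
  forall f' : G -> R, (forall x, 0 <= f' x <= e x) ->
    let F := fun x => f x - g x in
    \sum_u normc (amb chi F F u) ^+ 4 - 1 <=
    \sum_u normc (amb chi F F u) ^+ 3 * normc (amb chi (fun x => f x - f' x) F u).
Proof.
move=> hf he.
pose cls (g : G -> R) := forall x, 0 <= g x <= e x.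
pose Phi (g : G -> R) := let F := fun x => f x - g x in \sum_u normc (amb chi F F u) ^+ 4.
have n1 : 1 <= n by rewrite ler1n; apply/card_gt0P; exists 0.
have n0 : 0 < n by apply: lt_le_trans n1.
have n6 : 1 <= n ^+ 6 by apply: exprn_ege1.
pose t : R := (256 * n ^+ 6)^-1.
have t0 : 0 < t by rewrite invr_gt0 mulr_gt0 ?exprn_gt0.
have tE : t * (256 * n ^+ 6) = 1 by rewrite mulVf // gt_eqF // mulr_gt0 ?exprn_gt0.
have t1 : t <= 1 by nra.
have [g hg hmin] : exists2 g, cls g & forall g', cls g' -> Phi g <= Phi g' + t ^+ 2.
  pose E := [set y | exists2 g, cls g & y = Phi g]%classic.
  have lbE : has_lbound E.
    exists 0 => y [g _ ->]; apply: sumr_ge0 => u _; rewrite exprn_ge0 ?normc_ge0 //.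
  have hiE : has_inf E.
    split=> //; exists (Phi (fun=> 0)); exists (fun=> 0) => // x; rewrite lexx.
    by have /andP[] := he x.
  have [y [g hg ->] lt] := inf_adherent (exprn_gt0 2 t0) hiE.
  exists g => // g' hg'; apply: ltW; apply: lt_le_trans lt _; rewrite lerD2r.
  by apply: ge_inf => //; exists g'.
exists g => // f' hf'; pose F x := f x - g x.
have F1 x : `|F x| <= 1.
  have := hf x; have := hg x; have := he x; rewrite ler_norml /F; lra.
pose D x := f' x - g x.
have D1 x : `|D x| <= 1.
  have := hg x; have := hf' x; have := he x; rewrite ler_norml /D; lra.
pose H x := f x - f' x.
pose g' x := g x + t * D x.
have hg' : cls g'.
  move=> x; have /andP[g0 ge] := hg x; have /andP[f0 fe] := hf' x.
  rewrite /g' /D; apply/andP; split; nra.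
pose z u := amb chi F F u.
pose v u := - (amb chi D F u + amb chi F D u).
have eamb u : amb chi (fun x => f x - g' x) (fun x => f x - g' x) u =
    z u + (t%:C * v u + (t ^+ 2)%:C * amb chi D D u).
  rewrite /z /v /amb -big_split /= -sumrN !mulr_sumr -!big_split /=; apply: eq_bigr => x _.
  have -> : f x - g' x = F x - t * D x by rewrite /g' /F; ring.
  have -> : f (x + u.1) - g' (x + u.1) = F (x + u.1) - t * D (x + u.1) by rewrite /g' /F; ring.
  rewrite !(rmorphM, rmorphB, rmorphXn) /=; ring.
have up : Phi g' <= Phi g + 4 * t * (\sum_u normc (z u) ^+ 2 * complex.Re (z u * conjc (v u)))
    + 256 * t ^+ 2 * n ^+ 6.
  have e6 : 256 * t ^+ 2 * n ^+ 6 = \sum_(u : G * G) 256 * t ^+ 2 * n ^+ 4.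
    by rewrite sumr_const card_prod -[RHS]mulr_natr natrM -/n; ring.
  rewrite e6 mulr_sumr /Phi -big_split /= -big_split /=; apply: ler_sum => u _.
  rewrite eamb; apply: normc_expand4.
  - exact: (amb_le chiP).
  - rewrite normc_opp; apply: le_trans (normcD _ _) _; rewrite mulr2n mulrDl mul1r.
    by apply: lerD; apply: (amb_le chiP).
  - exact: (amb_le chiP).
  - by rewrite (ltW t0).
have eDF u : amb chi D F u = z u - amb chi H F u.
  rewrite /z /amb -sumrB; apply: eq_bigr => x _.
  have -> : D x = F x - H x by rewrite /D /F /H; ring.
  rewrite !(rmorphM, rmorphB) /=; ring.
have eFD u : amb chi F D u = z u - amb chi F H u.
  rewrite /z /amb -sumrB; apply: eq_bigr => x _.
  have -> : D (x + u.1) = F (x + u.1) - H (x + u.1) by rewrite /D /F /H; ring.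
  rewrite !(rmorphM, rmorphB) /=; ring.
pose S := \sum_u normc (z u) ^+ 3 * normc (amb chi H F u).
(* The two mixed terms give the same sum: exchanging the functions reverses the shift, and |amb F F|
   is even in it. *)
have eS : \sum_u normc (z u) ^+ 3 * normc (amb chi F H u) = S.
  rewrite /S -(pair_bigA _ (fun h k => normc (z (h, k)) ^+ 3 * normc (amb chi F H (h, k)))) /=.
  rewrite -(pair_bigA _ (fun h k => normc (z (h, k)) ^+ 3 * normc (amb chi H F (h, k)))) /=.
  rewrite [RHS](reindex_inj oppr_inj) /=; apply: eq_bigr => h _; apply: eq_bigr => k _.
  by rewrite (amb_swap chiP) /z (amb_swap chiP F F).
have lin : \sum_u normc (z u) ^+ 2 * complex.Re (z u * conjc (v u)) <= - 2 * Phi g + 2 * S.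
  have -> : - 2 * Phi g + 2 * S = \sum_u (- 2 * normc (z u) ^+ 4 + normc (z u) ^+ 3 * normc (amb chi H F u)
      + normc (z u) ^+ 3 * normc (amb chi F H u)).
    by rewrite !big_split /= eS -mulr_sumr -/S /Phi -addrA; congr (_ + _); rewrite mulr2n mulrDl mul1r.
  apply: ler_sum => u _; rewrite /v eDF eFD.
  have a0 := normc_ge0 (z u).
  have re1 := Re_le_normc (z u * conjc (amb chi H F u)).
  have re2 := Re_le_normc (z u * conjc (amb chi F H u)).
  rewrite ComplexField.Normc.normcM normc_conj in re1; rewrite ComplexField.Normc.normcM normc_conj in re2.
  have -> : complex.Re (z u * conjc (- (z u - amb chi H F u + (z u - amb chi F H u)))) =
     complex.Re (z u * conjc (amb chi H F u)) + complex.Re (z u * conjc (amb chi F H u)) - 2 * normc (z u) ^+ 2.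
    rewrite sqr_normcE; move: (z u) (amb chi H F u) (amb chi F H u) => [a b] [c d] [p q] /=; ring.
  move/(le_trans (ler_norm _)): re1 => re1; move/(le_trans (ler_norm _)): re2 => re2.
  have -> : - 2 * normc (z u) ^+ 4 + normc (z u) ^+ 3 * normc (amb chi H F u)
      + normc (z u) ^+ 3 * normc (amb chi F H u) = normc (z u) ^+ 2 *
     (normc (z u) * normc (amb chi H F u) + normc (z u) * normc (amb chi F H u) - 2 * normc (z u) ^+ 2) by ring.
  by rewrite ler_wpM2l ?sqr_ge0 // lerD2r lerD.
have := hmin _ hg'; rewrite -/(Phi g) -/S => hm.
change (Phi g - 1 <= S).
have l4 : 4 * t * (\sum_u normc (z u) ^+ 2 * complex.Re (z u * conjc (v u))) <= 4 * t * (- 2 * Phi g + 2 * S).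
  by rewrite ler_wpM2l // mulr_ge0 // ltW.
have e1 : 256 * t ^+ 2 * n ^+ 6 = t.
  have -> : 256 * t ^+ 2 * n ^+ 6 = t * (t * (256 * n ^+ 6)) by ring.
  by rewrite tE mulr1.
have e2 : t ^+ 2 <= t by rewrite expr2 ler_piMl // ltW.
have : 0 <= 8 * t * (S - Phi g + 1) by move: l4 up hm; lra.
by rewrite pmulr_rge0 ?mulr_gt0 //; lra.
Qed.

End NearMinimiser.

(** * Counting progressions with difference in a syndetic set *)

Definition syndetic (M : nat) (S : nat -> Prop) : Prop :=
  forall n : nat, (0 < n)%N -> exists2 t : nat, (0 < t <= M)%N & S (n * t)%N.

Definition no_ap3 (S : nat -> Prop) (A : pred nat) : Prop :=
  forall x d : nat, (0 < d)%N -> S d -> A x -> A (x + d)%N -> A (x + 2 * d)%N -> False.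

Lemma lreg_inv (G : comNzRingType) (c r : G) : c * r = 1 -> GRing.lreg r.
Proof. by move=> e x y h; rewrite -[x]mul1r -[y]mul1r -e -!mulrA h. Qed.

(** For i up to N / (8M) pick t_i <= M with i t_i in S. The pair (i t_i, t_i) determines i and t_i
    has M possible values, so about N / (8 M^2) elements of S arise; the 16 absorbs the rounding. *)
Lemma card_syndetic (M N m : nat) (S : nat -> Prop) : (0 < M)%N -> syndetic M S ->
  (8 * M <= N)%N -> (N < m)%N ->
  (N <= 16 * M ^ 2 * #|[set d : 'I_m | [&& (0 < d)%N, (8 * d <= N)%N & `[< S d >]]]|)%N.
Proof.
move=> M0 hS MN Nm; set SS := [set d | _].
pose D := (N %/ (8 * M))%N.
have M8 : (0 < 8 * M)%N by rewrite muln_gt0.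
have D1 : (0 < D)%N by rewrite divn_gt0.
have ND : (N <= 16 * M * D)%N.
  have := divn_eq N (8 * M); have := ltn_pmod N M8; rewrite -/D; nia.
have hS' (i : nat) : exists t, (0 < t <= M)%N /\ S (i.+1 * t)%N.
  by have [//|t h1 h2] := hS i.+1; exists t.
have [t ht] := choice hS'.
have lt (i : 'I_D) : (i.+1 * t i < m)%N.
  apply: leq_ltn_trans Nm; have [/andP[_ tM] _] := ht i.
  apply: leq_trans (_ : D * M <= _)%N; first by apply: leq_mul.
  have : (D * (8 * M) <= N)%N by apply: leq_divM.
  by move: M0; nia.
have tM (i : 'I_D) : ((t i).-1 < M)%N by have [/andP[t0 tM] _] := ht i; rewrite prednK.
pose phi (i : 'I_D) : 'I_m * 'I_M := (Ordinal (lt i), Ordinal (tM i)).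
have inj : injective phi.
  move=> i j [] e1 e2; have [/andP[ti _] _] := ht i; have [/andP[tj _] _] := ht j.
  have e : t i = t j by move: e2 ti tj; lia.
  apply: val_inj => /=; rewrite e in e1; move/eqP: e1; rewrite eqn_pmul2r // => /eqP[] //.
have : (D <= #|setX SS [set: 'I_M]|)%N.
  rewrite -[D]card_ord -(card_imset _ inj); apply: subset_leq_card; apply/subsetP.
  move=> _ /imsetP[i _ ->]; rewrite !inE /= andbT; have [/andP[t0 tM'] St] := ht i.
  rewrite muln_gt0 t0 /=; apply/andP; split; last exact/asboolP.
  have : (D * (8 * M) <= N)%N by apply: leq_divM.
  have : (i.+1 * t i <= D * M)%N by apply: leq_mul.
  by move: M0; nia.
rewrite cardsX cardsT card_ord => h.
apply: leq_trans ND _; rewrite -mulnn.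
by apply: leq_trans (leq_mul (leqnn (16 * M)) h) _; apply: eq_leq; ring.
Qed.

Lemma prod3_ge (R : realType) (gam a b c : R) :
  0 <= a <= gam -> 0 <= b <= gam -> 0 <= c <= gam ->
  gam ^+ 3 - gam ^+ 2 * (gam - a + (gam - b) + (gam - c)) <= a * b * c.
Proof.
move=> /andP[a0 ag] /andP[b0 bg] /andP[c0 cg]; rewrite -subr_ge0.
have -> : a * b * c - (gam ^+ 3 - gam ^+ 2 * (gam - a + (gam - b) + (gam - c))) =
  (gam - a) * (gam - b) * c + gam * ((gam - b) * (gam - c) + (gam - a) * (gam - c)) by ring.
have g0 : 0 <= gam by apply: le_trans ag.
have ha : 0 <= gam - a by rewrite subr_ge0.
have hb : 0 <= gam - b by rewrite subr_ge0.
have hc : 0 <= gam - c by rewrite subr_ge0.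
by apply: addr_ge0; [|apply: mulr_ge0 => //; apply: addr_ge0]; rewrite ?mulr_ge0.
Qed.

Section ZpFacts.
Variables (p N : nat).
Hypothesis pE : (p.+2 = 4 * N + 1)%N.

Lemma Zp_two_inv : (2 * N + 1)%:R * 2%:R = 1 :> 'I_p.+2.
Proof.
have e : ((2 * N + 1) * 2 = p.+2 + 1)%N by rewrite pE; lia.
have pn0 : p.+2%:R = 0 :> 'I_p.+2 by rewrite Zp_nat; apply: val_inj; rewrite /= modnn.
by rewrite -natrM e natrD pn0 add0r.
Qed.

Lemma Zp_val_add (x d : 'I_p.+2) (k : nat) : (x < N)%N -> (8 * d <= N)%N -> (k <= 2)%N ->
  (x + k%:R * d : 'I_p.+2) = (x + k * d)%N :> nat.
Proof.
move=> xN dN k2.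
have lt : (x + k * d < p.+2)%N.
  have : (k * d <= 2 * d)%N by rewrite leq_mul2r k2 orbT.
  by move: (k * d)%N (nat_of_ord x) (nat_of_ord d) xN dN pE => y x' d'; lia.
have -> : x + k%:R * d = (x + k * d)%N%:R :> 'I_p.+2 by rewrite natrD natrM !natr_Zp.
by rewrite Zp_nat /= modn_small.
Qed.

Lemma Zp_N_lt : (N < p.+2)%N.
Proof. by rewrite pE; lia. Qed.

End ZpFacts.

Lemma half_contra (R : realType) (v a b : R) :
  v / 32 <= a -> a <= b -> b <= v / 64 -> 0 < v -> False.
Proof.
lra.
Qed.

Section Count.
Variables (R : realType) (M N Z p : nat) (S : nat -> Prop) (A : pred nat) (delta gam : R).
Hypotheses (M_gt0 : (0 < M)%N) (MN : (8 * M <= N)%N) (pE : (p.+2 = 4 * N + 1)%N).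
Hypotheses (hS : syndetic M S) (noap : no_ap3 S A) (AN : forall x, A x -> (x < N)%N).
Hypotheses (d_gt0 : 0 < delta) (dg : delta <= gam) (gd : gam <= 25 / 24 * delta) (g1 : gam <= 1).
Hypotheses (dZ : 1 <= delta * Z%:R) (dA : delta * N%:R <= \sum_(x < N) (A x)%:R).

Let G : finComNzRingType := 'I_p.+2.
Let n : R := #|G|%:R.
Definition set_indicator (x : 'I_p.+2) : R := (A x)%:R.
Definition envelope (x : 'I_p.+2) : R := if (x < N)%N then gam else 0.
Let Y : R := (4800 * M ^ 2 * Z ^ 3)%:R.

(** Suppose U3 is smaller. Telescoping from f to g changes the count by three terms controlled by
    U3, and the count for f vanishes. U3 also controls the mean of F, so g has almost the mean of f
    and lies close to its ceiling gam on average; the count for g is therefore too large. *)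
Lemma U3_lower (g : 'I_p.+2 -> R) : (forall x, 0 <= g x <= envelope x) ->
  n ^+ 4 <= Y ^+ 8 * U3 (fun x => set_indicator x - g x).
Proof.
move=> hg; rewrite leNgt; apply/negP => lt.
pose f := set_indicator; pose F (x : 'I_p.+2) := f x - g x; rewrite -/F in lt.
have N0 : (0 < N)%N by apply: leq_trans MN; rewrite muln_gt0.
have NR : 0 < N%:R :> R by rewrite ltr0n.
have MR : 0 < M%:R :> R by rewrite ltr0n.
have Z0 : 0 < Z%:R :> R.
  by rewrite ltr0n lt0n; apply/eqP => z0; move: dZ; rewrite z0 mulr0; lra.
have YE : Y = 4800 * M%:R ^+ 2 * Z%:R ^+ 3 by rewrite /Y natrM natrM !natrX.
have Y0 : 0 < Y by rewrite YE !mulr_gt0 ?exprn_gt0.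
have nE : n = 4 * N%:R + 1 by rewrite /n card_ord pE natrD natrM.
have N1 : 1 <= N%:R :> R by rewrite ler1n.
have n0 : 0 < n by rewrite nE; lra.
have gm0 : 0 < gam by apply: lt_le_trans dg.
have env_ge0 x : 0 <= envelope x by rewrite /envelope; case: ifP => // _; apply: ltW.
have env_le x : envelope x <= gam by rewrite /envelope; case: ifP => // _; apply: ltW.
have f01 x : 0 <= f x <= 1 by rewrite /f /set_indicator; case: (A x); rewrite ?lexx ?ler01.
have g01 x : 0 <= g x <= 1.
  by have /andP[a b] := hg x; rewrite a (le_trans b) // (le_trans (env_le x)).
have F1 x : `|F x| <= 1.
  by have /andP[a b] := f01 x; have /andP[c d] := g01 x; rewrite ler_norml /F; apply/andP; split; lra.
have f1 x : `|f x| <= 1 by have /andP[a b] := f01 x; rewrite ler_norml; apply/andP; split; lra.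
have gb x : `|g x| <= 1 by have /andP[a b] := g01 x; rewrite ler_norml; apply/andP; split; lra.
pose Sd (d : 'I_p.+2) := [&& (0 < d)%N, (8 * d <= N)%N & `[< S d >]].
pose w (d : 'I_p.+2) : R := (Sd d)%:R.
have w01 d : 0 <= w d <= 1 by rewrite /w; case: (Sd d); rewrite ?lexx ?ler01.
have w1 d : `|w d| <= 1 by have /andP[a b] := w01 d; rewrite ler_norml; apply/andP; split; lra.
have small (I : R) : I ^+ 8 <= n ^+ 12 * U3 F -> `|I| <= n ^+ 2 / Y.
  move=> h; rewrite -(ler_pXn2r (ltn0Sn 7)) ?nnegrE ?normr_ge0 ?divr_ge0 ?exprn_ge0 ?(ltW n0) ?(ltW Y0) //.
  have -> : `|I| ^+ 8 = I ^+ 8 by rewrite -normrX ger0_norm // (exprn_even_ge0 (n := 8)).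
  apply: le_trans h _; rewrite exprMn exprVn ler_pdivlMr ?exprn_gt0 // -exprM.
  have -> : n ^+ (2 * 8) = n ^+ 12 * n ^+ 4 by rewrite -exprD.
  by rewrite -mulrA ler_wpM2l ?exprn_ge0 ?(ltW n0) // mulrC ltW.
have two := Zp_two_inv pE.
have l1 : GRing.lreg (1 : 'I_p.+2) by apply: (@lreg_inv _ 1); rewrite mul1r.
have lm1 : GRing.lreg (-1 : 'I_p.+2) by apply: (@lreg_inv _ (-1)); rewrite mulrNN mulr1.
have l2 : GRing.lreg (2%:R : 'I_p.+2) by apply: (lreg_inv two).
have lm2 : GRing.lreg (- 2%:R : 'I_p.+2).
  by apply: (@lreg_inv _ (- (2 * N + 1)%:R)); rewrite mulrNN.
pose tri (a b c : 'I_p.+2 -> R) := \sum_x \sum_d w d * a x * b (x + d) * c (x + 2%:R * d).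
have b1 : `|tri F f f| <= n ^+ 2 / Y.
  apply: small; apply: le_trans _ (von_neumann F l1 l2 w1 f1 f1).
  rewrite le_eqVlt; apply/orP; left; apply/eqP; congr (_ ^+ 8).
  by apply: eq_bigr => x _; apply: eq_bigr => d _; rewrite mul1r.
(* Recentred at the factor F, the other two points have steps (-1, 1), and (-2, -1) in the next
   bound. All are invertible because the modulus 4N + 1 is odd. *)
have b2 : `|tri g F f| <= n ^+ 2 / Y.
  apply: small; apply: le_trans _ (von_neumann F lm1 l1 w1 gb f1).
  rewrite le_eqVlt; apply/orP; left; apply/eqP; congr (_ ^+ 8).
  rewrite /tri exchange_big [RHS]exchange_big /=; apply: eq_bigr => d _.
  rewrite (reindex_inj (addIr (- d))) /=; apply: eq_bigr => x _.
  rewrite subrK mul1r mulN1r (_ : x - d + 2%:R * d = x + d); last by ring.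
  ring.
have b3 : `|tri g g F| <= n ^+ 2 / Y.
  apply: small; apply: le_trans _ (von_neumann F lm2 lm1 w1 gb gb).
  rewrite le_eqVlt; apply/orP; left; apply/eqP; congr (_ ^+ 8).
  rewrite /tri exchange_big [RHS]exchange_big /=; apply: eq_bigr => d _.
  rewrite (reindex_inj (addIr (- (2%:R * d)))) /=; apply: eq_bigr => x _.
  rewrite subrK mulN1r mulNr (_ : x - 2%:R * d + d = x - d); last by ring.
  ring.
(* With all weights equal to 1 the same inequality controls the mean of F. *)
have bF : `|\sum_x F x| <= n / Y.
  have : `|n * \sum_x F x| <= n ^+ 2 / Y.
    have one1 (x : 'I_p.+2) : `|1 : R| <= 1 by rewrite normr1.
    apply: small; apply: le_trans _ (von_neumann F l1 l1 one1 one1 one1).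
    rewrite le_eqVlt; apply/orP; left; apply/eqP; congr (_ ^+ 8).
    rewrite mulr_sumr; apply: eq_bigr => x _.
    under eq_bigr do rewrite mul1r !mulr1.
    by rewrite sumr_const mulr_natl.
  rewrite normrM (gtr0_norm n0) expr2 -mulrA ler_pM2l //.
have vadd := Zp_val_add pE.
have Np : (N <= p.+2)%N by apply: ltnW; apply: Zp_N_lt.
have fff : tri f f f = 0.
  rewrite /tri big1 // => x _; rewrite big1 // => d _; rewrite /w /f /set_indicator.
  case hd : (Sd d); last by rewrite !mul0r.
  case hx : (A x); last by rewrite mulr0 !mul0r.
  case hx1 : (A (x + d)); last by rewrite mulr0 !mul0r.
  case hx2 : (A (x + 2%:R * d)); last by rewrite mulr0.
  move: hd => /and3P[d0 d8 /asboolP Sd_].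
  have xN := AN hx.
  have e1 := vadd x d 1%N xN d8 isT; rewrite mul1r mul1n in e1.
  have e2 := vadd x d 2%N xN d8 isT.
  by exfalso; apply: (noap d0 Sd_ hx); rewrite -?e1 -?e2.
have tele : tri f f f = tri g g g + tri g g F + tri g F f + tri F f f.
  rewrite /tri -!big_split /=; apply: eq_bigr => x _; rewrite -!big_split /=; apply: eq_bigr => d _.
  rewrite /F; ring.
pose r (x : 'I_p.+2) := envelope x - g x.
have r0 x : 0 <= r x by have /andP[a b] := hg x; rewrite /r subr_ge0.
pose rho := \sum_x r x.
have eenv : \sum_x envelope x = N%:R * gam.
  rewrite /envelope (sum_ord_if (fun=> gam) Np).
  by rewrite sumr_const card_ord mulr_natl.
have hf : delta * N%:R <= \sum_x f x.
  apply: le_trans dA _; rewrite le_eqVlt; apply/orP; left; apply/eqP.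
  rewrite -(sum_ord_if (fun x => (A x)%:R) Np); apply: eq_bigr => x _.
  rewrite /f /set_indicator; case: ifP => // xN; case hx : (A x) => //.
  by rewrite (AN hx) in xN.
have hrho : rho <= (gam - delta) * N%:R + n / Y.
  rewrite /rho /r sumrB eenv.
  have e : \sum_x F x = \sum_x f x - \sum_x g x by rewrite -sumrB.
  have := le_trans (ler_norm _) bF; rewrite e; lra.
(* As 2d <= N / 4, at least three quarters of the x keep all three points below N; there g falls
   short of gam by r, of total rho. *)
have ggg_d (d : 'I_p.+2) : Sd d ->
    gam ^+ 2 * (3 / 4 * gam * N%:R - 3 * rho) <= \sum_x g x * g (x + d) * g (x + 2%:R * d).
  move=> /and3P[d0 d8 _].
  have d2N : (N - 2 * d <= p.+2)%N by apply: leq_trans Np; apply: leq_subr.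
  have ptw (x : 'I_p.+2) : (if (x < N - 2 * d)%N then gam ^+ 3 else 0) -
      gam ^+ 2 * (r x + r (x + d) + r (x + 2%:R * d)) <= g x * g (x + d) * g (x + 2%:R * d).
    have ra := r0 x; have rb := r0 (x + d); have rc := r0 (x + 2%:R * d).
    have ga := hg x; have gb' := hg (x + d); have gc := hg (x + 2%:R * d).
    case: ifP => [xN|_]; last first.
      apply: le_trans (_ : 0 <= _).
        by rewrite sub0r oppr_le0; apply: mulr_ge0; [exact: sqr_ge0 | apply: addr_ge0 => //; apply: addr_ge0].
      by move: ga gb' gc => /andP[? _] /andP[? _] /andP[? _]; rewrite !mulr_ge0.
    have xN' : (x < N)%N by apply: leq_trans xN (leq_subr _ _).
    have e1 := vadd x d 1%N xN' d8 isT; rewrite mul1r mul1n in e1.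
    have e2 := vadd x d 2%N xN' d8 isT.
    have i2 : (nat_of_ord (x + 2%:R * d)%R < N)%N by rewrite e2 addnC -ltn_subRL.
    have i1 : (nat_of_ord (x + d)%R < N)%N.
      by rewrite e1; apply: leq_ltn_trans i2; rewrite e2 leq_add2l leq_pmull.
    move: ra rb rc ga gb' gc; rewrite /r /envelope xN' i1 i2.
    move: (g x) (g (x + d)) (g (x + 2%:R * d)) => a b c ra rb rc ga gb' gc.
    exact: prod3_ge.
  apply: le_trans (_ : \sum_(x : 'I_p.+2) ((if (x < N - 2 * d)%N then gam ^+ 3 else 0) -
      gam ^+ 2 * (r x + r (x + d) + r (x + 2%:R * d))) <= _); last by apply: ler_sum.
  rewrite sumrB (sum_ord_if (fun=> gam ^+ 3) d2N) sumr_const card_ord -mulr_sumr.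
  have ed t : \sum_x r (x + t) = rho by rewrite /rho [RHS](reindex_inj (addIr t)).
  have -> : \sum_x (r x + r (x + d) + r (x + 2%:R * d)) = 3 * rho.
    by rewrite big_split /= big_split /= !ed -/rho; ring.
  rewrite -[gam ^+ 3 *+ _]mulr_natr natrB; last by apply: leq_trans d8; rewrite leq_mul2r orbT.
  rewrite natrM; have : 8 * (d : nat)%:R <= N%:R :> R by rewrite -natrM ler_nat.
  have := exprn_gt0 3 gm0; have -> : gam ^+ 3 = gam ^+ 2 * gam by rewrite exprSr.
  move: (gam ^+ 2) ((d : nat)%:R : R) => g2 dd h1 h2; nra.
have hsS : N%:R <= 16 * M%:R ^+ 2 * \sum_d w d.
  have -> : \sum_d w d = #|[set d : 'I_p.+2 | Sd d]|%:R.
    by rewrite -sum1_card natr_sum [RHS]big_mkcond /=; apply: eq_bigr => d _; rewrite inE /w; case: (Sd d).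
  rewrite -natrX -!natrM ler_nat; apply: card_syndetic => //.
  exact: Zp_N_lt.
set sw := \sum_d w d in hsS.
have ggg : sw * (gam ^+ 2 * (3 / 4 * gam * N%:R - 3 * rho)) <= tri g g g.
  rewrite /tri exchange_big /sw mulr_suml /=; apply: ler_sum => d _.
  have -> : \sum_i w d * g i * g (i + d) * g (i + 2%:R * d) = w d * \sum_i g i * g (i + d) * g (i + 2%:R * d).
    by rewrite mulr_sumr; apply: eq_bigr => i _; rewrite !mulrA.
  rewrite /w; case hd : (Sd d); last by rewrite !mul0r.
  by rewrite !mul1r; apply: ggg_d.
have gY : tri g g g <= 3 * (n ^+ 2 / Y).
  have := fff; rewrite tele; move: b1 b2 b3; rewrite !ler_norml; lra.
have n5 : n <= 5 * N%:R by rewrite nE; lra.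
have dZ3 : 1 <= delta ^+ 3 * Z%:R ^+ 3 by rewrite -exprMn exprn_ege1.
have M1 : 1 <= M%:R :> R by rewrite ler1n.
have MM1 : 1 <= M%:R ^+ 2 :> R by rewrite exprn_ege1.
have hYd : 4800 * M%:R ^+ 2 <= Y * delta ^+ 3.
  by rewrite YE -mulrA [_ ^+ 3 * _]mulrC ler_peMr // mulr_ge0 // sqr_ge0.
have M2 : 0 < M%:R ^+ 2 :> R by rewrite exprn_gt0.
have d1 : delta <= 1 by apply: le_trans g1.
have d3 : delta ^+ 3 <= delta by rewrite exprSr ler_piMl ?(ltW d_gt0) // exprn_ile1 // ltW.
have d3p : 0 < delta ^+ 3 by rewrite exprn_gt0.
have iY : Y^-1 <= delta ^+ 3 / (4800 * M%:R ^+ 2).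
  rewrite ler_pdivlMr ?mulr_gt0 // mulrC ler_pdivrMr // mulrC [delta ^+ 3 * _]mulrC mulrC.
  exact: hYd.
have iY2 : Y^-1 <= delta / 4800.
  apply: le_trans iY _; rewrite ler_pdivrMr ?mulr_gt0 //.
  have -> : delta / 4800 * (4800 * M%:R ^+ 2) = delta * M%:R ^+ 2 by field.
  by apply: le_trans d3 _; rewrite ler_peMr // ltW.
have iY0 : 0 <= Y^-1 by rewrite invr_ge0 ltW.
have nY : n / Y <= N%:R * delta / 960.
  apply: le_trans (_ : 5 * N%:R * (delta / 4800) <= _).
    by apply: ler_pM => //; apply: ltW.
  by rewrite le_eqVlt; apply/orP; left; apply/eqP; field.
(* This is where 25/24 is used: 3/4 gam - 3 (gam - delta) >= 21/32 delta, leaving room above delta /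
   2 for the error 3 n / Y. *)
have br : delta * N%:R / 2 <= 3 / 4 * gam * N%:R - 3 * rho.
  have h1 : delta * N%:R <= gam * N%:R by rewrite ler_pM2r.
  have h2 : gam * N%:R <= 25 / 24 * delta * N%:R by rewrite ler_pM2r.
  by move: hrho nY h1 h2; rewrite mulrBl; lra.
have sw0 : 0 <= sw by apply: sumr_ge0 => d _; have /andP[] := w01 d.
have dN0 : 0 <= delta * N%:R / 2 by rewrite !mulr_ge0 ?(ltW d_gt0) // invr_ge0.
have low : N%:R ^+ 2 * delta ^+ 3 / M%:R ^+ 2 / 32 <= tri g g g.
  apply: le_trans ggg; apply: le_trans (_ : sw * (delta ^+ 2 * (delta * N%:R / 2)) <= _); last first.
    apply: ler_wpM2l => //; apply: ler_pM => //; first exact: sqr_ge0.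
    by rewrite lerXn2r // nnegrE ltW.
  have -> : N%:R ^+ 2 * delta ^+ 3 / M%:R ^+ 2 / 32 =
     N%:R / (16 * M%:R ^+ 2) * (delta ^+ 2 * (delta * N%:R / 2)) by field; rewrite gt_eqF.
  apply: ler_wpM2r; first by rewrite mulr_ge0 ?sqr_ge0.
  by rewrite ler_pdivrMr ?mulr_gt0 // mulrC.
(* The 4800 in Y gives 3 * 25 / 4800 = 1/64, half of the constant 1/32 in [low]. *)
have up : 3 * (n ^+ 2 / Y) <= N%:R ^+ 2 * delta ^+ 3 / M%:R ^+ 2 / 64.
  have -> : N%:R ^+ 2 * delta ^+ 3 / M%:R ^+ 2 / 64 =
     3 * ((5 * N%:R) ^+ 2 * (delta ^+ 3 / (4800 * M%:R ^+ 2))) by field; rewrite gt_eqF.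
  rewrite ler_wpM2l //; apply: ler_pM => //; first exact: sqr_ge0.
  by rewrite lerXn2r // nnegrE ?(ltW n0) // mulr_ge0.
have : 0 < N%:R ^+ 2 * delta ^+ 3 / M%:R ^+ 2 :> R by rewrite !mulr_gt0 ?exprn_gt0 ?invr_gt0.
exact: (half_contra low gY up).
Qed.

End Count.

(** * Density increment *)

Lemma leq_exp2W (x y e : nat) : (x <= y -> x ^ e <= y ^ e)%N.
Proof. by case: e => // e xy; rewrite leq_exp2r. Qed.

(** K makes 12 N^2 / K^2 at most n^2 / X^(3e+12), as [energy_bound] asks; L is long enough for
    [smoothing]. The bounds for a (Schmidt in dimension m) and q0 (Dirichlet with r frequencies) are
    powers of L, and the exponent of T adds up to X^(10e+30) because 3 + 3 (2e+6) + 2 (e+3) + (2e+3)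
    = 10e + 30. *)
Lemma star_params (X e T N : nat) : (2 ^ 14 <= X)%N -> (X ^ (10 * e + 30) <= T)%N ->
  (T ^ (X ^ (10 * e + 30)) <= N)%N ->
  let K := (X ^ (2 * e + 6))%N in let L := (T ^ (4000 * K ^ 3))%N in
  [/\ (0 < T)%N, (0 < K)%N, (6 * K * T * (24 * K * T) ^ (1536 * K ^ 3) <= L)%N, (8 * K <= L)%N &
    forall m r a q0 : nat, (0 < m)%N -> (m <= (X ^ (e + 3)).+1)%N -> (r <= X ^ (2 * e + 3))%N ->
      (8 * m <= L ^ 3)%N /\ ((a <= (L ^ 3) ^ (100 * m ^ 2))%N ->
        (q0 <= (4 * (L * (L ^ 3) ^ (100 * m ^ 2))) ^ r)%N -> (K * (a * q0 * L) <= N)%N)].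
Proof.
move=> X_ge T_ge N_ge K L.
have X4 : (4000 <= X)%N by apply: leq_trans X_ge.
have X0 : (0 < X)%N by apply: leq_trans X4.
have Xm a b : (a <= b)%N -> (X ^ a <= X ^ b)%N by move=> ab; apply: leq_pexp2l.
have T0 : (0 < T)%N by apply: leq_trans T_ge; rewrite expn_gt0 X0.
have K0 : (0 < K)%N by rewrite expn_gt0 X0.
have K30 : (0 < K ^ 3)%N by rewrite expn_gt0 K0.
have XK : (X * K <= T)%N by rewrite /K -expnS; apply: leq_trans T_ge; apply: Xm; lia.
have TL : (T <= L)%N.
  rewrite /L -{1}[T]expn1; apply: leq_pexp2l => //; rewrite muln_gt0 K30 //.
have L0 : (0 < L)%N by apply: leq_trans TL.
have K24 : (24 * K <= T)%N by apply: leq_trans XK; rewrite leq_mul2r (leq_trans _ X4) ?orbT.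
split=> //.
- apply: leq_trans (_ : T * T * (T * T) ^ (1536 * K ^ 3) <= _)%N.
    apply: leq_mul; first by apply: leq_mul => //; apply: leq_trans K24; rewrite leq_mul2r orbT.
    by apply: leq_exp2W; apply: leq_mul.
  rewrite mulnn -expnM -expnD /L; apply: leq_pexp2l => //.
  by move: (K ^ 3)%N K30 => k k0; lia.
- by apply: leq_trans TL; apply: leq_trans K24; rewrite leq_mul2r orbT.
move=> m r a q0 m0 mle rle; split.
  apply: leq_trans (_ : L <= _)%N; last by rewrite -{1}[L]expn1; apply: leq_pexp2l.
  apply: leq_trans TL; apply: leq_trans T_ge; apply: leq_trans (_ : X * X ^ (e + 3) <= _)%N.
    have x1 : (0 < X ^ (e + 3))%N by rewrite expn_gt0 X0.
    apply: leq_trans (_ : 16 * X ^ (e + 3) <= _)%N; first by move: (X ^ (e + 3))%N mle x1 => y; lia.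
    by rewrite leq_mul2r (leq_trans _ X4) ?orbT.
  by rewrite -expnS; apply: Xm; lia.
move=> ale q0le; apply: leq_trans N_ge.
pose M2 := (m ^ 2)%N.
have M20 : (0 < M2)%N by rewrite expn_gt0 m0.
have eL : (L * (L ^ 3) ^ (100 * m ^ 2) = L ^ (300 * M2 + 1))%N.
  by rewrite -expnM -expnS; congr (_ ^ _)%N; rewrite -/M2; lia.
have L4 : (4 <= L)%N by apply: leq_trans TL; apply: leq_trans K24; move: K0; lia.
have q0le' : (q0 <= L ^ ((300 * M2 + 2) * r))%N.
  apply: leq_trans q0le _; rewrite eL expnM; apply: leq_exp2W.
  by rewrite [(300 * M2 + 2)%N]addnS expnS; apply: leq_mul.
have ale' : (a <= L ^ (300 * M2))%N.
  by apply: leq_trans ale _; rewrite -expnM -/M2; apply: leq_pexp2l => //; lia.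
have KL : (K <= L)%N by apply: leq_trans TL; apply: leq_trans K24; rewrite leq_pmull.
apply: leq_trans (_ : L * (L ^ (300 * M2) * L ^ ((300 * M2 + 2) * r) * L) <= _)%N.
  by apply: leq_mul => //; apply: leq_mul => //; apply: leq_mul.
rewrite -expnD -expnSr -expnS /L -expnM; apply: leq_pexp2l => //.
apply: leq_trans (_ : X * K ^ 3 * (X * M2 * r.+1) <= _)%N.
  apply: leq_mul; first by rewrite leq_mul2r X4 orbT.
  apply: leq_trans (_ : 302 * M2 * r.+1 <= _)%N; first by nia.
  by rewrite leq_mul2r leq_mul2r (leq_trans _ X4) ?orbT.
have x1 : (0 < X ^ (e + 3))%N by rewrite expn_gt0 X0.
have x2 : (0 < X ^ (2 * e + 3))%N by rewrite expn_gt0 X0.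
have hM2 : (M2 <= 4 * (X ^ (e + 3)) ^ 2)%N.
  rewrite (_ : 4 = 2 ^ 2)%N // -expnMn; apply: leq_exp2W.
  by move: (X ^ (e + 3))%N mle x1 => y; lia.
have hr : (r.+1 <= 2 * X ^ (2 * e + 3))%N by move: (X ^ (2 * e + 3))%N rle x2 => y; lia.
have hh : (M2 * r.+1 <= 8 * ((X ^ (e + 3)) ^ 2 * X ^ (2 * e + 3)))%N.
  apply: leq_trans (leq_mul hM2 hr) _; apply: eq_leq; ring.
apply: leq_trans (_ : X * K ^ 3 * (X * (X * ((X ^ (e + 3)) ^ 2 * X ^ (2 * e + 3)))) <= _)%N.
  rewrite -[(X * M2 * _)%N]mulnA; apply: leq_mul => //; apply: leq_mul => //.
  apply: leq_trans hh _; apply: leq_mul => //; exact: leq_trans X4.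
have ex a1 b1 c1 : (X * X ^ a1 * (X * (X * (X ^ b1 * X ^ c1))) = X ^ (3 + (a1 + (b1 + c1))))%N.
  rewrite (expnD X 3) (expnD X a1) (expnD X b1) !expnS expn0 muln1.
  by move: (X ^ a1)%N (X ^ b1)%N (X ^ c1)%N => u v w; ring.
by rewrite /K -!expnM ex; apply: Xm; lia.
Qed.

Lemma mem_bigcup_seq (V I : finType) (ps : seq I) (c : I -> {set V}) P x :
  P \in ps -> x \in c P -> x \in \bigcup_(p <- ps) c p.
Proof.
move=> Pps xP; elim: ps Pps => // p ps IH; rewrite big_cons !inE => /predU1P[<-|/IH->].
  by rewrite xP.
by rewrite orbT.
Qed.

Lemma card_bigcup_seq (V I : finType) (ps : seq I) (c : I -> {set V}) k :
  (forall p, p \in ps -> #|c p| <= k)%N -> (#|\bigcup_(p <- ps) c p| <= size ps * k)%N.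
Proof.
elim: ps => [|p ps IH] h; first by rewrite big_nil cards0.
rewrite big_cons /= mulSn; apply: leq_trans (_ : #|c p| + #|\bigcup_(p <- ps) c p| <= _)%N.
  by rewrite cardsU leq_subr.
apply: leq_add; first by apply: h; rewrite mem_head.
by apply: IH => p' h'; apply: h; rewrite inE h' orbT.
Qed.

Lemma subn_mul_rev (j d t u : nat) : (d * (t + u) <= j)%N -> (j - d * u = j - d * (t + u) + d * t)%N.
Proof. by rewrite mulnDr; move: (d * t)%N (d * u)%N => a b; lia. Qed.

Lemma exp_aux e : (3 * e + 12 <= (2 * e + 6) * 2)%N.
Proof. by lia. Qed.

Lemma exp_aux2 e : (2 * e + 3 = e + 3 + e)%N.
Proof. by lia. Qed.

Lemma norm_bool_sub (R : realType) (b : bool) (t : R) : 0 <= t <= 1 -> `|b%:R - t| <= 1.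
Proof.
have hb : 0 <= (b%:R : R) <= 1 by case: b; rewrite ?lexx ?ler01.
by move: (b%:R) hb => c /andP[c0 c1] /andP[u v]; rewrite ler_norml; apply/andP; split; lra.
Qed.

Lemma sqr_affine_ge (R : realType) (x : R) : 0 <= x -> 12 * x ^+ 2 <= (4 * x + 1) ^+ 2.
Proof.
move=> x0; have := sqr_ge0 x; have -> : (4 * x + 1) ^+ 2 = 16 * x ^+ 2 + 8 * x + 1 by ring.
lra.
Qed.

(** * A competitor uncorrelated with F *)

Section Star.
Variables (R : realType) (N T X p e : nat) (A : pred nat) (gam : R).
Hypothesis eE : piece_exp = e.
Let K := (X ^ (2 * e + 6))%N.
Let L := (T ^ (4000 * K ^ 3))%N.
Hypotheses (X_ge : (2 ^ 14 <= X)%N) (pE : (p.+2 = 4 * N + 1)%N).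
Hypotheses (T_ge : (X ^ (10 * e + 30) <= T)%N) (N_ge : (T ^ (X ^ (10 * e + 30)) <= N)%N).
Hypotheses (AN : forall x, A x -> (x < N)%N) (gam01 : 0 <= gam <= 1).
Hypothesis hered : forall y d : nat, (0 < d)%N -> (y + T.-1 * d < N)%N ->
  \sum_(t < T) (A (y + t * d)%N)%:R <= gam * T%:R.
Let params := star_params X_ge T_ge N_ge.
Let T0 : (0 < T)%N. Proof. by case: params. Qed.
Let K0 : (0 < K)%N. Proof. by case: params. Qed.
Let L_ge : (6 * K * T * (24 * K * T) ^ (1536 * K ^ 3) <= L)%N. Proof. by case: params. Qed.
Let KL : (8 * K <= L)%N. Proof. by case: params. Qed.
Let L0 : (0 < L)%N. Proof. by apply: leq_trans KL; rewrite muln_gt0 K0. Qed.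

Section Cells.
Variable q : nat.
Hypothesis q_gt0 : (0 < q)%N.

Let acell (si : nat * nat) (j : nat) : R := (A (si.1 * (q * L) + si.2 + j * q)%N)%:R.

Lemma cell_div s i j : (i < q)%N -> (j < L)%N ->
  [/\ ((s * (q * L) + i + j * q) %/ (q * L) = s)%N,
      (((s * (q * L) + i + j * q) %% (q * L)) %% q = i)%N &
      (((s * (q * L) + i + j * q) %% (q * L)) %/ q = j)%N].
Proof.
move=> iq jL; have lt : (i + j * q < q * L)%N.
  by apply: leq_trans (_ : j.+1 * q <= _)%N; [rewrite mulSn ltn_add2r | rewrite mulnC leq_mul2l jL orbT].
have qL : (0 < q * L)%N by apply: leq_ltn_trans lt.
rewrite -addnA divnMDl // (divn_small lt) addn0 modnMDl (modn_small lt); split=> //.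
  by rewrite addnC modnMDl modn_small.
by rewrite addnC divnMDl // divn_small // addn0.
Qed.

(** The average runs over a T-term progression of step d q below N, where [hered] bounds the
    density. *)
Lemma smoothed_le s i d j : (0 < d)%N -> (s * (q * L) + i + j * q < N)%N ->
  0 <= smoothed T (acell (s, i)) d j <= gam.
Proof.
move=> d0 xN; have /andP[gm0 gm1] := gam01; rewrite /smoothed; case: ltnP => [_|Dj].
  by rewrite lexx.
have TR : 0 < T%:R :> R by rewrite ltr0n.
rewrite mulr_ge0 ?invr_ge0 ?sumr_ge0 //= ler_pdivrMl // mulrC.
rewrite (reindex_inj rev_ord_inj) /=.
pose y0 := (s * (q * L) + i + (j - d * T.-1) * q)%N.
have e1 t : (t < T)%N -> (j - d * (T - t.+1) = j - d * T.-1 + d * t)%N.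
  move=> tT; have [u eu] : exists u, (T = (t + u).+1)%N.
    by exists (T - t.+1)%N; rewrite -addSn subnKC.
  have -> : T.-1 = (t + u)%N by rewrite eu.
  have -> : (T - t.+1 = u)%N by rewrite eu -addSn addKn.
  by apply: subn_mul_rev; move: Dj; rewrite eu.
have := @hered y0 (d * q)%N; rewrite muln_gt0 d0 q_gt0 => hh.
apply: le_trans (hh isT _); last first.
  apply: leq_trans xN; rewrite ltnS /y0; apply: eq_leq.
  have -> : (T.-1 * (d * q) = d * T.-1 * q)%N by rewrite mulnA [(T.-1 * d)%N]mulnC.
  by rewrite -addnA -mulnDl subnK.
rewrite le_eqVlt; apply/orP; left; apply/eqP; apply: eq_bigr => t _; rewrite /acell /=.
by congr ((A _)%:R); rewrite e1 // /y0 mulnDl addnA; congr (_ + _)%N; rewrite mulnA [(d * t)%N]mulnC.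
Qed.

(** Each cell receives its own step d. Uniformity in xi is free, since [zchi R xi ^+ j] is an
    exponential in j that merges with th. Beyond the last full cell the value is 0. *)
Lemma exists_smoothing : exists2 h' : nat -> R,
  (forall x, 0 <= h' x <= if (x < N)%N then gam else 0) &
  forall (s i : nat) (xi : 'I_p.+2) (th : R), (s < N %/ (q * L))%N -> (i < q)%N ->
  normc (\sum_(j < L) ((A (s * (q * L) + i + j * q)%N)%:R - h' (s * (q * L) + i + j * q)%N)%:C
     * zchi R xi ^+ j * ec (th * j%:R)) <= L%:R / K%:R.
Proof.
have qL : (0 < q * L)%N by rewrite muln_gt0 q_gt0.
have ex (si : nat * nat) : exists d : nat, (0 < d)%N /\ forall th : R,
    normc (\sum_(j < L) (acell si j - smoothed T (acell si) d j)%:C * ec (th * j%:R)) <= L%:R / K%:R.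
  have a01 j : 0 <= acell si j <= 1 by rewrite /acell; case: (A _); rewrite ?lexx ?ler01.
  by have [d d0 hd] := smoothing T0 K0 L_ge a01; exists d.
have [d hd] := choice ex.
pose Q := (N %/ (q * L))%N.
have QN : (Q * (q * L) <= N)%N by apply: leq_divM.
have /andP[gm0 gm1] := gam01.
pose cell x := ((x %/ (q * L))%N, ((x %% (q * L)) %% q)%N).
exists (fun x => if (x < Q * (q * L))%N then
   smoothed T (acell (cell x)) (d (cell x)) ((x %% (q * L)) %/ q)%N else 0).
  move=> x; case: (ltnP x (Q * (q * L))) => [xQ|_]; last by rewrite lexx andTb; case: ifP; rewrite ?lexx.
  have xN : (x < N)%N by apply: leq_trans QN.
  rewrite xN; apply: smoothed_le; first by have [] := hd (cell x).
  by rewrite -addnA [(_ %% q + _)%N]addnC -divn_eq -divn_eq.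
move=> s i xi th sQ iq; have [_ hs] := hd (s, i).
have := hs ((xi : nat)%:R / p.+2%:R + th); apply: le_trans; rewrite le_eqVlt; apply/orP; left; apply/eqP.
congr normc; apply: eq_bigr => j _; have [e1 e2 e3] := cell_div s iq (ltn_ord j).
rewrite /cell e1 e2 e3; have -> : (s * (q * L) + i + j * q < Q * (q * L))%N.
  apply: leq_trans (_ : s.+1 * (q * L) <= _)%N; last by rewrite leq_mul2r sQ orbT.
  rewrite mulSn [(q * L + _)%N]addnC -addnA ltn_add2l.
  by apply: leq_trans (_ : j.+1 * q <= _)%N; [rewrite mulSn ltn_add2r | rewrite mulnC leq_mul2l ltn_ord orbT].
rewrite -mulrA; congr (_ * _); rewrite mulrDl ecD; congr (_ * _).
by rewrite mulrC ecM.
Qed.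

End Cells.

Variable F : 'I_p.+2 -> R.
Hypothesis F1 : forall x, `|F x| <= 1.
Let n : R := #|'I_p.+2|%:R.

Lemma star : exists2 f' : 'I_p.+2 -> R, forall x, 0 <= f' x <= @envelope R N p gam x &
  \sum_u normc (amb (@zchi R p) F F u) ^+ 3 *
     normc (amb (@zchi R p) (fun x => @set_indicator R p A x - f' x) F u) <= 3 * n ^+ 5 / X%:R ^+ 2.
Proof.
have chiP := zchi_is_char R p.
have [ps [sps hps cov]] := largeamb_cover chiP F1 X_ge.
rewrite eE in sps hps.
(* Joining all spectra lets a single q0 produce the strings of every piece. *)
pose Sall := \bigcup_(P <- ps) P.2.
have rle : (#|Sall| <= X ^ (2 * e + 3))%N.
  apply: leq_trans (@card_bigcup_seq _ _ ps (fun P => P.2) (X ^ e)%N _) _.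
    by move=> P /hps[_ [_ ? _]].
  apply: leq_trans (leq_mul sps (leqnn _)) _; rewrite -expnD.
  by rewrite exp_aux2.
(* The successor keeps the dimension positive even without pieces. *)
pose m := (size ps).+1.
(* The strings are used at indices a l with l < L and a bounded by Schmidt's theorem, hence this
   length. Dirichlet with 4 * L1 keeps the phases within 1/4 of integers, where the real part is
   nonnegative. *)
pose L1 := (L * (L ^ 3) ^ (100 * m ^ 2))%N.
have LB : (0 < L ^ 3)%N by rewrite expn_gt0 L0.
have LB2 : (0 < (L ^ 3) ^ (100 * m ^ 2))%N by rewrite expn_gt0 LB.
have L10 : (0 < L1)%N by rewrite muln_gt0 L0.
have L40 : (0 < 4 * L1)%N by rewrite muln_gt0.
pose th (i : 'I_#|Sall|) : R := ((enum_val i : 'I_p.+2) : nat)%:R / p.+2%:R.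
have [q0 /andP[q00 q0le] hq0] := dirichlet th L40.
have L1R : 0 < L1%:R :> R by rewrite ltr0n.
have pos (P : {set 'I_p.+2 * 'I_p.+2} * {set 'I_p.+2}) : P \in ps -> forall l k, (l <= L1)%N -> k \in P.2 ->
    0 <= complex.Re (zchi R (k * (q0%:R *+ l))).
  move=> Pps l k lL kP.
  have kS : k \in Sall by apply: (mem_bigcup_seq (c := fun P => P.2) Pps).
  have nk : @nearz R (q0%:R * ((k : nat)%:R / p.+2%:R)) (4 * L1)%:R^-1.
    by have := hq0 (enum_rank_in kS k); rewrite /th enum_rankK_in.
  have -> : k * (q0%:R *+ l) = (k * (q0 * l))%N%:R by rewrite natrM natrM natr_Zp mulr_natr.
  rewrite zchi_nat.
  have -> : (k * (q0 * l))%:R / p.+2%:R = l%:R * (q0%:R * ((k : nat)%:R / p.+2%:R)) :> R.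
    by rewrite natrM natrM; ring.
  have [z hz] := nearz_muln l nk; apply: (@Re_ec_ge0 _ _ z); apply: le_trans hz _.
  rewrite natrM invfM mulrCA -[leRHS]mulr1 ler_wpM2l ?invr_ge0 //.
  by rewrite ler_pdivrMr // mul1r ler_nat.
have ex (P : {set 'I_p.+2 * 'I_p.+2} * {set 'I_p.+2}) : exists ee : 'I_p.+2, P \in ps ->
    forall l, (l <= L1)%N ->
    (q0%:R *+ l, ee *+ l) \in diffset (nsumset 2 P.1) (nsumset 2 P.1).
  case: (boolP (P \in ps)) => [Pps|_]; last by exists 0.
  have [_ [_ _ h]] := hps P Pps; have [ee hee] := h q0%:R L1 (pos P Pps).
  by exists ee.
have [ee hee] := choice ex.
(* Scaling both q0 and the slope [ee] by a multiplies the mixed phase by a^2, so these are the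
   numbers to approximate. *)
pose al (i : 'I_m) : R := ((ee (nth (set0, set0) ps i)) : nat)%:R * q0%:R / p.+2%:R.
have mle : (m <= (X ^ (e + 3)).+1)%N by rewrite ltnS.
have [_ _ _ _ hpar] := params.
have [mB _] := hpar m #|Sall| 0%N 0%N isT mle rle.
have [a /andP[a0 ale] ha] := @schmidt R m (L ^ 3)%N al isT mB.
have [_ hN] := hpar m #|Sall| a q0 isT mle rle.
have KqL := hN ale q0le.
pose q := (a * q0)%N.
have q_gt0 : (0 < q)%N by rewrite muln_gt0 a0.
have [h' h'b h'c] := exists_smoothing q_gt0.
pose h x : R := (A x)%:R - h' x.
have /andP[gm0 gm1] := gam01.
have h'1 x : 0 <= h' x <= 1.
  by have /andP[u v] := h'b x; rewrite u (le_trans v) //; case: ifP.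
have h1 x : `|h x| <= 1.
  exact: norm_bool_sub (h'1 x).
exists (fun x => h' x); first by move=> x; exact: h'b.
pose H (x : 'I_p.+2) : R := set_indicator R A x - h' x.
have Np : (N <= p.+2)%N by apply: ltnW; exact: Zp_N_lt.
have H1 x : `|H x| <= 1 by exact: h1.
have ambE u : amb (@zchi R p) H F u = namb (@zchi R p) N h F u.
  rewrite /amb /namb -(sum_ord_if (fun x => (h x * F (x%:R + u.1))%:C * zchi R (u.2 * x%:R)) Np).
  apply: eq_bigr => x _; rewrite natr_Zp; case: ifP => // xN.
  have -> : H x = 0.
    have := h'b x; rewrite xN -eq_le => /eqP e0; rewrite /H /set_indicator -e0 subr0.
    by case hx : (A x) => //; rewrite (AN hx) in xN.
  by rewrite mul0r rmorph0 mul0r.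
have KR : 0 < K%:R :> R by rewrite ltr0n.
have LR : 0 < L%:R :> R by rewrite ltr0n.
pose beta : R := 12 * N%:R ^+ 2 / K%:R ^+ 2.
have beta0 : 0 <= beta by rewrite divr_ge0 ?mulr_ge0 ?exprn_ge0 // ltW.
apply: (energy_bound chiP H1 F1 X_ge sps cov) => P Pps.
have [sC [cD _ _]] := hps P Pps; split=> //; exists beta.
  split=> //; apply: le_trans (_ : beta * K%:R ^+ 2 <= _).
    rewrite ler_wpM2l // -!natrX ler_nat /K -expnM leq_pexp2l //; last exact: (exp_aux e).
    by apply: leq_trans X_ge.
  rewrite /beta divfK ?gt_eqF ?exprn_gt0 // card_ord pE natrD natrM.
  exact: sqr_affine_ge.
pose eta := ee P *+ a.
have iP : (index P ps < m)%N by rewrite ltnS index_size.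
have := ha (Ordinal iP); rewrite /al /= nth_index // => hph.
(* The precision L^-3 beats the L^2 accumulated over a cell: 8 L^2 / L^3 <= 1 / K since 8K <= L. *)
have phase : L%:R ^+ 2 * normc (zchi R (eta * q%:R) - 1) <= K%:R^-1.
  have -> : eta * q%:R = (ee P * a * (a * q0))%N%:R.
    by rewrite /eta /q !natrM natr_Zp [ee P * a%:R]mulr_natr.
  rewrite zchi_nat.
  have -> : (ee P * a * (a * q0))%:R / p.+2%:R = a%:R ^+ 2 * ((ee P : nat)%:R * q0%:R / p.+2%:R) :> R.
    by rewrite !natrM; ring.
  apply: le_trans (ler_wpM2l _ (normc_ec1_nearz hph)) _; first exact: sqr_ge0.
  have -> : L%:R ^+ 2 * (8 * (L ^ 3)%:R^-1) = 8 / L%:R :> R.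
    by rewrite natrX; field; rewrite gt_eqF.
  rewrite ler_pdivrMr // mulrC ler_pdivlMr // -natrM ler_nat //.
apply: le_trans (_ : #|diffset (nsumset 3 P.1) (nsumset 2 P.1)|%:R * beta <= _); last first.
  by rewrite ler_wpM2r // ler_nat.
apply: (@string_sum R _ P.1 (fun u => normc (amb (@zchi R p) H F u) ^+ 2) L
   (fun l => (q%:R *+ l, eta *+ l))) => //.
- by move=> u; apply: sqr_ge0.
- move=> l lL; have -> : (q%:R *+ l, eta *+ l) = (q0%:R *+ (a * l), ee P *+ (a * l)) :> 'I_p.+2 * 'I_p.+2.
    by congr pair; [rewrite /q natrM mulr_natl mulrnA | rewrite /eta mulrnA].
  apply: hee => //; rewrite mulnC; apply: leq_mul => //; exact: ltnW.
move=> v; under eq_bigr do rewrite ambE.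
exact: (@string_bound R _ _ chiP N q L K h F v eta q_gt0 L0 K0 h1 F1 h'c KqL phase).
Qed.

End Star.

Lemma energy_contra (R : realType) (n X : R) : 6 <= X -> X <= n ->
  n ^+ 5 / X - 1 <= 3 * n ^+ 5 / X ^+ 2 -> False.
Proof.
move=> X6 Xn; have X0 : 0 < X by lra.
have n0 : 0 < n by lra.
have n1 : 1 <= n by lra.
have v4 : n <= n ^+ 5 / X.
  rewrite ler_pdivlMr // (_ : n ^+ 5 = n * n ^+ 4); last by rewrite -exprS.
  rewrite ler_pM2l //; apply: le_trans Xn _; rewrite -{1}[n]expr1.
  exact: ler_weXn2l.
have -> : 3 * n ^+ 5 / X ^+ 2 = (n ^+ 5 / X) * (3 / X) by field; rewrite gt_eqF.
have x2 : 3 / X <= 2^-1 by rewrite ler_pdivrMr //; lra.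
move: (n ^+ 5 / X) v4 => v v4.
have : v * (3 / X) <= v * 2^-1 by rewrite ler_wpM2l //; lra.
lra.
Qed.

Section DensityIncrement.
Variables (R : realType) (M Z e : nat).
Hypotheses (M_gt0 : (0 < M)%N) (Z_gt0 : (0 < Z)%N) (eE : piece_exp = e).
(** Z stands for an integer at least 1 / delta. [X] is Y^8 because [U3_lower] bounds U3 below by n^4
    / Y^8, and [W] is the exponent relating T to N in [star]. *)
Let Y := (4800 * M ^ 2 * Z ^ 3)%N.
Let X := (Y ^ 8)%N.
Let W := (X ^ (10 * e + 30))%N.

Lemma Y_ge : (4800 * M <= Y)%N.
Proof.
rewrite /Y -mulnA leq_mul2l /=; apply: leq_trans (_ : M ^ 2 <= _)%N.
  by rewrite -mulnn leq_pmull.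
by rewrite leq_pmulr // expn_gt0 Z_gt0.
Qed.

Lemma Y_le_X : (Y <= X)%N.
Proof.
rewrite /X -{1}[Y]expn1; apply: leq_pexp2l => //.
by apply: leq_trans Y_ge; rewrite muln_gt0 M_gt0.
Qed.

Lemma X_large : (2 ^ 14 <= X)%N.
Proof.
have Y1 : (2 ^ 7 <= Y)%N by apply: leq_trans Y_ge; apply: leq_trans (leq_pmulr _ M_gt0).
have Y0 : (0 < Y)%N by apply: leq_trans Y1.
rewrite (_ : 14 = 7 * 2)%N // expnM; apply: leq_trans (leq_exp2W 2 Y1) _.
exact: leq_pexp2l.
Qed.

Lemma X_le_W : (X <= W)%N.
Proof.
rewrite /W -{1}[X]expn1; apply: leq_pexp2l; first by apply: leq_trans X_large.
by rewrite addnS.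
Qed.

(** Otherwise [star] provides a competitor for the near-minimiser, and U3 >= n^4 / X yields n^5 / X
    - 1 <= 3 n^5 / X^2, absurd for 6 <= X <= n. *)
Lemma density_increment (N T : nat) (S : nat -> Prop) (A : pred nat) (delta gam : R) :
  syndetic M S -> no_ap3 S A -> (forall x, A x -> (x < N)%N) ->
  0 < delta -> delta <= gam -> gam <= 25 / 24 * delta -> gam <= 1 -> 1 <= delta * Z%:R ->
  delta * N%:R <= \sum_(x < N) (A x)%:R -> (W <= T)%N -> (T ^ W <= N)%N ->
  exists y d : nat, [/\ (0 < d)%N, (y + T.-1 * d < N)%N &
    gam * T%:R < \sum_(t < T) (A (y + t * d)%N)%:R].
Proof.
move=> hS noap AN d0 dg gd g1 dZ dA WT TN; apply: contrapT => none.
have hered y d : (0 < d)%N -> (y + T.-1 * d < N)%N ->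
    \sum_(t < T) (A (y + t * d)%N)%:R <= gam * T%:R.
  by move=> dd yd; rewrite leNgt; apply/negP => lt; apply: none; exists y, d.
have W0 : (0 < W)%N by apply: leq_trans X_le_W; apply: leq_trans X_large.
have T0 : (0 < T)%N by exact: leq_trans W0 WT.
have TW : (T <= T ^ W)%N by rewrite -{1}[T]expn1; apply: leq_pexp2l.
have XN : (X <= N)%N by exact: leq_trans (leq_trans (leq_trans X_le_W WT) TW) TN.
have MN : (8 * M <= N)%N.
  apply: leq_trans (leq_trans (leq_trans Y_ge Y_le_X) XN).
  by rewrite leq_mul2r orbT.
have N0 : (0 < N)%N by apply: leq_trans MN; rewrite muln_gt0.
have [p pE] : exists p, (p.+2 = 4 * N + 1)%N.
  by exists (4 * N).-1; rewrite prednK ?muln_gt0 // addn1.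
have chiP := zchi_is_char R p.
pose f := @set_indicator R p A; pose env := @envelope R N p gam.
have gm0 : 0 < gam by apply: lt_le_trans dg.
have f01 x : 0 <= f x <= 1 by rewrite /f /set_indicator; case: (A x); rewrite ?lexx ?ler01.
have e01 x : 0 <= env x <= 1.
  by rewrite /env /envelope; case: ifP => _; rewrite ?lexx ?ler01 // g1 ltW.
have [g hg hmin] := near_minimiser chiP f01 e01.
have g01 x : 0 <= g x <= 1.
  by have /andP[a b] := hg x; have /andP[_ c] := e01 x; rewrite a (le_trans b c).
pose F (x : 'I_p.+2) := f x - g x.
have F1 x : `|F x| <= 1 by apply: norm_bool_sub.
have gm01 : 0 <= gam <= 1 by rewrite ltW.
have [f' hf' bnd] := star eE X_large pE WT TN AN gm01 hered F1.
pose n : R := #|'I_p.+2|%:R.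
have hm : \sum_u normc (amb (@zchi R p) F F u) ^+ 4 - 1 <=
    \sum_u normc (amb (@zchi R p) F F u) ^+ 3 *
      normc (amb (@zchi R p) (fun x => f x - f' x) F u) := hmin f' hf'.
rewrite (sum_amb4 chiP) in hm.
have low : n ^+ 4 <= Y%:R ^+ 8 * U3 F :=
  U3_lower M_gt0 MN pE hS noap AN d0 dg gd g1 dZ dA hg.
have X0 : 0 < X%:R :> R by rewrite ltr0n; apply: leq_trans X_large.
apply: (@energy_contra R n X%:R).
- by rewrite ler_nat; apply: leq_trans X_large.
- rewrite /n card_ord ler_nat; apply: leq_trans XN _; apply: ltnW; exact: Zp_N_lt.
apply: le_trans (le_trans _ hm) bnd; rewrite lerD2r ler_pdivrMr // exprS -mulrA.
by rewrite ler_wpM2l ?ler0n // mulrC /X natrX.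
Qed.

(** Here j bounds the number of increments left before density 1. Passing to a progression of step d
    replaces S by the s with d s in S, syndetic with the same M; Z and W can be kept because the
    density only grows. *)
Lemma iterated_bound (j : nat) : forall (N : nat) (S : nat -> Prop) (A : pred nat) (delta : R),
  (0 < N)%N -> syndetic M S -> no_ap3 S A -> (forall x, A x -> (x < N)%N) ->
  0 < delta -> 1 <= delta * Z%:R -> delta * N%:R <= \sum_(x < N) (A x)%:R ->
  1 < (25 / 24) ^+ j * delta -> (N < W ^ (W ^ j.+1))%N.
Proof.
have card_le N (A : nat -> nat) (B : pred nat) : \sum_(x < N) (B (A x))%:R <= N%:R :> R.
  rewrite -[X in _ <= X%:R]card_ord -sumr_const; apply: ler_sum => x _.
  by case: (B _).
have W1 : (0 < W)%N by apply: leq_trans X_le_W; apply: leq_trans X_large.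
elim: j => [|j IH] N S A delta N0 hS noap AN d0 dZ dA hj.
  have NR : 0 < N%:R :> R by rewrite ltr0n.
  have := le_trans dA (card_le N id A); rewrite -[leRHS]mul1r ler_pM2r // => h.
  by move: hj; rewrite expr0 mul1r ltNge h.
rewrite ltnNge; apply/negP => TN.
(* T is exactly the bound of the induction hypothesis, which will therefore give T < T. *)
pose T := (W ^ (W ^ j.+1))%N.
have WT : (W <= T)%N.
  rewrite /T -{1}[W]expn1; apply: leq_pexp2l => //; rewrite expn_gt0 W1 //.
have TN' : (T ^ W <= N)%N by rewrite /T -expnM -expnSr.
have T0 : (0 < T)%N by apply: leq_trans WT.
(* If 25/24 delta exceeds 1, the increment is run with gam = 1 and would give a density above 1. *)
have [small|big] := leP (25 / 24 * delta) 1; last first.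
  have NR : 0 < N%:R :> R by rewrite ltr0n.
  have d1 : delta <= 1.
    by have := le_trans dA (card_le N id A); rewrite -[leRHS]mul1r ler_pM2r.
  have [y [d [_ _]]] := density_increment hS noap AN d0 d1 (ltW big) (lexx 1) dZ dA WT TN'.
  by rewrite mul1r ltNge (card_le T (fun t => (y + t * d)%N) A).
have dg : delta <= 25 / 24 * delta by lra.
have [y [d [dd yd dens]]] := density_increment hS noap AN d0 dg (lexx _) small dZ dA WT TN'.
pose A' : pred nat := fun t => (t < T)%N && A (y + t * d)%N.
have : (T < W ^ (W ^ j.+1))%N; last by rewrite ltnn.
apply: (IH T (fun s => S (d * s)%N) A' (25 / 24 * delta)) => //.
- move=> k k0; have [|t ht St] := hS (d * k)%N; first by rewrite muln_gt0 dd.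
  by exists t => //; rewrite mulnA.
- move=> x s s0 Ss /andP[_ a1] /andP[_ a2] /andP[_ a3].
  apply: (noap (y + x * d)%N (d * s)%N) => //; first by rewrite muln_gt0 dd.
    by move: a2; rewrite mulnDl addnA [(s * d)%N]mulnC.
  by move: a3; rewrite mulnDl addnA -mulnA [(s * d)%N]mulnC.
- by move=> x /andP[].
- lra.
- by apply: le_trans dZ _; rewrite ler_wpM2r.
- apply: ltW; apply: lt_le_trans dens _; rewrite le_eqVlt; apply/orP; left; apply/eqP.
  by apply: eq_bigr => t _; rewrite /A' ltn_ord.
- by move: hj; rewrite exprSr -mulrA.
Qed.

End DensityIncrement.


(* Logarithmic form of the bound *)
From mathcomp Require Import finmap.
From mathcomp Require Import all_classical all_reals all_analysis.

Local Open Scope classical_set_scope.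
Local Open Scope ring_scope.

Lemma Y_le_pow (R : realType) (M Z : nat) (q : R) : 4 <= q -> M%:R <= q -> Z%:R <= q ->
  (4800 * M ^ 2 * Z ^ 3)%:R <= q ^+ 12.
Proof.
move=> q4 Mq Zq; have q0 : 0 <= q by apply: le_trans q4.
have hc : 4800%:R <= q ^+ 7.
  apply: (@le_trans _ _ ((4 ^ 7)%N%:R)); first by rewrite ler_nat.
  by rewrite natrX lerXn2r // nnegrE.
move: hc; move: (4800)%N => c hc.
have -> : q ^+ 12 = q ^+ 7 * q ^+ 2 * q ^+ 3 by rewrite -!exprD.
rewrite natrM natrM !natrX; apply: ler_pM; rewrite ?mulr_ge0 ?exprn_ge0 //.
  by apply: ler_pM; rewrite ?exprn_ge0 // lerXn2r // nnegrE.
by rewrite lerXn2r // nnegrE.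
Qed.

Lemma loglog_le (R : realType) (N W j : nat) : (1 < N)%N -> (1 < W)%N ->
  (N < W ^ (W ^ j.+1))%N -> ln (ln (N%:R : R)) <= j.+2%:R * ln W%:R.
Proof.
move=> N1 W1 NW.
have WR1 : 1 < W%:R :> R by rewrite ltr1n.
have W0 : 0 < W%:R :> R by apply: lt_trans WR1.
have lnW0 : 0 < ln (W%:R : R) by apply: ln_gt0.
have NR1 : 1 < N%:R :> R by rewrite ltr1n.
have lnN0 : 0 < ln (N%:R : R) by apply: ln_gt0.
have lnN : ln (N%:R : R) <= W%:R ^+ j.+1 * ln W%:R.
  apply: le_trans (_ : ln (W%:R ^+ (W ^ j.+1)) <= _).
    rewrite ler_ln ?posrE ?exprn_gt0 ?(lt_trans ltr01 NR1) //.
    by rewrite -natrX ler_nat ltnW.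
  by rewrite lnXn // -natrX -[leLHS]mulr_natl.
apply: le_trans (_ : ln (W%:R ^+ j.+1 * ln W%:R) <= _).
  by rewrite ler_ln ?posrE ?mulr_gt0 ?exprn_gt0.
rewrite lnM ?posrE ?exprn_gt0 // lnXn // -[X in X + _ <= _]mulr_natl -[j.+2%:R]natr1 mulrDl mul1r.
by rewrite lerD2l ler_ln ?posrE //; apply: ltW; exact: ln_sublinear.
Qed.

Theorem theorem4p1 (R : realType) :
  exists C : R, 0 < C /\
    forall (M N : nat) (delta : R) (A : {fset int}) (S : set nat),
      (2 <= M)%N ->
      (2 <= N)%N ->
      0 < delta <= 1 / 2 ->
      (forall a : int, a \in A -> 1 <= a <= N%:Z) ->
      delta * N%:R <= #|` A|%:R ->
      S `<=` positive_nats ->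
      mult_syndetic M S ->
      ~ has_3AP_with_difference_in A S ->
      ln (ln (N%:R : R)) <= C * ln (delta^-1) * ln (M%:R / delta).
Proof.
have [e eE] : exists e, piece_exp = e by exists piece_exp.
pose lam : R := ln (25 / 24); pose mu : R := ln 2.
have lam0 : 0 < lam by apply: ln_gt0; lra.
have mu0 : 0 < mu by apply: ln_gt0; lra.
pose k := ((10 * e + 30) * 8 * 12)%N.
have k0 : 0 < k%:R :> R by rewrite ltr0n /k addnS.
(* About ln(1/delta) / lam increments by the factor 25/24 are possible; the 3 left over from
   rounding is absorbed by ln(1/delta) >= mu. The factor k is the exponent in W <= (M/delta)^k, from
   Y <= (M/delta)^12 and W = Y^(8 (10e+30)). *)
exists ((lam^-1 + 3 / mu) * k%:R); split.
  by rewrite mulr_gt0 // addr_gt0 ?invr_gt0 ?divr_gt0.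
move=> M N delta A S M2 N2 /andP[d0 d2] hA dA Spos hS noap.
have M0 : (0 < M)%N by apply: leq_trans M2.
have di0 : 0 < delta^-1 by rewrite invr_gt0.
have di2 : 2 <= delta^-1 by rewrite -[2]invrK lef_pV2 ?posrE ?invr_gt0 //; lra.
(* Least integer above 1 / delta; it is at most 2 / delta, hence at most M / delta. *)
pose Z := (Num.truncn delta^-1).+1.
have /andP[z1 z2] := truncn_itv (ltW di0).
have dZ : 1 <= delta * Z%:R.
  by rewrite -ler_pdivrMl // mulr1 ltW.
have Z0 : (0 < Z)%N by [].
have ZM : Z%:R <= M%:R / delta.
  apply: le_trans (_ : 2 * delta^-1 <= _).
    by rewrite /Z -natr1; move: z1; lra.
  by rewrite ler_wpM2r ?(ltW di0) // ler_nat.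
(* Translation by 1 moves A from [1, N] to the naturals below N and preserves progressions. *)
pose A0 : pred nat := fun x => x.+1%:Z \in A.
have A0N x : A0 x -> (x < N)%N by move=> /hA /andP[_]; rewrite lez_nat.
have dA0 : delta * N%:R <= \sum_(x < N) (A0 x)%:R.
  apply: le_trans dA _.
  have -> : \sum_(x < N) (A0 x)%:R = (size [seq x.+1%:Z | x <- iota 0 N & A0 x])%:R :> R.
    rewrite size_map size_filter -sum1_count natr_sum -(big_mkord predT (fun x => (A0 x)%:R)).
    rewrite /index_iota subn0 [RHS]big_mkcond /=; apply: eq_bigr => x _.
    by case: (A0 x).
  rewrite ler_nat; apply: uniq_leq_size; first exact: fset_uniq.
  move=> a aA; have /andP[a1 aN] := hA a aA.
  have [x ex] : exists x : nat, a = x.+1%:Z.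
    by exists (absz a).-1; move: a1; case: (a) => [[|b]|b].
  apply/mapP; exists x => //; rewrite mem_filter mem_iota /= add0n.
  have Ax : A0 x by rewrite /A0 -ex.
  by rewrite Ax (A0N _ Ax).
have hS0 : syndetic M S by move=> n n0; have [t [t1 St]] := hS n n0; exists t.
have noap0 : no_ap3 S A0.
  move=> x d _ Sd a1 a2 a3; by apply: noap; exists (x.+1%:Z), d; split.
pose ld := ln delta^-1.
have ld_mu : mu <= ld by rewrite /mu /ld ler_ln ?posrE.
have ld0 : 0 < ld by apply: lt_le_trans ld_mu.
pose j := (Num.truncn (ld / lam)).+1.
have q0 : 0 <= ld / lam by rewrite divr_ge0 // ltW.
have /andP[j1 j2] := truncn_itv q0.
have hj : 1 < (25 / 24) ^+ j * delta.
  have b0 : 0 < 25 / 24 :> R by lra.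
  rewrite -ltr_pdivrMr // mul1r -ltr_ln ?posrE ?exprn_gt0 // lnXn //.
  by rewrite -[ln (25 / 24) *+ j]mulr_natl -/ld -/lam -ltr_pdivrMr.
have N0 : (0 < N)%N by apply: leq_trans N2.
pose q : R := M%:R / delta.
have M2R : 2 <= M%:R :> R by rewrite ler_nat.
have q4 : 4 <= q.
  rewrite (_ : 4 = 2 * 2 :> R); last by rewrite -natrM.
  exact: ler_pM.
have q1 : 1 <= q by apply: le_trans q4; rewrite ler1n.
have qp : 0 < q by apply: lt_le_trans q1.
have Mq : M%:R <= q by rewrite ler_peMr // (le_trans _ di2) // ler1n.
have lq0 : 0 <= ln q by apply: ln_ge0.
have jle : j.+2%:R <= (lam^-1 + 3 / mu) * ld.
  rewrite mulrDl; have h1 : 3 <= 3 / mu * ld by rewrite mulrAC ler_pdivlMr // ler_wpM2l.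
  have h2 : j.+2%:R = (Num.truncn (ld / lam))%:R + 3 :> R by rewrite /j -addn3 natrD.
  by rewrite h2 [lam^-1 * ld]mulrC; apply: lerD.
have YR := Y_le_pow q4 Mq ZM.
have YM := Y_ge M0 Z0.
have := iterated_bound M0 Z0 eE N0 hS0 noap0 A0N d0 dZ dA0 hj.
move: YR YM; move: (4800 * M ^ 2 * Z ^ 3)%N => Y YR YM NW.
have Y2 : (2 <= Y)%N by apply: leq_trans (leq_trans M2 _) YM; apply: leq_pmull.
have Yp : 0 < Y%:R :> R by rewrite ltr0n; apply: leq_trans Y2.
pose W := ((Y ^ 8) ^ (10 * e + 30))%N.
have W2 : (2 <= W)%N.
  apply: leq_trans Y2 _; rewrite /W -expnM -{1}[Y]expn1; apply: leq_pexp2l; first by rewrite -(ltr0n R).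
  by rewrite muln_gt0 addnS.
have lnW0 : 0 < ln (W%:R : R) by apply: ln_gt0; rewrite ltr1n.
have lnW : ln (W%:R : R) <= k%:R * ln q.
  rewrite /W -expnM natrX lnXn // -[leLHS]mulr_natl.
  have -> : k%:R = (8 * (10 * e + 30))%:R * 12%:R :> R by rewrite -natrM /k [(8 * _)%N]mulnC.
  rewrite -mulrA ler_wpM2l ?ler0n //.
  apply: le_trans (_ : ln (q ^+ 12) <= _); first by rewrite ler_ln ?posrE ?exprn_gt0.
  by rewrite lnXn // -[leLHS]mulr_natl.
apply: le_trans (@loglog_le R N W j N2 W2 NW) _.
apply: le_trans (_ : (lam^-1 + 3 / mu) * ld * (k%:R * ln q) <= _).
  by apply: ler_pM => //; apply: ltW.
rewrite le_eqVlt; apply/orP; left; apply/eqP; rewrite -/ld -/q.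
have aux (x y z w : R) : x * y * (z * w) = x * z * y * w by ring.
exact: aux.
Qed.
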